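(* Let $\mathcal{H}$ be a family of graphs. Let $G$ be an $n$-vertex graph with $\text{tree-}\pi_{\mathcal{H}}(G)\le k$. There is a set $X\subseteq V(G)$ such that every component of $G-N[X]$ has at most $n/2$ vertices, where \begin{enumerate} \item $|X|=\mathcal{O}(kt)$ if $\mathcal{H}$ contains a path on $t$ vertices, and \item $|X|=\mathcal{O}(k^3\log n)$ if $\mathcal{H}$ contains all cycles. \end{enumerate} The constants hidden in the $\mathcal{O}(\cdot)$-notation are absolute, and the bounds are understood for $k\ge 1$ and $n\ge 2$.
   Context: Graphs are finite, without loops or parallel edges. Logarithms are base 2. $N[X]$ denotes the set consisting of $X$ and all neighbors of vertices of $X$. Disjoint vertex sets are anticomplete if there is no edge between them; subgraphs are pairwise anticomplete if their vertex sets are pairwise disjoint and anticomplete. For a family $\mathcal{H}$ of graphs, an induced $\mathcal{H}$-packing in $G$ is a set of pairwise anticomplete induced subgraphs of $G$, each isomorphic to a member of $\mathcal{H}$. For $B\subseteq V(G)$, it is $B$-rooted if every member of the packing intersects $B$ (members need not be contained in $B$), and $\pi_{\mathcal{H}}(G,B)$ is the largest size of a $B$-rooted induced $\mathcal{H}$-packing. For a tree decomposition $\mathcal{T}=(T,\beta)$ of $G$ let $\pi_{\mathcal{H}}(G,\mathcal{T})=\max_{t\in V(T)}\pi_{\mathcal{H}}(G,\beta(t))$. The induced $\mathcal{H}$-packing treewidth is $\text{tree-}\pi_{\mathcal{H}}(G)=\min_{\mathcal{T}}\pi_{\mathcal{H}}(G,\mathcal{T})$ over all tree decompositions $\mathcal{T}$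 of $G$. *)

(* Defs.v *)
From mathcomp Require Import all_boot all_order all_algebra.
From mathcomp Require Import boolp reals exp.

Set Implicit Arguments.
Unset Strict Implicit.
Unset Printing Implicit Defensive.

Record sgraph := SGraph {
  vertex :> finType;
  edge : rel vertex;
  edge_sym : symmetric edge;
  edge_irrefl : irreflexive edge }.

Arguments edge {s}.

Definition sg_iso (G F : sgraph) : Prop :=
  exists2 f : G -> F, bijective f & forall x y, edge (f x) (f y) = edge x y.

Section Induced.
Variables (G : sgraph) (A : {set G}).

Definition induced_edge : rel {x : G | x \in A} := relpre val (@edge G).

Lemma induced_edge_sym : symmetric induced_edge.
Proof. by move=> x y; rewrite /induced_edge /= edge_sym. Qed.

Lemma induced_edge_irrefl : irreflexive induced_edge.
Proof. by move=> x; rewrite /induced_edge /= edge_irrefl. Qed.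

Definition induced : sgraph := SGraph induced_edge_sym induced_edge_irrefl.
End Induced.

Definition sg_connected (G : sgraph) : Prop := forall x y : G, connect edge x y.

(* Vertex sets of the connected components. *)
Definition components (G : sgraph) : {set {set G}} :=
  [set [set y | connect edge x y] | x : G].

Definition closed_nbhd (G : sgraph) (X : {set G}) : {set G} :=
  X :|: [set y | [exists x in X, edge x y]].

Definition anticomplete (G : sgraph) (A B : {set G}) : Prop :=
  [disjoint A & B] /\ {in A & B, forall x y, ~~ edge x y}.

Section PathGraph.
Variable t : nat.

Definition path_edge : rel 'I_t := fun i j => (i.+1 == j :> nat) || (j.+1 == i :> nat).

Lemma path_edge_sym : symmetric path_edge.
Proof. by move=> i j; rewrite /path_edge orbC. Qed.

Lemma path_edge_irrefl : irreflexive path_edge.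
Proof. by move=> i; rewrite /path_edge orbb eqn_leq ltnn. Qed.

Definition path_graph : sgraph := SGraph path_edge_sym path_edge_irrefl.
End PathGraph.

(* This is the cycle of length l only when 3 <= l. *)
Section CycleGraph.
Variable l : nat.

Definition cycle_edge : rel 'I_l :=
  fun i j => (i != j) && ((j == ordS i) || (i == ordS j)).

Lemma cycle_edge_sym : symmetric cycle_edge.
Proof. by move=> i j; rewrite /cycle_edge eq_sym orbC. Qed.

Lemma cycle_edge_irrefl : irreflexive cycle_edge.
Proof. by move=> i; rewrite /cycle_edge eqxx. Qed.

Definition cycle_graph : sgraph := SGraph cycle_edge_sym cycle_edge_irrefl.
End CycleGraph.

(* Families need not be closed under isomorphism, hence the use of sg_iso in
   the predicates below. *)
Definition graph_family := sgraph -> Prop.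

(* G is isomorphic to a member of H. *)
Definition iso_mem (H : graph_family) (G : sgraph) : Prop :=
  exists2 F, H F & sg_iso G F.

(* Paths have at least one vertex. *)
Definition contains_path (H : graph_family) (t : nat) : Prop :=
  0 < t /\ iso_mem H (path_graph t).

Definition contains_all_cycles (H : graph_family) : Prop :=
  forall l, 3 <= l -> iso_mem H (cycle_graph l).

Section Packing.
Variables (H : graph_family) (G : sgraph).

(* An induced subgraph is represented by its vertex set. *)
Definition induced_packing (P : {set {set G}}) : Prop :=
  {in P, forall A, iso_mem H (induced A)} /\
  {in P &, forall A B, A != B -> anticomplete A B}.

Definition rooted (B : {set G}) (P : {set {set G}}) : Prop :=
  {in P, forall A, A :&: B != set0}.

Definition packing_number (B : {set G}) : nat :=
  \max_(P : {set {set G}} | `[< induced_packing P /\ rooted B P >]) #|P|.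
End Packing.

Definition acyclic (G : sgraph) : Prop :=
  forall c : seq G, ucycle edge c -> size c <= 2.

Definition is_tree (T : sgraph) : Prop :=
  [/\ 0 < #|T|, sg_connected T & acyclic T].

Record tree_decomposition (G : sgraph) := TreeDecomposition {
  td_tree :> sgraph;
  bag : td_tree -> {set G};
  td_treeP : is_tree td_tree;
  td_cover : forall v : G, exists t, v \in bag t;
  td_edge : forall u v : G, edge u v -> exists t, (u \in bag t) && (v \in bag t);
  td_conn : forall v : G, sg_connected (induced [set t | v \in bag t]) }.

Definition td_packing_number (H : graph_family) (G : sgraph)
    (D : tree_decomposition G) : nat :=
  \max_(t : D) packing_number H (bag t).

Lemma trivial_tree_decomposition (G : sgraph) : tree_decomposition G.
Proof.
have sub1 (P : pred 'I_1) (x y : {i : 'I_1 | P i}) : x = y.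
  by apply/val_inj; rewrite /= (ord1 (val x)) (ord1 (val y)).
apply: (@TreeDecomposition G (path_graph 1) (fun=> [set: G])).
- split=> [|x y|c /andP[_ /card_uniqP <-]]; first by rewrite card_ord.
  + by rewrite (ord1 x) (ord1 y) connect0.
  + by rewrite (leq_trans (max_card _)) // card_ord.
- by move=> v; exists ord0; rewrite inE.
- by move=> u v _; exists ord0; rewrite !inE.
- by move=> v x y; rewrite (_ : x = y) ?connect0 //; apply: sub1.
Qed.

Lemma tree_packing_number_ex (H : graph_family) (G : sgraph) :
  exists m, `[< exists D : tree_decomposition G, td_packing_number H D = m >].
Proof.
exists (td_packing_number H (trivial_tree_decomposition G)).
by apply/asboolP; exists (trivial_tree_decomposition G).
Qed.

(* The induced H-packing treewidth of G. *)
Definition tree_packing_number (H : graph_family) (G : sgraph) : nat :=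
  ex_minn (tree_packing_number_ex H G).

Definition balanced_separator (G : sgraph) (S : {set G}) : Prop :=
  {in components (induced (~: S)), forall C : {set _}, 2 * #|C| <= #|G|}.

Definition log2 (R : realType) (x : R) : R := (ln x / ln 2)%R.

(* Main.v *)
(* Both bounds go by contradiction.  If N[Y] is never balanced for small Y, then
   G - N[Y] has a majority component, and these components shrink as Y grows.
   For every node t a small set X_t is found whose majority component lies,
   up to the vertices cut off by bag t, in a single branch of the tree at t.
   Orient t towards that branch.  Some tree edge tt' is oriented both ways, and
   a vertex of the majority component of X_t and X_t' together is then
   in two disjoint branches.

   For paths, X_t is the union of a maximum bag-rooted packing of t-vertex paths;
   if the majority component still met bag t, Gyarfas' path argument would
   produce one more path.

   For cycles, X_t comes from a coarse Erdos-Posa theorem for cycles meeting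
   B = bag t: either there are k + 1 pairwise anticomplete B-cycles, or O(k^2)
   closed neighbourhoods meet all B-cycles.  As in Simonovits' proof, a subgraph f of
   maximum degree 4 is grown by shortest ears and shortest cycles, keeping all of its
   cycles rooted.  The branch vertices, and the few vertices near the ends
   of every new ear, are put into X; minimality of the ears then forces all
   remaining edges of G inside the subgraph to join vertices at f-distance at most 5.
   Once the cyclomatic excess of f is of order k^2, f contains k + 1
   cycles at pairwise f-distance more than 5. *)

Require Import Defs.
From mathcomp Require Import all_boot all_order all_algebra.
From mathcomp Require Import boolp reals exp.
From mathcomp Require Import zify.

Set Implicit Arguments.
Unset Strict Implicit.
Unset Printing Implicit Defensive.

(** * Cores and restricted connectivity *)

(** An ear can be added only if one further root restores the invariant that [XB] meets every cycle
    of [f]. This is impossible exactly for the [benign] ears: they avoid [B] and their ends are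
    already joined in [f] off [B], so they close a cycle without roots. Minimality is therefore
    available only against rooted cycles and ears that are not benign, and every exchange argument
    has to extract its contradiction from the benignity of the shorter ears.

    The distance 5 comes from an edge joining the first to the last interior vertex of an ear: one
    step to an end, at most three between the ends by [fr_clean], one step back. [fr_clean] is
    carried along to make this possible.

    Once all rooted cycles are hit, the majority component may still meet the bag, but two
    neighbours in it of a bag vertex [b] are never connected there without [b]. Bag vertices thus
    behave like cut vertices, and only the part on the majority side of all these cuts is placed in
    a branch.

    The hitting set has size quadratic in [k] and independent of [n]; the cubic bound with the
    logarithm is a weakening made at the very end. *)

Section Restriction.
Variable V : finType.
Implicit Types (r f e : rel V) (A B Z : {set V}).

Definition rst r A : rel V := fun x y => [&& r x y, x \in A & y \in A].
Arguments rst r A x y /.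

Lemma rst_sym r A : symmetric r -> symmetric (rst r A).
Proof. by move=> sr x y; rewrite /rst /= sr [(x \in A) && _]andbC. Qed.

Lemma rst_connectC r A x y : symmetric r ->
  connect (rst r A) x y = connect (rst r A) y x.
Proof. by move=> sr; apply: sym_connect_sym; apply: rst_sym. Qed.

Lemma rst_sub r A B x y : A \subset B -> connect (rst r A) x y -> connect (rst r B) x y.
Proof.
move=> sAB; apply: connect_sub => u v /and3P[ruv uA vA].
by apply: connect1; rewrite /= ruv !(subsetP sAB).
Qed.

Lemma rst_path r A x p : path (rst r A) x p -> path r x p /\ {subset p <= A}.
Proof.
elim: p x => [|y p IH] x //= /andP[/and3P[rxy xA yA] /IH[-> sp]].
by rewrite rxy; split=> // z; rewrite inE => /orP[/eqP->|/sp].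
Qed.

Lemma path_rst r A x p : x \in A -> path r x p -> {subset p <= A} -> path (rst r A) x p.
Proof.
elim: p x => [|y p IH] x //= xA /andP[-> ryp] sp.
have yA : y \in A by apply: sp; rewrite inE eqxx.
by rewrite xA yA IH // => z zp; apply: sp; rewrite inE zp orbT.
Qed.

Lemma rst_connect_in r A x y : connect (rst r A) x y -> x \in A -> y \in A.
Proof.
move=> /connectP[p /rst_path[_ sp] ->] xA.
by case: (lastP p) sp => //= p' z sp; rewrite last_rcons; apply: sp; rewrite mem_rcons inE eqxx.
Qed.

Lemma rst_connectP r A x y : x \in A -> connect (rst r A) x y ->
  exists p, [/\ path r x p, uniq (x :: p), {subset x :: p <= A} & last x p = y].
Proof.
move=> xA /connectP[p pp ->]; case/shortenP: pp => p' pp' up' _.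
have [pr sp] := rst_path pp'; exists p'; split=> //.
by move=> z; rewrite inE => /orP[/eqP->|/sp].
Qed.

Lemma path_connect_rst r A x p : path r x p -> {subset x :: p <= A} ->
  connect (rst r A) x (last x p).
Proof.
move=> pp sp; apply/connectP; exists p => //; apply: path_rst => //.
  by apply: sp; rewrite inE eqxx.
by move=> z zp; apply: sp; rewrite inE zp orbT.
Qed.

(* A finite graph has a cycle iff it has a nonempty core; phrasing acyclicity
   through cores avoids handling cycles as lists. *)
Definition core f Z := forall v, v \in Z ->
  exists y1 y2, [/\ y1 != y2, y1 \in Z, y2 \in Z, f v y1 & f v y2].

(** If [x] has a second neighbour in [Z], then [Z] itself is a core. Otherwise deleting [x] lowers
    only the degree of its unique neighbour [y], which becomes the new exceptional vertex. *)
Lemma nearly_core f Z x : symmetric f -> irreflexive f -> x \in Z ->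
  (exists2 y, y \in Z & f x y) ->
  (forall v, v \in Z -> v != x ->
     exists y1 y2, [/\ y1 != y2, y1 \in Z, y2 \in Z, f v y1 & f v y2]) ->
  exists Y, [/\ Y != set0, Y \subset Z & core f Y].
Proof.
move=> sf irf; move: {2}#|Z| (leqnn #|Z|) => n.
elim: n Z x => [|n IH] Z x.
  by rewrite leqn0 cards_eq0 => /eqP->; rewrite inE.
move=> cZ xZ [y yZ fxy] H.
have [/existsP[z /and3P[zZ zy fxz]]|nz] := boolP [exists z, [&& z \in Z, z != y & f x z]].
  exists Z; split=> //; first by apply/set0Pn; exists x.
  move=> v vZ; have [->|/H/(_)] := eqVneq v x; last by apply.
  by exists z, y; split.
have yx : y != x by apply/eqP => yx; rewrite yx irf in fxy.
have [] := IH (Z :\ x) y.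
- by move: cZ; rewrite (cardsD1 x) xZ.
- by rewrite !inE yx.
- have [y1 [y2 [y12 y1Z y2Z f1 f2]]] := H y yZ yx.
  have [y1x|y1x] := eqVneq y1 x; last by exists y1; rewrite ?inE ?y1x.
  by exists y2; rewrite ?inE // y2Z andbT; apply: contraNneq y12 => ->; rewrite y1x.
- move=> v; rewrite !inE => /andP[vx vZ] vy.
  have [y1 [y2 [y12 y1Z y2Z f1 f2]]] := H v vZ vx.
  have nx u : f v u -> u != x.
    move=> fvu; apply: contraNneq nz => ux.
    by apply/existsP; exists v; rewrite vZ vy sf -ux.
  by exists y1, y2; rewrite !inE !nx //; split.
move=> Y [Y0 YZ cY]; exists Y; split=> //.
by apply: subset_trans YZ _; apply: subsetDl.
Qed.

Lemma cycle_core f c : symmetric f -> uniq c -> cycle f c -> 2 < size c ->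
  core f [set x in c].
Proof.
move=> sf uc cc sc v; rewrite inE => vc.
have [i c' Ec] := rot_to vc.
move: uc cc sc; rewrite -(rot_uniq i) -(rot_cycle i) -(size_rot i) Ec.
have memc z : (z \in c) = (z \in v :: c') by rewrite -Ec mem_rot.
case: c' {Ec} memc => [//|y1 c'] memc; case: (lastP c') memc => [//|c2 y2] memc /=.
rewrite !mem_rcons !inE !rcons_path /= last_rcons !negb_or => /and3P[_ /andP[y12 _] _].
move=> /andP[fv /andP[_ fv2]] _; exists y1, y2; split=> //; rewrite ?inE ?memc ?inE ?mem_rcons ?inE ?eqxx ?orbT //.
by rewrite sf.
Qed.

(** When a path inside [Z] cannot be extended beyond its front [x], two neighbours of [x] lie on it,
    and the farther one closes a cycle with at least three vertices. *)
Lemma core_cycle f Z : symmetric f -> irreflexive f -> Z != set0 -> core f Z ->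
  exists c, [/\ uniq c, cycle f c, 2 < size c & {subset c <= Z}].
Proof.
move=> sf irf /set0Pn[v vZ] cZ.
suff H n : forall x p, path f x p -> uniq (x :: p) -> {subset x :: p <= Z} ->
    #|Z| - size p <= n -> exists c, [/\ uniq c, cycle f c, 2 < size c & {subset c <= Z}].
  by apply: (H #|Z| v [::]) => //= [z|]; rewrite ?subn0 // inE => /eqP->.
elim: n => [|n IH] x p pp up sp sz.
  have := uniq_leq_size up (s2 := enum Z); rewrite -cardE /= => /(_ _)/wrap[].
    by move=> z /sp; rewrite mem_enum.
  by move: sz; lia.
have xZ : x \in Z by apply: sp; rewrite inE eqxx.
have ext y : y \in Z -> f x y -> y \notin p -> exists c, [/\ uniq c, cycle f c, 2 < size c & {subset c <= Z}].
  move=> yZ fxy yp; apply: (IH y (x :: p)).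
  - by rewrite /= sf fxy.
  - rewrite cons_uniq up andbT inE negb_or yp andbT; apply/eqP => yx.
    by rewrite yx irf in fxy.
  - by move=> z; rewrite inE => /orP[/eqP->|/sp].
  - by move: sz => /=; lia.
have [y1 [y2 [y12 y1Z y2Z f1 f2]]] := cZ x xZ.
have [y1p|] := boolP (y1 \in p); last exact: ext.
have [y2p|] := boolP (y2 \in p); last exact: ext.
wlog lt : y1 y2 y12 y1Z y2Z f1 f2 y1p y2p / index y1 p < index y2 p.
  move=> W; case: (ltngtP (index y1 p) (index y2 p)); [exact: W| |].
    by apply: W => //; rewrite eq_sym.
  by move=> /(congr1 (nth y1 p)); rewrite !nth_index // => E; rewrite E eqxx in y12.
case/splitPr: p / y2p pp up sp {sz ext y1p} lt => p1 p2 pp up sp.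
have y2p1 : y2 \notin p1.
  by move: up; rewrite cons_uniq cat_uniq /= => /and3P[_ _ /andP[/norP[]]].
rewrite !index_cat (negPf y2p1) /= eqxx addn0.
case: ifP => [y1p1 _|_]; last by lia.
exists (x :: rcons p1 y2); split.
- by move: up; rewrite -cat_rcons -cat_cons cat_uniq => /and3P[].
- move: pp; rewrite -cat_rcons cat_path => /andP[pp _].
  by rewrite /= rcons_path last_rcons sf f2 pp.
- by rewrite /= size_rcons; case: p1 y1p1 {pp up sp y2p1}.
- move=> z zc; apply: sp; rewrite -cat_rcons -cat_cons mem_cat.
  by rewrite zc.
Qed.

Lemma rst_cycle_core f A b y1 y2 : symmetric f -> irreflexive f -> b \in A ->
  y1 != y2 -> y1 \in A -> y2 \in A -> f b y1 -> f b y2 ->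
  connect (rst f (A :\ b)) y1 y2 ->
  exists c, [/\ uniq (b :: c), cycle f (b :: c), 2 < size (b :: c) & {subset b :: c <= A}].
Proof.
move=> sf irf bA y12 y1A y2A f1 f2 con.
have y1b : y1 != b by apply/eqP => E; rewrite E irf in f1.
have [|p [pp up sp lp]] := rst_connectP _ con; first by rewrite !inE y1b.
exists (y1 :: p); split.
- rewrite cons_uniq up andbT; apply/negP => /sp; by rewrite !inE eqxx.
- by rewrite /= rcons_path f1 pp lp /= sf f2.
- by case: p lp {pp up sp} => //= E; rewrite E eqxx in y12.
- move=> z; rewrite inE => /orP[/eqP->//|/sp]; by rewrite !inE => /andP[].
Qed.

End Restriction.
Arguments rst {V} r A x y /.

(** * Cheap cycles in sparse graphs *)

Section SparseGraph.
Variable V : finType.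
Implicit Types (r f e : rel V) (A B Z : {set V}).

Lemma card_bigcup_le (I : finType) (P : pred I) (F : I -> {set V}) :
  #|\bigcup_(i | P i) F i| <= \sum_(i | P i) #|F i|.
Proof.
elim/big_rec2: _ => [|i n S _ IH]; first by rewrite cards0.
by rewrite cardsU; apply: leq_trans (leq_subr _ _) _; rewrite leq_add2l.
Qed.

Lemma setUD_id (A B : {set V}) : A \subset B -> A :|: (B :\: A) = B.
Proof. by move=> sAB; rewrite -{1}(setIidPr sAB) setID. Qed.

Lemma disjoint_setDr (A B : {set V}) : [disjoint A & B :\: A].
Proof. by rewrite disjoint_sym disjoints_subset setDE subsetIr. Qed.

Lemma cardsD_sub (A B : {set V}) : A \subset B -> #|A| + #|B :\: A| = #|B|.
Proof. by move=> sAB; rewrite -{1}(setIidPr sAB) cardsID. Qed.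

Definition deg f A v := #|[set u in A | f v u]|.
(** For symmetric [f] this is twice the number of edges inside [A]; counting ordered pairs avoids
    halving throughout. *)
Definition pairs f A := \sum_(v in A) deg f A v.
Definition cross f A B := \sum_(v in A) deg f B v.

Lemma degU f A B v : [disjoint A & B] -> deg f (A :|: B) v = deg f A v + deg f B v.
Proof.
move=> dAB; rewrite /deg -cardsUI [X in _ = _ + X](_ : _ = 0) ?addn0.
  by congr #|pred_of_set _|; apply/setP => u; rewrite !inE andb_orl.
apply/eqP; rewrite cards_eq0 -subset0; apply/subsetP => u; rewrite !inE.
by case/andP=> /andP[uA _] /andP[uB _]; rewrite (disjointFr dAB uA) in uB.
Qed.

Lemma degS f A B v : A \subset B -> deg f A v <= deg f B v.
Proof.
move=> sAB; apply/subset_leq_card/subsetP => u.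
by rewrite !inE => /andP[/(subsetP sAB)-> ->].
Qed.

Lemma deg_sum f A v : deg f A v = \sum_(u in A) f v u.
Proof.
rewrite /deg -sum1_card big_mkcond [RHS]big_mkcond; apply: eq_bigr => u _.
by rewrite inE; case: (u \in A); case: (f v u).
Qed.

Lemma crossC f A B : symmetric f -> cross f A B = cross f B A.
Proof.
move=> sf; rewrite /cross (eq_bigr _ (fun v _ => deg_sum f B v)) exchange_big /=.
by apply: eq_bigr => u _; rewrite deg_sum; apply: eq_bigr => v _; rewrite sf.
Qed.

Lemma sum_setU A B (F : V -> nat) : [disjoint A & B] ->
  \sum_(v in A :|: B) F v = \sum_(v in A) F v + \sum_(v in B) F v.
Proof.
by move=> dAB; rewrite -bigU //; apply: eq_bigl => v; rewrite !inE.
Qed.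

Lemma pairsU f A B : symmetric f -> [disjoint A & B] ->
  pairs f (A :|: B) = pairs f A + pairs f B + 2 * cross f A B.
Proof.
move=> sf dAB; rewrite /pairs (eq_bigr _ (fun v _ => degU f v dAB)).
have := crossC A B sf; rewrite /cross big_split /= !sum_setU //; lia.
Qed.

Lemma coreP f Z : core f Z <-> (forall v, v \in Z -> 1 < deg f Z v).
Proof.
split=> cZ v vZ; have := cZ v vZ.
  case=> y1 [y2 [y12 y1Z y2Z f1 f2]]; apply/card_gt1P; exists y1, y2.
  by rewrite !inE y1Z y2Z f1 f2.
case/card_gt1P=> y1 [y2 [+ + y12]]; rewrite !inE => /andP[y1Z f1] /andP[y2Z f2].
by exists y1, y2.
Qed.

(** Vertices of degree at most one are deleted in turn. Each deletion loses one vertex and at most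
    one edge, so the surplus of edges survives until no such vertex is left. *)
Lemma pairs_core f A : symmetric f -> irreflexive f -> A != set0 -> 2 * #|A| < pairs f A + 2 ->
  exists Y, [/\ Y != set0, Y \subset A & core f Y].
Proof.
move=> sf irf; move En : #|A| => n; elim: n A En => [|n IH] A cA A0 H.
  by rewrite -cards_eq0 cA in A0.
have [/forallP ge2|] := boolP [forall v, (v \in A) ==> (1 < deg f A v)].
  by exists A; split=> //; apply/coreP => v vA; have /implyP := ge2 v; apply.
rewrite negb_forall => /existsP[v]; rewrite negb_imply -leqNgt => /andP[vA dv].
have EA : [set v] :|: (A :\ v) = A by rewrite setD1K.
have dvA : [disjoint [set v] & A :\ v] by rewrite disjoints1 !inE eqxx.
have cA' : #|A :\ v| = n by move: cA; rewrite (cardsD1 v A) vA; case.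
have p1 : pairs f [set v] = 0.
  rewrite /pairs big_set1; apply/eqP; rewrite cards_eq0 -subset0; apply/subsetP => u.
  by rewrite !inE => /andP[/eqP->]; rewrite irf.
have pA : pairs f A = pairs f (A :\ v) + 2 * deg f (A :\ v) v.
  by rewrite -{1}EA pairsU // p1 /cross big_set1.
have dv' : deg f (A :\ v) v <= 1 by apply: leq_trans dv; apply/degS/subsetDl.
have [A'0|A'0] := eqVneq (A :\ v) set0.
  move: pA H; rewrite -cA' A'0 cards0 /pairs big_set0 /deg (_ : [set u in set0 | f v u] = set0) ?cards0 => [->//|].
  by apply/setP => u; rewrite !inE.
have [|Y [Y0 YA cY]] := IH _ cA' A'0; first by lia.
by exists Y; split=> //; apply: subset_trans YA (subsetDl _ _).
Qed.

Definition cset f A := [forall x in A, forall y in A, connect (rst f A) x y].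

Lemma csetP f A : reflect {in A &, forall x y, connect (rst f A) x y} (cset f A).
Proof.
apply: (iffP forall_inP) => H x.
  by move=> y xA; have /forall_inP/(_ y) := H x xA.
by move=> xA; apply/forall_inP => y; apply: H.
Qed.

Lemma connect_cross f A (S : {set V}) x y : connect (rst f A) x y -> x \in S -> y \notin S ->
  exists u v, [/\ u \in S :&: A, v \in A :\: S & f u v].
Proof.
move=> /connectP[p pp ->]; elim: p x pp => [|z p IH] x /=; first by move=> _ ->.
case/andP=> /and3P[fxz xA zA] pp xS lS.
have [zS|zS] := boolP (z \in S); first exact: IH lS.
by exists x, z; rewrite !inE xA xS zA zS.
Qed.

(** For [x] outside [A] this is the singleton of [x], because [connect] is reflexive. *)
Definition comp f A x := [set y | connect (rst f A) x y].

Lemma comp_id f A x : x \in comp f A x. Proof. by rewrite inE connect0. Qed.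

Lemma comp_sub f A x : x \in A -> comp f A x \subset A.
Proof. by move=> xA; apply/subsetP => y; rewrite inE => /rst_connect_in; apply. Qed.

Lemma comp_step f A x u v : u \in comp f A x -> u \in A -> v \in A -> f u v -> v \in comp f A x.
Proof.
rewrite !inE => xu uA vA fuv; apply: connect_trans xu _.
by apply: connect1; rewrite /= fuv uA.
Qed.

Lemma comp_connect f A x y : y \in comp f A x -> connect (rst f (comp f A x)) x y.
Proof.
rewrite inE => /connectP[p pp ->].
elim/last_ind: p pp => [|p z IH]; first by rewrite /= connect0.
rewrite rcons_path last_rcons => /andP[pp pz].
apply: connect_trans (IH pp) _; apply: connect1 => /=.
case/and3P: (pz) => -> lA zA /=.
apply/andP; split; rewrite inE; first by apply/connectP; exists p.
by apply/connectP; exists (rcons p z); rewrite ?rcons_path ?pp ?last_rcons.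
Qed.

Lemma comp_cset f A x : symmetric f -> cset f (comp f A x).
Proof.
move=> sf; apply/csetP => y z yC zC.
apply: connect_trans (comp_connect zC).
by rewrite rst_connectC //; apply: comp_connect.
Qed.

Section Weight.
Variables (f : rel V) (W : {set V}) (m : nat).
Hypotheses (sf : symmetric f) (irf : irreflexive f) (m0 : 0 < m).
Hypothesis deg4 : forall v, deg f setT v <= 4.

Definition wt A := #|A :&: W|.

Lemma wtS A B : A \subset B -> wt A <= wt B.
Proof. by move=> sAB; apply/subset_leq_card/setSI. Qed.

Lemma wtU A B : [disjoint A & B] -> wt (A :|: B) = wt A + wt B.
Proof.
move=> dAB; rewrite /wt setIUl cardsU [X in _ - X](_ : _ = 0) ?subn0 //.
apply/eqP; rewrite cards_eq0 -subset0; apply/subsetP => u; rewrite !inE.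
by case/andP=> /andP[uA _] /andP[uB _]; rewrite (disjointFr dAB uA) in uB.
Qed.

(** This is the spanning tree bound. A maximal subset containing [x] and satisfying it must be all
    of [A]: otherwise connectivity provides a vertex outside with a neighbour inside, and adding
    that vertex keeps the bound. *)
Lemma cset_pairs A : A != set0 -> cset f A -> 2 * #|A| <= pairs f A + 2.
Proof.
move=> /set0Pn[x xA] /csetP cA.
pose P (S : {set V}) := [&& x \in S, S \subset A & 2 * #|S| <= pairs f S + 2].
have P1 : P [set x] by rewrite /P !inE eqxx sub1set xA cards1 leq_addl.
have [S /maxsetP[/and3P[xS SA HS] mS] _] := maxset_exists P1.
have [<-//|nSA] := eqVneq S A.
have [y yA yS] : exists2 y, y \in A & y \notin S.
  by apply/subsetPn; apply: contra nSA => sAS; rewrite eqEsubset SA.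
have [u [v [uS]]] := connect_cross (cA x y xA yA) xS yS.
rewrite !inE in uS *; case/andP: uS => uS uA /andP[vS vA] fuv.
have dv : [disjoint [set v] & S] by rewrite disjoints1.
suff /mS/(_ (subsetUr _ _)) E : P (v |: S) by rewrite -E !inE eqxx in vS.
rewrite /P !inE xS orbT subUset sub1set vA SA /= cardsU1 vS pairsU // /cross big_set1.
have : 0 < deg f S v by apply/card_gt0P; exists u; rewrite inE uS sf.
by move: HS; clear; lia.
Qed.

(* For [P] inclusion-minimal and [p] in [P] attached to the rest, each of the at
   most four components of [P] minus [p] is light. *)
Lemma heavy_part (K : {set V}) : cset f K -> m <= wt K ->
  exists P : {set V}, [/\ P \subset K, P != set0, cset f P, cset f (K :\: P) & m <= wt P <= 4 * m + 1].
Proof.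
move=> cK wK.
pose good (P : {set V}) := [&& P \subset K, cset f P, cset f (K :\: P) & m <= wt P].
have gK : good K.
  by rewrite /good subxx cK setDv wK andbT; apply/csetP => x y; rewrite inE.
have [P /minsetP[/and4P[PK cP cKP wP] mP] _] := minset_exists gK.
have P0 : P != set0 by apply: contraTneq wP => ->; rewrite /wt set0I cards0 -ltnNge.
exists P; split=> //; rewrite wP /=.
(* [p] is a vertex attaching [P] to the rest of [K]; if there is no rest, any vertex of [P]
   serves. *)
have [p pP pK] : exists2 p, p \in P & (K :\: P = set0 \/ exists2 k, k \in K :\: P & f p k).
  have [x xP] := set0Pn _ P0.
  have [KP|/set0Pn[y yKP]] := eqVneq (K :\: P) set0; first by exists x => //; left.
  move: (yKP); rewrite inE => /andP[yP yK].
  have [u [v [uS vS fuv]]] := connect_cross (csetP _ _ cK x y (subsetP PK x xP) yK) xP yP.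
  exists u; first by case/setIP: uS.
  by right; exists v.
have {}cP := csetP _ _ cP; have {}cKP := csetP _ _ cKP.
(* A component of weight at least [m] would itself be [good]: everything else in [P] still reaches
   [p], and through [p] the set [K :\: P], so its complement in [K] is connected. This contradicts
   the minimality of [P]. *)
have light y : y \in P :\ p -> wt (comp f (P :\ p) y) < m.
  move=> yP; have QP := comp_sub f yP; rewrite ltnNge; apply/negP => wQ.
  have pQ : p \notin comp f (P :\ p) y by apply/negP => /(subsetP QP); rewrite !inE eqxx.
  have QP' : comp f (P :\ p) y \subset P by apply: subset_trans QP (subsetDl _ _).
  suff /mP/(_ QP') E : good (comp f (P :\ p) y) by rewrite E pP in pQ.
  rewrite /good (subset_trans QP' PK) comp_cset //= wQ andbT.
  set Q := comp f _ y in QP pQ QP' *.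
  have toP z : z \in K :\: Q -> connect (rst f (K :\: Q)) z p.
    rewrite inE => /andP[zQ zK]; have [zP|zP] := boolP (z \in P).
      apply: (rst_sub (setSD Q PK)).
      suff: p \in comp f (P :\: Q) z by rewrite inE.
      apply/negPn/negP => pR.
      have [u [v [+ + fuv]]] := connect_cross (cP z p zP pP) (comp_id _ _ _) pR.
      case/setIP=> uR uP /setDP[vP vR].
      have uPQ : u \in P :\: Q by apply: (subsetP (comp_sub f _)) uR; rewrite inE zQ.
      have vQ : v \in Q.
        apply/negPn/negP => vQ; case/negP: vR.
        by apply: (comp_step uR uPQ _ fuv); rewrite inE vQ.
      move: uPQ; rewrite inE => /andP[/negP uQ _]; case: uQ; apply: (comp_step vQ).
      - by apply: (subsetP QP).
      - rewrite !inE uP andbT; apply: contraNneq pR => <-; exact: uR.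
      - by rewrite sf.
    case: pK => [KP|[k kKP fpk]].
      by have: z \in K :\: P by [rewrite inE zP]; rewrite KP inE.
    have sKPQ : K :\: P \subset K :\: Q by apply: setDS.
    apply: (@connect_trans _ _ k); last first.
      apply: connect1; rewrite /= sf fpk (subsetP sKPQ) // inE pQ.
      exact: (subsetP PK).
    by apply: (rst_sub sKPQ); apply: cKP => //; rewrite inE zP.
  apply/csetP => z z' zK z'K; apply: connect_trans (toP z zK) _.
  by rewrite rst_connectC //; apply: toP.
(* Every component of [P :\ p] contains a neighbour of [p], so there are at most four; the vertex
   [p] accounts for the final [+ 1]. *)
pose N := [set u in P | f p u].
have sub : P \subset p |: \bigcup_(y in N) comp f (P :\ p) y.
  apply/subsetP => z zP; rewrite inE in_set1; have [//|zp] := eqVneq z p => /=.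
  have pS : p \notin comp f (P :\ p) z.
    by apply/negP => /(subsetP (comp_sub f _)); rewrite !inE eqxx zp zP => /(_ isT).
  have [u [v [+ + fuv]]] := connect_cross (cP z p zP pP) (comp_id _ _ _) pS.
  case/setIP=> uS uP /setDP[vP vS].
  have uPp : u \in P :\ p by apply: (subsetP (comp_sub f _)) uS; rewrite !inE zp.
  have vp : v = p.
    apply/eqP/negPn/negP => vp; case/negP: vS.
    by apply: (comp_step uS uPp _ fuv); rewrite !inE vp.
  apply/bigcupP; exists u; first by rewrite inE uP sf -vp.
  by move: uS; rewrite !inE rst_connectC.
have wN : wt (\bigcup_(y in N) comp f (P :\ p) y) <= #|N| * m.
  rewrite /wt big_distrl /= (leq_trans (card_bigcup_le _ _)) //.
  rewrite -sum_nat_const leq_sum // => y; rewrite inE => /andP[yP fpy].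
  apply: ltnW; apply: light; rewrite !inE yP andbT.
  by apply: contraTneq fpy => ->; rewrite irf.
have cN : #|N| <= 4.
  apply: leq_trans (deg4 p); apply/subset_leq_card/subsetP => u.
  by rewrite !inE => /andP[].
apply: leq_trans (wtS sub) _; rewrite /wt setIUl (leq_trans (leq_card_setU _ _)) // addnC.
apply: leq_add.
  by apply: leq_trans wN _; rewrite leq_mul2r cN orbT.
by rewrite (leq_trans (subset_leq_card (subsetIl _ _))) // cards1.
Qed.

(** The threshold is twice the weight bound of [heavy_part], so that the union of two such parts
    contains no core at all. *)
Definition cheap_free A :=
  forall Y : {set V}, Y != set0 -> Y \subset A -> core f Y -> 2 * (4 * m + 1) < wt Y.

Lemma cheap_freeS A B : A \subset B -> cheap_free B -> cheap_free A.
Proof. by move=> sAB H Y Y0 YA; apply: H => //; apply: subset_trans sAB. Qed.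

Lemma cheap_free_pairs A : A != set0 -> cheap_free A -> wt A <= 2 * (4 * m + 1) ->
  pairs f A + 2 <= 2 * #|A|.
Proof.
move=> A0 cf wA; rewrite leqNgt; apply/negP => /(pairs_core sf irf A0)[Y [Y0 YA cY]].
by have := cf Y Y0 YA cY; rewrite ltnNge (leq_trans (wtS YA)).
Qed.

(** Two edges between the connected sets would give the union at least as many edges as vertices,
    hence a core too light for [cheap_free]. *)
Lemma cross_parts P Q : P != set0 -> Q != set0 -> cset f P -> cset f Q -> [disjoint P & Q] ->
  wt P <= 4 * m + 1 -> wt Q <= 4 * m + 1 -> cheap_free (P :|: Q) -> cross f P Q <= 1.
Proof.
move=> P0 Q0 cP cQ dPQ wP wQ cf.
have PQ0 : P :|: Q != set0.
  by have [x xP] := set0Pn _ P0; apply/set0Pn; exists x; rewrite inE xP.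
have := cheap_free_pairs PQ0 cf; rewrite wtU // pairsU // => /(_ _)/wrap[]; first by lia.
have := cset_pairs P0 cP; have := cset_pairs Q0 cQ.
have := leq_card_setU P Q; rewrite dPQ => -[_ /eqP->].
by lia.
Qed.

Lemma cross_cover P A (ps : seq {set V}) :
  A \subset \bigcup_(Q <- ps) Q -> (forall Q, Q \in ps -> cross f P Q <= 1) ->
  cross f P A <= size ps.
Proof.
elim: ps A => [|Q ps IH] A; first by rewrite big_nil subset0 => /eqP-> _;
  rewrite /cross big1 // => v _; apply/eqP; rewrite cards_eq0 -subset0; apply/subsetP => u; rewrite !inE.
rewrite big_cons => sA H.
have : cross f P A <= cross f P Q + cross f P (A :\: Q).
  rewrite -big_split /=; apply: leq_sum => v _; rewrite -degU.
    by apply: degS; apply/subsetP => u uA; rewrite !inE uA andbT orbN.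
  by rewrite disjoint_sym disjoints_subset; apply/subsetP => u; rewrite !inE => /andP[].
have /= := H Q; rewrite inE eqxx => /(_ isT).
have : cross f P (A :\: Q) <= size ps.
  apply: IH => [|R Rps]; last by apply: H; rewrite inE Rps orbT.
  by rewrite subDset.
lia.
Qed.

(* [K] is cut into connected parts, all but one of weight at least [m]; two parts
   joined by two edges would contain a cheap core. *)
Lemma connected_parts K : K != set0 -> cset f K -> cheap_free K ->
  exists ps : seq {set V}, [/\ 0 < size ps,
    K \subset \bigcup_(Q <- ps) Q,
    forall Q, Q \in ps -> [/\ Q != set0, Q \subset K, cset f Q & wt Q <= 4 * m + 1],
    (size ps).-1 * m <= wt K & pairs f K + 2 <= 2 * #|K| + size ps * (size ps).-1].
Proof.
move En: #|K| => n; elim/ltn_ind: n K En => n IH K cK K0 conK cf.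
have one : wt K <= 4 * m + 1 -> exists ps : seq {set V}, [/\ 0 < size ps,
    K \subset \bigcup_(Q <- ps) Q,
    forall Q, Q \in ps -> [/\ Q != set0, Q \subset K, cset f Q & wt Q <= 4 * m + 1],
    (size ps).-1 * m <= wt K & pairs f K + 2 <= 2 * n + size ps * (size ps).-1].
  move=> wK; exists [:: K]; split=> //; first by rewrite big_seq1.
    by move=> Q; rewrite inE => /eqP->.
  by rewrite muln0 addn0 -cK cheap_free_pairs // (leq_trans wK) // leq_pmull.
have [wK|wK] := ltnP (wt K) m; first by apply: one; lia.
have [P [PK P0 cP cKP /andP[wP1 wP2]]] := heavy_part conK wK.
have EK := setUD_id PK; have dPK := disjoint_setDr P K.
have [KP0|KP0] := eqVneq (K :\: P) set0.
  by apply: one; rewrite -EK KP0 setU0.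
have cPK := cardsD_sub PK; rewrite cK in cPK.
have P1 : 0 < #|P| by rewrite card_gt0.
have [|ps [s0 Kps Hps wps pps]] := IH #|K :\: P| _ _ erefl KP0 cKP (cheap_freeS (subsetDl _ _) cf).
  by lia.
exists (P :: ps); split=> //=.
- by rewrite big_cons -{1}EK setUS.
- move=> Q; rewrite inE => /orP[/eqP->//|/Hps[Q0 QK cQ wQ]]; split=> //.
  exact: subset_trans QK (subsetDl _ _).
- rewrite -EK wtU //; nia.
have cr : cross f P (K :\: P) <= size ps.
  apply: cross_cover Kps _ => Q /Hps[Q0 QK cQ wQ].
  apply: cross_parts => //; first exact: disjointWr QK dPK.
  by apply: cheap_freeS cf; rewrite subUset PK (subset_trans QK (subsetDl _ _)).
have : pairs f P + 2 <= 2 * #|P|.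
  by apply: cheap_free_pairs => //; [apply: cheap_freeS PK cf|lia].
by rewrite -{1}EK pairsU //; nia.
Qed.

(** Summation over components: one with [q + 1] parts has weight at least [q * m] and at most
    [q * q.+1] pairs beyond twice its order, and [q * q.+1] is superadditive in [q]. *)
Lemma cheap_free_bound A : cheap_free A ->
  exists h, h * m <= wt A /\ pairs f A <= 2 * #|A| + h * h.+1.
Proof.
move En: #|A| => n; elim/ltn_ind: n A En => n IH A cA cf.
have [A0|/set0Pn[x xA]] := eqVneq A set0.
  by exists 0; rewrite A0 /pairs big_set0.
set K := comp f A x; have KA : K \subset A := comp_sub f xA.
have K0 : K != set0 by apply/set0Pn; exists x; apply: comp_id.
have EA := setUD_id KA; have dK := disjoint_setDr K A.
have cKA := cardsD_sub KA; rewrite cA in cKA.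
have K1 : 0 < #|K| by rewrite card_gt0.
have [ps [s0 _ _ wps pps]] := connected_parts K0 (comp_cset _ _ sf) (cheap_freeS KA cf).
have [|h [wh ph]] := IH #|A :\: K| _ _ erefl (cheap_freeS (subsetDl _ _) cf); first by lia.
have c0 : cross f K (A :\: K) = 0.
  rewrite /cross big1 // => v vK; apply/eqP; rewrite cards_eq0 -subset0; apply/subsetP => u.
  rewrite [u \in [set _ in _ | _]]inE => /andP[/setDP[uA uK] fvu]; case/negP: uK.
  by apply: (comp_step vK _ uA fvu); apply: (subsetP KA).
exists ((size ps).-1 + h); rewrite -EA wtU // pairsU // c0.
by case: (size ps) s0 wps pps => //= q _ wps pps; split; nia.
Qed.

End Weight.
End SparseGraph.

(** * Pairwise distant cores *)

Section FarCores.
Variable V : finType.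
Implicit Types (A B S Y Z : {set V}).
Variable f : rel V.
Hypotheses (sf : symmetric f) (irf : irreflexive f).
Hypothesis deg4 : forall v, deg f setT v <= 4.

Definition ball1 S := S :|: \bigcup_(u in S) [set v | f u v].
Definition ball n S := iter n ball1 S.

Lemma card_ball n S : #|ball n S| <= 5 ^ n * #|S|.
Proof.
elim: n => [|n IH] /=; first by rewrite mul1n.
have : #|ball1 (ball n S)| <= 5 * #|ball n S|.
  rewrite /ball1 (leq_trans (leq_card_setU _ _)) // [5 * _]mulSn leq_add2l.
  rewrite (leq_trans (card_bigcup_le _ _)) // mulnC -sum_nat_const leq_sum // => u _.
  by apply: leq_trans (deg4 u); apply/subset_leq_card/subsetP => v; rewrite !inE.
by move: IH; rewrite expnS -/(ball n S); clear; nia.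
Qed.

Lemma ball_subset n S : S \subset ball n S.
Proof.
elim: n => [|n IH] //=; apply: subset_trans IH _; exact: subsetUl.
Qed.

Lemma ball_mono n m S : n <= m -> ball n S \subset ball m S.
Proof. by move=> /subnK<-; rewrite /ball iterD; apply: ball_subset. Qed.

Lemma ball1_path p S u : u \in S -> path f u p -> last u p \in ball (size p) S.
Proof.
elim: p u S => [|v p IH] u S //= uS /andP[fuv pp].
rewrite -[ball1 _]/(iter (size p).+1 ball1 S) iterSr; apply: IH pp.
by rewrite inE; apply/orP; right; apply/bigcupP; exists u; rewrite ?inE.
Qed.

Definition bad := [set v | 2 < deg f setT v].

(* A vertex outside [bad] has both of its neighbours in the core, so a walk can only
   leave the core at [bad]. *)
Lemma core_exit Y p u : core f Y -> u \in Y -> path f u p -> last u p \notin Y ->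
  last u p \in ball (size p) (Y :&: bad).
Proof.
move=> cY; elim: p u => [|v p IH] u /=; first by move=> ->.
move=> uY /andP[fuv pp] lY; have [vY|vY] := boolP (v \in Y).
  by apply: (subsetP (ball_mono _ (leqnSn _))); apply: IH.
apply: (@ball1_path (v :: p) _ u); last by rewrite /= fuv.
have [y1 [y2 [y12 y1Y y2Y f1 f2]]] := cY u uY.
rewrite !inE uY; apply/card_gt2P; exists y1, y2, v; split; rewrite ?inE //.
split=> //; apply: contraNneq vY; [by move=> <-|by move=> ->].
Qed.

Definition near d u v := exists p, [/\ path f u p, last u p = v & size p <= d].

(** A greedy choice. A light core [Y] exists by counting; deleting it with the ball of radius [d]
    around [Y :&: bad] lowers the excess of pairs over [2 * #|A|] by at most six per vertex of the
    ball. By [core_exit], cores found later are farther than [d] from [Y]. *)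
Lemma far_cores m d j A : 0 < m ->
  (forall h, h * m <= #|bad| ->
     2 * #|A| + h * h.+1 + j * (6 * (5 ^ d * (2 * (4 * m + 1)))) < pairs f A) ->
  exists P : {set {set V}}, [/\ #|P| = j.+1,
    forall Y, Y \in P -> [/\ Y != set0, Y \subset A & core f Y] &
    forall Y Y' u v, Y \in P -> Y' \in P -> Y != Y' -> u \in Y -> v \in Y' -> ~ near d u v].
Proof.
move=> m0; elim: j A => [|j IH] A H.
(* Base case and induction step both start from a core of weight at most [2 * (4 * m + 1)]; if there
   were none, [cheap_free_bound] would contradict the hypothesis on [pairs f A]. *)
all: have : exists Y, [/\ Y != set0, Y \subset A, core f Y & wt bad Y <= 2 * (4 * m + 1)].
1,3: have [/existsP[Y /and4P[Y0 YA /forall_inP cY wY]]|] :=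
    boolP [exists Y : {set V}, [&& Y != set0, Y \subset A, [forall v in Y, 1 < deg f Y v] & wt bad Y <= 2 * (4 * m + 1)]];
  [by exists Y; split=> //; apply/coreP|
   move=> /existsPn N; exfalso;
   have [|h [wh ph]] := @cheap_free_bound _ f bad m sf irf m0 deg4 A;
   [by move=> Y Y0 YA /coreP cY; rewrite ltnNge; apply: contra (N Y) => ->;
       rewrite Y0 YA andbT /=; apply/forall_inP
   |have := H h; rewrite (leq_trans wh (subset_leq_card (subsetIr _ _))) => /(_ isT);
    move: ph; clear; lia]].
- case=> Y [Y0 YA cY _]; exists [set Y]; split.
  + by rewrite cards1.
  + by move=> Z; rewrite inE => /eqP->.
  + by move=> Y1 Y2 u v; rewrite !inE => /eqP-> /eqP->; rewrite eqxx.
case=> Y [Y0 YA cY wY].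
set bl := ball d (Y :&: bad); pose D := A :&: (Y :|: bl).
have cbl : #|bl| <= 5 ^ d * (2 * (4 * m + 1)).
  by rewrite (leq_trans (card_ball _ _)) // leq_mul2l wY orbT.
(* Each vertex of [D] contributes its degree inside [D] plus twice its degree across. In [bl] this
   is at most [8 = 2 + 6]. Outside [bl] the vertex lies in [Y] and has degree two with both
   neighbours in [Y], so it contributes only 2. *)
have pD : pairs f A <= pairs f (A :\: D) + 2 * #|D| + 6 * #|bl|.
  rewrite -{1}(setUD_id (subsetIl A (Y :|: bl))) -/D pairsU ?disjoint_setDr //.
  suff : pairs f D + 2 * cross f D (A :\: D) <= 2 * #|D| + 6 * #|bl| by clear; lia.
  rewrite /pairs /cross big_distrr -big_split /=.
  have: \sum_(v in D) (2 + 6 * (v \in bl)) <= 2 * #|D| + 6 * #|bl|.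
    rewrite big_split sum_nat_const mulnC leq_add2l -big_distrr leq_mul2l /=.
    rewrite -sum1_card [X in _ <= X]big_mkcond [X in X <= _]big_mkcond.
    by apply: leq_sum => v _; case: (v \in D); case: (v \in bl).
  apply: leq_trans; apply: leq_sum => v vD.
  have dv : deg f D v + deg f (A :\: D) v <= deg f setT v.
    by rewrite -degU ?disjoint_setDr // degS // subsetT.
  have [vb|vb] := boolP (v \in bl); first by have := deg4 v; move: dv; clear; lia.
  have vY : v \in Y by move: vD; rewrite !inE (negPf vb) orbF => /andP[].
  have : 1 < deg f D v.
    apply: leq_trans (_ : deg f Y v <= _); first by move/coreP: cY; apply.
    by apply: degS; rewrite subsetI YA subsetUl.
  have : deg f setT v <= 2.
    rewrite leqNgt; apply/negP => b; case/negP: vb; apply: (subsetP (ball_subset _ _)).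
    by rewrite !inE vY.
  by move: dv; clear; lia.
have cD := cardsD_sub (subsetIl A (Y :|: bl)); rewrite -/D in cD.
have [h /H|P [cP P1 P2]] := IH (A :\: D).
  by move: pD cD cbl; clear; nia.
have notin Z : Z \in P -> [disjoint Y & Z] /\ [disjoint bl & Z].
  case/P1=> _ ZA _; split; rewrite disjoints_subset; apply/subsetP => v v1; rewrite inE;
  by apply/negP => /(subsetP ZA); rewrite !inE v1 ?orbT; case: (v \in A).
have far Z u v p : Z \in P -> u \in Y -> v \in Z -> path f u p -> last u p = v -> size p <= d -> False.
  move=> ZP uY vZ pp lp sp; have [dY db] := notin Z ZP.
  have := core_exit cY uY pp; rewrite lp (disjointFl dY vZ) => /(_ isT) vb.
  by have := subsetP (ball_mono (Y :&: bad) sp) v vb; rewrite (disjointFl db vZ).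
exists (Y |: P); split.
- rewrite cardsU1 cP; case: (boolP (Y \in P)) => // /notin[+ _].
  by rewrite -setI_eq0 setIid (negPf Y0).
- move=> Z /setU1P[->//|/P1[Z0 ZA cZ]]; split=> //.
  exact: subset_trans ZA (subsetDl _ _).
- move=> Y1 Y2 u v /setU1P[->|Y1P] /setU1P[->|Y2P]; rewrite ?eqxx // => Y12 u1 v2.
  + by case=> p [pp lp sp]; apply: (far Y2 u v p).
  + case=> p [pp lp sp]; apply: (far Y1 v u (rev (belast u p))) => //.
    * by rewrite -lp rev_path (eq_path (e' := f)) // => a b; rewrite sf.
    * by case: p lp {pp sp} => //= w p _; rewrite rev_cons last_rcons.
    * by rewrite size_rev size_belast.
  + by move=> N; apply: (P2 Y1 Y2 u v).
Qed.

End FarCores.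

(** * Attaching an ear *)

Section Links.
Variable V : finType.
Implicit Types (A B S Y Z F : {set V}) (f e : rel V) (l s : seq V).

(* [lk a l] is the set of edges of the walk [a :: l]. *)
Fixpoint lk (a : V) l : rel V := fun u v =>
  if l is b :: l' then (u == a) && (v == b) || (u == b) && (v == a) || lk b l' u v else false.

Lemma lkC a l : symmetric (lk a l).
Proof.
elim: l a => //= b l IH a u v; rewrite IH; congr (_ || _).
by rewrite orbC ![(v == _) && _]andbC.
Qed.

Lemma lk_cat a l1 l2 u v : lk a (l1 ++ l2) u v = lk a l1 u v || lk (last a l1) l2 u v.
Proof. by elim: l1 a => //= b l IH a; rewrite IH !orbA. Qed.

Lemma lk_in a l u v : lk a l u v -> u \in a :: l.
Proof.
elim: l a => //= b l IH a /orP[/orP[]/andP[/eqP-> _]|/IH]; rewrite !inE ?eqxx ?orbT //.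
by move=> ->; rewrite orbT.
Qed.

Lemma lk_edge e a l u v : symmetric e -> path e a l -> lk a l u v -> e u v.
Proof.
move=> se; elim: l a => //= b l IH a /andP[eab pl] /orP[/orP[]/andP[/eqP-> /eqP->]|/(IH _ pl)] //.
by rewrite se.
Qed.

Lemma path_lk a l : path (lk a l) a l.
Proof.
elim: l a => //= b l IH a; rewrite !eqxx /=; apply: sub_path (IH b) => u v /= ->.
by rewrite orbT.
Qed.

Lemma path_revE e a l b : symmetric e -> path e a (rcons l b) = path e b (rcons (rev l) a).
Proof.
move=> se; have := rev_path e a (rcons l b).
rewrite last_rcons belast_rcons rev_cons => ->.
by apply: eq_path => u v; rewrite se.
Qed.

Lemma mem_split (z : V) l : z \in l -> exists l1 l2, l = l1 ++ z :: l2.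
Proof. by move=> zl; case/splitPr: l / zl => l1 l2; exists l1, l2. Qed.

Definition add_links f a l : rel V := fun u v => f u v || lk a l u v.

Definition on F f := forall u v, f u v -> (u \in F) && (v \in F).

Lemma add_links_sym f a l : symmetric f -> symmetric (add_links f a l).
Proof. by move=> sf u v; rewrite /add_links sf lkC. Qed.

Lemma add_links_on F f a l : symmetric f -> on F f -> a \in F ->
  on (F :|: [set v in l]) (add_links f a l).
Proof.
move=> sf Ff aF u v /orP[/Ff/andP[uF vF]|luv]; rewrite !inE ?uF ?vF //.
have := lk_in luv; have := lk_in (_ : lk a l v u); rewrite lkC => /(_ luv).
by rewrite !inE => /orP[/eqP->|->] /orP[/eqP->|->]; rewrite ?aF ?orbT.
Qed.

(** In terms of cores: [f] minus [XB] is a forest. *)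
Definition acyc f (XB : {set V}) := forall Z, core f Z -> [disjoint Z & XB] -> Z = set0.

Lemma core_on F f Z : on F f -> core f Z -> Z \subset F.
Proof. by move=> Ff cZ; apply/subsetP => z /cZ[y1 [y2 [_ _ _ /Ff/andP[zF _] _]]]. Qed.

Section Ear.
Variables (F : {set V}) (f : rel V) (x y : V) (s : seq V).
Hypotheses (sf : symmetric f) (Ff : on F f) (xF : x \in F) (yF : y \in F).
Hypotheses (us : uniq s) (sF : forall v, v \in s -> v \notin F) (xys : (x == y) < size s).
Let f' := add_links f x (rcons s y).

Lemma ear_nbrs_in s1 q s2 u : s = s1 ++ q :: s2 ->
  f' q u = (u == last x s1) || (u == head y s2).
Proof.
move=> Es.
have qF : q \notin F by apply: sF; rewrite Es mem_cat inE eqxx orbT.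
have neqF z : z \in F -> (q == z) = false by move=> zF; apply: contraNF qF => /eqP->.
have qs : (q \notin s1) && (q \notin s2).
  by move: us; rewrite Es -cat_rcons cat_uniq rcons_uniq => /and3P[/andP[-> _] /hasPn H _] /=;
  apply/negP => /H; rewrite mem_rcons inE eqxx.
case/andP: qs => q1 q2.
have qx : q \in x :: s1 = false by rewrite inE neqF // (negPf q1).
rewrite /f' /add_links Es rcons_cat lk_cat.
rewrite (_ : f q u = false); last by apply: contraNF qF => /Ff/andP[].
rewrite (_ : lk x s1 q u = false) /=; last by apply/negP => /lk_in; rewrite qx.
rewrite (_ : (q == last x s1) = false) /=; last first.
  by apply/eqP => E; move: (mem_last x s1); rewrite -E qx.
rewrite eqxx /=; congr (_ || _).
case: s2 q2 {Es} => [|h t] /=; first by rewrite (neqF y yF) ?eqxx ?orbF.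
rewrite inE negb_or => /andP[qh qt]; rewrite ?eqxx (negPf qh) /=.
rewrite [lk _ _ _ _](_ : _ = false) ?orbF //.
by apply/negP => /lk_in; rewrite inE (negPf qh) mem_rcons inE (neqF y yF) (negPf qt).
Qed.

Lemma ear_ends_neq s1 q s2 : s = s1 ++ q :: s2 -> last x s1 != head y s2.
Proof.
move=> Es; have qF z : z \in s -> forall w, w \in F -> z != w.
  by move=> /sF zF w wF; apply: contraNneq zF => ->.
case: s2 Es => [|h t] Es /=.
  case: (lastP s1) Es => [|s1' w] Es /=.
    by move: xys; rewrite Es /=; case: eqP.
  by rewrite last_rcons; apply: qF => //; rewrite Es mem_cat mem_rcons inE eqxx.
have hs : h \in s by rewrite Es mem_cat !inE eqxx !orbT.
rewrite eq_sym; case: (lastP s1) Es => [|s1' w] Es /=; first exact: qF.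
rewrite last_rcons; move: us; rewrite Es cat_uniq => /and3P[_ /hasPn H _].
by apply: contraNneq (H h _) => [->|]; rewrite ?mem_rcons ?inE ?eqxx ?orbT.
Qed.

Lemma ear_deg_in v : v \in s -> deg f' setT v = 2.
Proof.
move=> /mem_split[s1 [s2 Es]].
rewrite /deg (_ : [set _ in _ | _] = [set last x s1; head y s2]).
  by rewrite cards2 (ear_ends_neq Es).
by apply/setP => u; rewrite !inE (ear_nbrs_in _ Es).
Qed.

Lemma ear_nbrs_out v u : v \in F ->
  f' v u = [|| f v u, (v == x) && (u == head y s) | (v == y) && (u == last x s)].
Proof.
move=> vF; have neqF z : z \in s -> (v == z) = false.
  by move=> /sF zF; apply: contraNF zF => /eqP <-.
rewrite /f' /add_links; congr (_ || _).
case: s xys us neqF => [|h t] //= _ /andP[hs ut] neqF.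
rewrite (neqF h) ?inE ?eqxx //= orbF; congr (_ || _).
rewrite -cats1 lk_cat /= (_ : lk h t v u = false); last first.
  by apply/negP => /lk_in /neqF; rewrite eqxx.
by rewrite (neqF (last h t)) ?mem_last //= orbF.
Qed.

Lemma ear_deg_out v : v \in F -> deg f' setT v = deg f setT v + (v == x) + (v == y).
Proof.
move=> vF.
have [hs ls] : head y s \in s /\ last x s \in s.
  case: s xys => [|h t] /=; first by rewrite ltn0.
  by rewrite mem_head mem_last.
have hl : (v == x) && (v == y) -> head y s != last x s.
  case/andP=> /eqP Ex /eqP Ey; move: xys us; rewrite -Ex -Ey eqxx.
  case: s => [//|h [//|h2 t]] _ /= /andP[+ _]; apply: contra => /eqP->; exact: mem_last.
have nF z : z \in s -> z \in [set u | f v u] = false.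
  by move=> /sF zF; rewrite inE; apply: contraNF zF => /Ff/andP[].
rewrite /deg -addnA.
have -> : [set u in setT | f' v u] = [set u | f v u] :|:
    ([set u | (v == x) && (u == head y s)] :|: [set u | (v == y) && (u == last x s)]).
  by apply/setP => u; rewrite !inE ear_nbrs_out.
have E b z : #|[set u : V | b && (u == z)]| = b.
  case: b; last by apply/eqP; rewrite cards_eq0; apply/eqP/setP => u; rewrite !inE.
  by rewrite (_ : [set _ | _] = [set z]) ?cards1 //; apply/setP => u; rewrite !inE.
rewrite [in RHS](_ : [set u in setT | f v u] = [set u | f v u]); last by apply/setP => u; rewrite !inE.
rewrite cardsU disjoint_setI0 ?cards0 ?subn0.
  rewrite cardsU disjoint_setI0 ?cards0 ?subn0 ?E //.
  rewrite -setI_eq0; apply/eqP/setP => u; rewrite !inE; apply/negP.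
  move=> /andP[/andP[vx /eqP uh] /andP[vy /eqP ul]].
  by move: (hl); rewrite vx vy -uh -ul eqxx => /(_ isT).
rewrite -setI_eq0; apply/eqP/setP => u; rewrite in_setI in_set0.
apply/negP => /andP[uf]; rewrite !inE => /orP[]/andP[_ /eqP E1]; move: uf.
  by rewrite E1 nF.
by rewrite E1 nF.
Qed.

(** An interior vertex has only its two neighbours on the ear, so a core containing it contains
    both, and this propagates to the two ends. *)
Lemma ear_core_all Z z : core f' Z -> z \in Z -> z \in s -> {subset x :: rcons s y <= Z}.
Proof.
move=> cZ zZ zs.
have closed s1 q s2 : s = s1 ++ q :: s2 -> q \in Z -> (last x s1 \in Z) && (head y s2 \in Z).
  move=> Es /cZ[y1 [y2 [y12 y1Z y2Z]]]; rewrite !(ear_nbrs_in _ Es).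
  move=> /orP[]/eqP E1 /orP[]/eqP E2; move: y12; rewrite E1 E2 ?eqxx // => _.
    by rewrite -E1 -E2 y1Z y2Z.
  by rewrite -E1 -E2 y1Z y2Z.
have [s1 [s2 Es]] := mem_split zs.
have L : forall s1 q s2, s = s1 ++ q :: s2 -> q \in Z -> {subset x :: rcons s1 q <= Z}.
  elim/last_ind => [|t w IH] q t2 Et qZ u; have /andP[lZ _] := closed _ _ _ Et qZ.
    by rewrite /= !inE => /orP[]/eqP->.
  rewrite last_rcons in lZ; have H := IH w (q :: t2); rewrite -cat_rcons in H.
  by rewrite -rcons_cons mem_rcons inE => /orP[/eqP->//|]; apply: H.
have R : forall s2 q s1, s = s1 ++ q :: s2 -> q \in Z -> {subset q :: rcons s2 y <= Z}.
  elim => [|w t IH] q t1 Et qZ u; have /andP[_ rZ] := closed _ _ _ Et qZ.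
    by rewrite /= !inE => /orP[]/eqP->.
  rewrite inE => /orP[/eqP->//|]; apply: (IH _ (rcons t1 q)) => //.
  by rewrite cat_rcons.
move=> u; rewrite Es rcons_cat -cat_rcons /= -cat_cons mem_cat => /orP[].
  exact: (L _ _ _ Es zZ).
rewrite -/(rcons _ _) => us2; apply: (R _ _ _ Es zZ).
by rewrite inE us2 orbT.
Qed.

Lemma ear_core_out Z : core f' Z -> (forall z, z \in Z -> z \notin s) -> Z \subset F -> core f Z.
Proof.
move=> cZ Zs ZF v vZ; have [y1 [y2 [y12 y1Z y2Z]]] := cZ v vZ.
have vF := subsetP ZF v vZ.
have [hs ls] : head y s \in s /\ last x s \in s.
  case: s xys => [|h t] /=; first by rewrite ltn0.
  by rewrite mem_head mem_last.
have nb u : u \in Z -> f' v u -> f v u.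
  move=> uZ; rewrite ear_nbrs_out // => /or3P[//||] /andP[_ /eqP E];
    by have := Zs u uZ; rewrite E ?hs ?ls.
by move=> f1 f2; exists y1, y2; rewrite !nb.
Qed.

Variables (B XB : {set V}).
Hypothesis irf : irreflexive f.
Hypothesis XBB : XB \subset B.

(** A core using the ear contains [x] and [y]. The component of [x] in its old part misses [y], so
    there only [x] can have lost a neighbour, and [nearly_core] yields a core of [f] itself. *)
Lemma ear_acyc_separated (R : {set V}) : acyc f XB -> XB \subset R ->
  ~~ connect (rst f (~: R)) x y -> acyc f' R.
Proof.
move=> ac XBR nxy Z cZ dZ.
have f'on := add_links_on (l := rcons s y) sf Ff xF.
have ZF' := core_on f'on cZ.
have dZ' Y : Y \subset Z -> [disjoint Y & XB].
  by move=> YZ; apply: disjointWl YZ _; apply: disjointWr XBR dZ.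
have [/existsP[z /andP[zZ zs]]|ns] := boolP [exists z, (z \in Z) && (z \in s)]; last first.
  have nsZ z : z \in Z -> z \notin s.
    by move=> zZ; apply: contra ns => zs; apply/existsP; exists z; rewrite zZ.
  apply: ac (dZ' Z (subxx _)); apply: ear_core_out => //.
  apply/subsetP => z zZ; have := subsetP ZF' z zZ; rewrite !inE mem_rcons inE (negPf (nsZ z zZ)) orbF.
  by case/orP=> // /eqP->.
have allZ := ear_core_all cZ zZ zs.
have xZ : x \in Z by apply: allZ; rewrite mem_head.
have nxy' : x != y by apply: contraNneq nxy => ->; rewrite connect0.
pose Q := Z :&: F; have xQ : x \in Q by rewrite inE xZ.
pose K := comp f Q x; have KQ : K \subset Q := comp_sub f xQ.
have yK : y \notin K.
  apply: contra nxy; rewrite inE; apply: rst_sub; apply/subsetP => u.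
  by rewrite !inE => /andP[uZ _]; rewrite (disjointFr dZ uZ).
have inK v u : v \in K -> f v u -> u \in Z -> u \in K.
  move=> vK fvu uZ; apply: (comp_step vK) => //; first exact: (subsetP KQ).
  by rewrite inE uZ; case/andP: (Ff fvu).
have [|v vK vx|Y [Y0 YK cY]] := @nearly_core _ f K x sf irf (comp_id _ _ _).
- have [y1 [y2 [y12 y1Z y2Z]]] := cZ x xZ.
  rewrite !ear_nbrs_out // (negPf nxy') eqxx /= !orbF => f1 f2.
  have [f1'|nf1] := boolP (f x y1); first by exists y1 => //; apply: inK f1' _; rewrite ?comp_id.
  have [f2'|nf2] := boolP (f x y2); first by exists y2 => //; apply: inK f2' _; rewrite ?comp_id.
  by move: f1 f2 y12; rewrite (negPf nf1) (negPf nf2) => /eqP-> /eqP->; rewrite eqxx.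
- have vy : v != y by apply: contraNneq yK => <-.
  have /setIP[vZ vF] := subsetP KQ v vK.
  have [y1 [y2 [y12 y1Z y2Z]]] := cZ v vZ.
  rewrite !ear_nbrs_out // (negPf vx) (negPf vy) !orbF => f1 f2.
  by exists y1, y2; split=> //; apply: inK; eassumption.
have YZ : Y \subset Z by apply: subset_trans YK (subset_trans KQ (subsetIl _ _)).
by case/set0Pn: Y0 => w; rewrite (ac Y cY (dZ' Y YZ)) inE.
Qed.

(** A root on the ear blocks all new cycles. Otherwise [x] and [y] are not connected in [f] off [B].
    If they are connected off [XB], the connecting path passes through some [b] in [B], and [b] is
    taken: were [x] and [y] still connected after its deletion, [f] would have a cycle through [b]
    avoiding [XB]. *)
Lemma ear_acyc : acyc f XB ->
  ~~ [&& x \notin B, y \notin B, all (fun v => v \notin B) s & connect (rst f (~: B)) x y] ->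
  exists W : {set V}, [/\ #|W| <= 1, W \subset B, W \subset F :|: [set v in s] &
    acyc f' (XB :|: W)].
Proof.
move=> ac nb; have f'on := add_links_on (l := rcons s y) sf Ff xF.
have [/existsP[b /andP[bl bB]]|noB] := boolP [exists b, (b \in x :: rcons s y) && (b \in B)].
  exists [set b]; split; rewrite ?cards1 ?sub1set //.
    by move: bl; rewrite !inE mem_rcons inE => /or3P[/eqP->|/eqP->|->]; rewrite ?xF ?yF ?orbT.
  move=> Z cZ dZ; have ZF' := core_on f'on cZ.
  have bZ : b \notin Z by apply/negP => /(disjointFr dZ); rewrite !inE eqxx orbT.
  have nsZ z : z \in Z -> z \notin s.
    by move=> zZ; apply: contra bZ => zs; apply: (ear_core_all cZ zZ zs).
  apply: ac (disjointWr (subsetUl _ _) dZ); apply: ear_core_out => //.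
  apply/subsetP => z zZ; have := subsetP ZF' z zZ; rewrite !inE mem_rcons inE (negPf (nsZ z zZ)) orbF.
  by case/orP=> // /eqP->.
have nB v : v \in x :: rcons s y -> v \notin B.
  by move=> vl; apply: contra noB => vB; apply/existsP; exists v; rewrite vl.
have xB : x \notin B by apply: nB; rewrite mem_head.
have yB : y \notin B by apply: nB; rewrite inE mem_rcons mem_head orbT.
have ncB : ~~ connect (rst f (~: B)) x y.
  apply: contra nb => ->; rewrite xB yB andbT /=; apply/allP => v vs.
  by apply: nB; rewrite inE mem_rcons inE vs !orbT.
have [con|ncon] := boolP (connect (rst f (~: XB)) x y); last first.
  exists set0; rewrite cards0 !sub0set setU0; split=> //.
  exact: ear_acyc_separated.
have xXB : x \in ~: XB by rewrite inE; apply: contra xB; apply: (subsetP XBB).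
have [p [pp up sp lp]] := rst_connectP xXB con.
have [b bp bB] : exists2 b, b \in x :: p & b \in B.
  apply/hasP; apply: contraNT ncB => /hasPn nBp; rewrite -lp; apply: path_connect_rst => //.
  by move=> v /nBp; rewrite inE.
have bx : b != x by apply: contraNneq xB => <-.
have bXB : b \in ~: XB by apply: sp.
have bF : b \in F.
  move: bp; rewrite inE (negPf bx) /= => bp; case/splitPr: p / bp pp {up sp lp} => p1 p2.
  by rewrite cat_path /= => /and3P[_ /Ff/andP[]].
exists [set b]; split; rewrite ?cards1 ?sub1set ?inE ?bF //.
apply: ear_acyc_separated => //; first exact: subsetUl.
apply/negP => con'.
move: bp; rewrite inE (negPf bx) /= => /mem_split[p1 [p2 Ep]]; rewrite {}Ep in pp up sp lp.
case: p2 pp up sp lp => [|v p2]; first by rewrite last_cat /= => _ _ _ E; rewrite -E bB in yB.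
rewrite cat_path last_cat /= => /and3P[pp1 flb /andP[fbv pp2]] up sp lp.
have {}up : uniq ((x :: p1) ++ b :: v :: p2) by [].
have [c [uc cc sc subc]] : exists c, [/\ uniq (b :: c), cycle f (b :: c), 2 < size (b :: c) & {subset b :: c <= ~: XB}].
  have subR u : u \in x :: p1 ++ v :: p2 -> u \in ~: XB :\ b.
    move=> uin; rewrite in_setD1 sp ?andbT.
      apply: contraTneq uin => ->; have : uniq (b :: (v :: p2) ++ (x :: p1)) by rewrite uniq_catC in up.
      by rewrite cons_uniq => /andP[+ _]; rewrite -[x :: p1 ++ _]cat_cons !mem_cat orbC.
    by move: uin; rewrite -![x :: p1 ++ _]cat_cons !mem_cat ![_ \in _ :: v :: p2]inE => /orP[->|->]; rewrite ?orbT.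
  apply: (@rst_cycle_core _ f (~: XB) b (last x p1) v) => //.
  - apply/eqP => E; move: up; rewrite cat_uniq => /and3P[_ /hasPn/(_ v) H _].
    by have /negP := H (mem_behead (s := b :: v :: p2) (mem_head v p2)); rewrite -E; apply; apply: mem_last.
  - have : last x p1 \in ~: XB :\ b by apply: subR; rewrite -cat_cons mem_cat mem_last.
    by rewrite in_setD1 => /andP[].
  - have : v \in ~: XB :\ b by apply: subR; rewrite inE mem_cat mem_head !orbT.
    by rewrite in_setD1 => /andP[].
  - by rewrite sf.
  apply: (@connect_trans _ _ x).
    rewrite rst_connectC //; apply: path_connect_rst => // u up1; apply: subR.
    by rewrite -cat_cons mem_cat up1.
  apply: (@connect_trans _ _ y).
    by apply: rst_sub con'; apply/subsetP => u; rewrite !inE negb_or andbC.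
  rewrite rst_connectC // -lp; apply: path_connect_rst => // u up2; apply: subR.
  by rewrite inE mem_cat up2 !orbT.
have : [set z in b :: c] = set0.
  apply: ac; first exact: cycle_core.
  by rewrite disjoints_subset; apply/subsetP => u; rewrite inE => /subc.
by move/setP/(_ b); rewrite !inE eqxx.
Qed.

End Ear.
End Links.

(** * Ears and rooted cycles *)

Section Near.
Variable V : finType.
Implicit Types (f : rel V).

Lemma near_refl f d u : near f d u u.
Proof. by exists [::]. Qed.

Lemma near1 f d u v : 0 < d -> f u v -> near f d u v.
Proof. by move=> d0 fuv; exists [:: v]; rewrite /= fuv. Qed.

Lemma near_le f d d' u v : d <= d' -> near f d u v -> near f d' u v.
Proof. by move=> dd [p [pp lp sp]]; exists p; split=> //; apply: leq_trans dd. Qed.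

Lemma near_sub f f' d u v : subrel f f' -> near f d u v -> near f' d u v.
Proof. by move=> ff [p [pp lp sp]]; exists p; split=> //; apply: sub_path pp. Qed.

Lemma near_trans f d1 d2 u v w : near f d1 u v -> near f d2 v w -> near f (d1 + d2) u w.
Proof.
move=> [p [pp lp sp]] [q [pq lq sq]]; exists (p ++ q).
by rewrite cat_path last_cat lp pp pq size_cat leq_add.
Qed.

Lemma near_sym f d u v : symmetric f -> near f d u v -> near f d v u.
Proof.
move=> sf [p [pp lp sp]]; exists (rev (belast u p)); split.
- by rewrite -lp rev_path (eq_path (e' := f)) // => a b; rewrite sf.
- by case: p lp {pp sp} => //= w p _; rewrite rev_cons last_rcons.
- by rewrite size_rev size_belast.
Qed.

End Near.

Section Objects.
Variables (V : finType) (e : rel V) (B : {set V}).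
Hypotheses (se : symmetric e) (ire : irreflexive e).
Implicit Types (F X XB : {set V}) (f : rel V) (l lam s : seq V).

Definition cnb X : {set V} := X :|: [set y | [exists x in X, e x y]].

(** New ears and cycles draw their new vertices from here. Excluding the closed neighbourhood, and
    not just [X], ensures that they never touch a vertex of [X]. *)
Definition off F X v := (v \notin cnb X) && (v \notin F).

(* The last condition excludes an empty interior and, when the ends coincide, a single
   interior vertex. *)
Definition ear F X x s y :=
  [/\ x \in F, y \in F, path e x (rcons s y) & [/\ uniq s, all (off F X) s & (x == y) < size s]].

(* The ears that would close a cycle avoiding [B]. *)
Definition benign f x s y :=
  [&& x \notin B, y \notin B, all (fun v => v \notin B) s & connect (rst f (~: B)) x y].

Definition bcyc (P : pred V) c := [/\ uniq c, cycle e c, 2 < size c, all P c & has (mem B) c].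

Lemma cnbS X (Y : {set V}) : X \subset Y -> cnb X \subset cnb Y.
Proof.
move=> sXY; apply: setUSS => //; apply/subsetP => y; rewrite !inE.
by case/exists_inP=> x xX exy; apply/exists_inP; exists x => //; apply: (subsetP sXY).
Qed.

Lemma cnb_adj X x y : x \in X -> e x y -> y \in cnb X.
Proof. by move=> xX exy; rewrite !inE; apply/orP; right; apply/exists_inP; exists x. Qed.

Lemma off_sub F X (F' X' : {set V}) v : F \subset F' -> X \subset X' -> off F' X' v -> off F X v.
Proof.
move=> FF XX /andP[vX vF]; apply/andP; split; first by apply: contra vX; apply/subsetP/cnbS.
by apply: contra vF; apply/subsetP.
Qed.

Lemma off_adj F X u v : off F X u -> e u v -> v \notin X.
Proof. by case/andP=> uX _ euv; apply: contra uX => vX; apply: (cnb_adj vX); rewrite se. Qed.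

Section MinimalEar.
Variables (F X : {set V}) (f : rel V) (n : nat).
Hypothesis min_ear : forall x s y, ear F X x s y -> size s < n -> benign f x s y.
Hypothesis min_cyc : forall c, bcyc (off F X) c -> n <= size c.
Variables (x y : V) (s : seq V).
Hypotheses (earS : ear F X x s y) (sn : size s = n) (nbS : ~~ benign f x s y).

(** The detour yields two ears ending at [z], both shorter and hence benign. Concatenating the two
    connections at [z] would make the original ear benign. *)
Lemma ear_contact s1 q s2 lam z : s = s1 ++ q :: s2 -> z \in F ->
  path e q (rcons lam z) -> uniq (lam ++ s) -> all (off F X) lam ->
  size lam < size s1 -> size lam < size s2 -> False.
Proof.
move=> Es zF pz ulam alam l1 l2; case: earS => xF yF pxy [us als _].
move: pxy als ulam; rewrite Es rcons_cat /= cat_path /= => /and3P[p1 p1q p2].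
rewrite all_cat /= => /and3P[a1 aq a2]; rewrite cat_uniq => /and3P[ul].
rewrite has_cat /= negb_or => /andP[h1]; rewrite negb_or => /andP[nq h2].
rewrite cat_uniq /= => /and3P[u1]; rewrite negb_or => /andP[nq1 h12] /andP[nq2 u2].
have H1 : benign f x (s1 ++ q :: lam) z.
  apply: min_ear; last by move: l2; rewrite -sn Es !size_cat /=; clear; lia.
  split=> //; first by rewrite rcons_cat cat_path /= p1 p1q.
  split; last by move: l1; rewrite size_cat /=; case: (x == z) => //=; clear; lia.
    by rewrite cat_uniq /= u1 nq ul negb_or nq1 /= andbT has_sym.
  by rewrite all_cat /= a1 aq alam.
have H2 : benign f z (rev lam ++ q :: s2) y.
  apply: min_ear; last by move: l1; rewrite -sn Es !size_cat /= size_rev; clear; lia.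
  have pz' : path e z (rcons (rev lam) q) by rewrite -path_revE.
  split=> //; first by rewrite rcons_cat /= -cat_rcons cat_path pz' last_rcons.
  split; last by move: l2; rewrite size_cat /=; case: (z == y) => //=; clear; lia.
    by rewrite cat_uniq rev_uniq ul /= mem_rev negb_or nq nq2 u2 has_sym has_rev has_sym h2.
  by rewrite all_cat all_rev /= aq alam.
case/and4P: H1 => xB zB; rewrite all_cat /= => /and3P[B1 qB _] c1.
case/and4P: H2 => _ yB; rewrite all_cat /= => /and3P[_ _ B2] c2.
case/negP: nbS; apply/and4P; split=> //; last exact: connect_trans c1 c2.
by rewrite Es all_cat /= B1 qB.
Qed.

(** Replacing [s2] by [lam] gives a shorter, hence benign ear. Since the original one is not benign,
    a root lies in [s2], so [s2] and [lam] form a rooted cycle, whose length is at least [n]. *)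
Lemma ear_bypass s1 a s2 b s3 lam : s = s1 ++ a :: s2 ++ b :: s3 ->
  path e a (rcons lam b) -> uniq (lam ++ s) -> all (off F X) lam ->
  size lam < size s2 -> size s1 + size s3 <= size lam.
Proof.
move=> Es pz ulam alam l2; case: earS => xF yF pxy [us als _].
move: pxy als ulam; rewrite Es rcons_cat /= rcons_cat /= cat_path /= cat_path /=.
move=> /and5P[p1 p1a pa2 pb p3].
rewrite all_cat /= all_cat /= => /and5P[a1 aa a2 ab a3]; rewrite cat_uniq => /and3P[ul].
rewrite has_cat /= has_cat /= !negb_or => /and5P[h1 na h2 nb h3].
rewrite cat_uniq /= => /and3P[u1].
rewrite !negb_or has_cat /= !negb_or mem_cat inE !negb_or.
move=> /and4P[na1 h12 nb1 h13] /andP[/and3P[na2 nab na3]].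
rewrite cat_uniq /= => /and3P[u2]; rewrite !negb_or => /andP[nb2 h23] /andP[nb3 u3].
have H : benign f x (s1 ++ a :: lam ++ b :: s3) y.
  apply: min_ear; last by move: l2; rewrite -sn Es !size_cat /= !size_cat /=; clear; lia.
  split=> //.
    move: pz; rewrite rcons_path => /andP[pa lb].
    by rewrite rcons_cat /= rcons_cat /= cat_path /= cat_path /= p1 p1a pa lb.
  split; last by rewrite size_cat /= size_cat /=; case: (x == y) => //=; clear; lia.
    rewrite cat_uniq /= u1 negb_or na1 mem_cat inE !negb_or na nab na3 /=.
    rewrite has_cat /= !negb_or has_sym h1 nb1 h13 /=.
    by rewrite cat_uniq ul /= negb_or nb nb3 u3 h3.
  by rewrite all_cat /= all_cat /= a1 aa alam ab a3.
case/and4P: H => xB yB; rewrite all_cat /= all_cat /= => /and5P[B1 aB _ bB B3] con.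
have hB : has (mem B) s2.
  apply: contraNT nbS => /hasPn nB; apply/and4P; split=> //.
  by rewrite Es all_cat /= all_cat /= B1 aB bB B3 /= andbT; apply/allP => v /nB.
suff: n <= size (a :: s2 ++ b :: rev lam).
  by rewrite -sn Es /= !size_cat /= !size_cat /= size_rev; clear; lia.
apply: min_cyc; split.
- by rewrite /= mem_cat inE !negb_or na2 nab mem_rev na cat_uniq u2 /= negb_or nb2
    mem_rev nb rev_uniq ul has_rev has_sym h2.
- rewrite /= rcons_cat /= cat_path /= pa2 pb /=.
  by rewrite -path_revE.
- by rewrite /= size_cat /=; case: (s2) hB => //= ? ? _; clear; lia.
- by rewrite /= all_cat /= all_rev aa a2 ab.
- by rewrite /= has_cat hB orbT.
Qed.

End MinimalEar.
End Objects.

(** * The invariant and the ear step *)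

Section State.
Variables (V : finType) (e : rel V) (B : {set V}).
Hypotheses (se : symmetric e) (ire : irreflexive e).
Implicit Types (F X XB Z : {set V}) (f : rel V) (l lam s : seq V) (O : {set {set V}}).

(* [M] bounds from below the excess of the edges of [f] over its vertices, [XB] is a
   set of roots meeting every cycle of [f], and [O] consists of the cycles that
   were not attached as ears. *)
Record frame F f X XB M O : Prop := Frame {
  fr_sym : symmetric f;
  fr_edge : subrel f e;
  fr_on : on F f;
  fr_XF : X \subset F;
  fr_XBX : XB \subset X;
  fr_XBB : XB \subset B;
  fr_deg4 : forall v, deg f setT v <= 4;
  fr_deg2 : forall v, v \notin X -> deg f setT v <= 2;
  fr_adj : forall u v, u \in F -> v \in F -> e u v ->
    [|| f u v, u \in X | v \in X] /\ near f 5 u v;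
  fr_acyc : acyc f XB;
  fr_clean : forall x y lam, x \in F -> y \in F -> path e x (rcons lam y) ->
    uniq lam -> all (off e F X) lam -> 0 < size lam <= 2 -> near f 3 x y;
  fr_sum : 2 * (#|F| + M) <= \sum_(v in F) deg f setT v;
  fr_bad : #|bad f| <= 2 * M;
  fr_core : forall Z, Z \in O -> Z != set0 /\ core f Z;
  fr_triv : forall Z Z', Z \in O -> Z' \in O -> Z != Z' -> [disjoint Z & Z'];
  fr_X : #|X| <= 11 * (M + #|O|) }.

Lemma deg_out F f A v : on F f -> v \notin F -> deg f A v = 0.
Proof.
move=> Ff vF; apply/eqP; rewrite cards_eq0 -subset0; apply/subsetP => u.
by rewrite !inE => /andP[_ /Ff/andP[]]; rewrite (negPf vF).
Qed.

Lemma core_subrel f f' Z : subrel f f' -> core f Z -> core f' Z.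
Proof. by move=> ff cZ v /cZ[y1 [y2 [? ? ? /ff f1 /ff f2]]]; exists y1, y2. Qed.

Lemma sum_eq1 F x : x \in F -> \sum_(v in F) (v == x) = 1.
Proof.
move=> xF; rewrite (bigD1 x) //= eqxx big1 // => v /andP[_ vx].
by rewrite (negPf vx).
Qed.

Lemma card_set_seq_le l : #|[set v in l]| <= size l.
Proof. by rewrite cardsE card_size. Qed.

Lemma mem_take_split m s1 a s2 : a \notin take m (s1 ++ a :: s2) -> m <= size s1.
Proof.
apply: contraNT; rewrite -ltnNge take_cat => lm; rewrite ltnNge (ltnW lm) /=.
by rewrite mem_cat; case: (m - size s1) (subn_gt0 (size s1) m) => [|k] //=; [rewrite lm|rewrite inE eqxx orbT].
Qed.

Lemma mem_drop_split m s1 a s2 :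
  a \notin drop (size (s1 ++ a :: s2) - m) (s1 ++ a :: s2) -> m <= size s2.
Proof.
apply: contraNT; rewrite -ltnNge => lm.
have [k ->] : exists k, drop (size (s1 ++ a :: s2) - m) (s1 ++ a :: s2) = k ++ a :: s2; last by rewrite mem_cat mem_head orbT.
exists (drop (size (s1 ++ a :: s2) - m) s1).
rewrite drop_cat size_cat /=; case: ltnP => // h.
have -> : size s1 + (size s2).+1 - m - size s1 = 0 by move: lm h; clear; lia.
by rewrite (drop_oversize h) drop0.
Qed.

Section EarStep.
Variables (F X XB : {set V}) (f : rel V) (M : nat) (O : {set {set V}}) (n : nat).
Hypothesis inv : frame F f X XB M O.
Hypothesis min_ear : forall x s y, ear e F X x s y -> size s < n -> benign B f x s y.
Hypothesis min_cyc : forall c, bcyc e B (off e F X) c -> n <= size c.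
Variables (x y : V) (s : seq V).
Hypotheses (earS : ear e F X x s y) (sn : size s = n) (nbS : ~~ benign B f x s y).

Lemma ear_step : exists F' f' X' XB',
  frame F' f' X' XB' M.+1 O /\ #|~: F'| < #|~: F|.
Proof.
have [xF yF pxy [us als xys]] := earS.
have sF v : v \in s -> v \notin F by move=> /(allP als)/andP[].
have sf := fr_sym inv; have fe := fr_edge inv; have Ff := fr_on inv.
have XF := fr_XF inv; have XBX := fr_XBX inv; have XBB := fr_XBB inv.
have irf : irreflexive f by move=> v; apply/negP => /fe; rewrite ire.
have [W [cW WB WF acW]] := ear_acyc sf Ff xF yF us sF xys irf XBB (fr_acyc inv) nbS.
pose f' := add_links f x (rcons s y); pose F' := F :|: [set v in s].
(* With three interior vertices protected at each end, a later vertex can only be adjacent to ear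
   vertices at least three away from both ends. This exceeds the two interior vertices of a path in
   [fr_clean], as [ear_contact] and [ear_bypass] demand. *)
pose T := [set v in [:: x, y & take 3 s ++ drop (size s - 3) s]].
pose X' := X :|: T :|: W.
have ff' : subrel f f' by move=> u v fuv; rewrite /f' /add_links fuv.
have FF' : F \subset F' by apply: subsetUl.
have XX' : X \subset X' by rewrite /X' -setUA subsetUl.
have sF' v : v \in s -> v \in F' by move=> vs; rewrite !inE vs orbT.
have TX' v : v \in [:: x, y & take 3 s ++ drop (size s - 3) s] -> v \in X'.
  by move=> vT; rewrite !in_setU [v \in T]inE vT orbT.
have pf' : path f' x (rcons s y).
  by apply: sub_path (path_lk _ _) => u v h; rewrite /f' /add_links h orbT.
have sf' : symmetric f' by apply: add_links_sym.
have onF' : on F' f'.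
  move=> u v /(add_links_on sf Ff xF)/andP[].
  rewrite !inE !mem_rcons !inE => h1 h2; apply/andP; split.
    by case/or3P: h1 => [->|/eqP->|->] //; rewrite ?yF ?orbT.
  by case/or3P: h2 => [->|/eqP->|->] //; rewrite ?yF ?orbT.
have [hs ls] : head y s \in s /\ last x s \in s.
  by case: (s) xys => [|h t] /=; rewrite ?ltn0 // mem_head mem_last.
(* The ends are adjacent to vertices that are [off], so they are outside [X] and have degree at most
   two; the degree stays at most four even if [x] and [y] coincide. *)
have [xX yX] : x \notin X /\ y \notin X.
  split.
    apply: (off_adj se (allP als _ hs)).
    by case: (s) xys pxy => [|h t] /=; rewrite ?ltn0 // se => _ /andP[].
  apply: (off_adj se (allP als _ ls)).
  by move: pxy; rewrite rcons_path => /andP[].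
have dx := fr_deg2 inv xX; have dy := fr_deg2 inv yX.
have din v : v \in s -> deg f' setT v = 2 by exact: (ear_deg_in Ff xF yF us sF xys).
have dout v : v \in F -> deg f' setT v = deg f setT v + (v == x) + (v == y).
  by exact: (ear_deg_out Ff us sF xys).
have off' v : off e F' X' v -> off e F X v by apply: off_sub.
have offs v : off e F' X' v -> v \notin s.
  by case/andP=> _; apply: contra => /sF'.
have inF' v : v \in F' -> v \in F \/ v \in s.
  by rewrite !inE => /orP[h|h]; [left|right].
have far a v : a \in s -> off e F' X' v -> e v a -> forall s1 s2, s = s1 ++ a :: s2 -> 3 <= size s1 /\ 3 <= size s2.
  move=> as' ov eva s1 s2 Es; have aX' := off_adj se ov eva; split.
    apply: (@mem_take_split _ _ a s2); rewrite -Es; apply: contra aX' => h.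
    by apply: TX'; rewrite !inE mem_cat h !orbT.
  apply: (@mem_drop_split _ s1 a s2); rewrite -Es; apply: contra aX' => h.
  by apply: TX'; rewrite !inE mem_cat h !orbT.
have cl_in a lam s1 s2 b s3 : s = s1 ++ a :: s2 ++ b :: s3 -> path e a (rcons lam b) ->
    uniq lam -> all (off e F' X') lam -> 0 < size lam <= 2 -> near f' 3 a b.
  move=> Es pl ul al /andP[l0 l2].
  have [sm|lg] := leqP (size s2) (size lam).
    exists (rcons s2 b); split; rewrite ?last_rcons // ?size_rcons; last by apply: leq_trans l2.
    move: pf'; rewrite Es rcons_cat /= cat_path /= => /and3P[_ _].
    by rewrite rcons_cat /= -cat_rcons cat_path => /andP[].
  have := ear_bypass se min_ear min_cyc earS sn nbS Es pl _ _ lg.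
  have -> : uniq (lam ++ s).
    rewrite cat_uniq ul us andbT /=; apply/hasPn => v vs; apply/negP => /(allP al)/offs.
    by rewrite vs.
  rewrite (sub_all off' al) => /(_ isT isT) H.
  have [|||h1 _] := far a (head b lam) _ _ _ s1 (s2 ++ b :: s3) Es.
  - by rewrite Es mem_cat mem_head orbT.
  - by case: (lam) l0 al => //= w t _ /andP[].
  - by case: (lam) l0 pl => //= w t _ /andP[]; rewrite se.
  by move: H h1 l2; clear; lia.
have cl_mix a z lam : a \in s -> z \in F -> path e a (rcons lam z) ->
    uniq lam -> all (off e F' X') lam -> 0 < size lam <= 2 -> near f' 3 a z.
  move=> as' zF pl ul al /andP[l0 l2]; have [s1 [s2 Es]] := mem_split as'.
  have [|||h1 h2] := far a (head z lam) _ _ _ s1 s2 Es => //.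
  - by case: (lam) l0 al => //= w t _ /andP[].
  - by case: (lam) l0 pl => //= w t _ /andP[]; rewrite se.
  case: (ear_contact se min_ear earS sn nbS Es zF pl).
  - rewrite cat_uniq ul us andbT /=; apply/hasPn => v vs; apply/negP => /(allP al)/offs.
    by rewrite vs.
  - exact: (sub_all off' al).
  - by move: l2 h1; clear; lia.
  - by move: l2 h2; clear; lia.
(* By [ear_contact] with an empty detour only the first and last interior vertices can have
   neighbours in [F]; for these [fr_clean] applies to a path with one interior vertex. *)
have ad_mix u v : u \in s -> v \in F -> e u v -> (u \in X') /\ near f' 4 u v.
  move=> us' vF euv; have [s1 [s2 Es]] := mem_split us'.
  have ou : all (off e F X) [:: u] by rewrite /= (allP als).
  case: s1 Es => [|h1 t1] Es.
    split; first by apply: TX'; rewrite Es !inE eqxx ?orbT.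
    have fxu : f' u x by rewrite sf'; move: pf'; rewrite Es => /andP[].
    apply: (near_trans (d1 := 1) (d2 := 3) (v := x)); first exact: near1.
    have exu : e x u by move: pxy; rewrite Es => /andP[].
    by apply: near_sub ff' _; apply: (fr_clean inv xF vF _ _ ou); rewrite //= exu euv.
  case: s2 Es => [|h2 t2] Es; last first.
    by case: (ear_contact se min_ear earS sn nbS Es vF (lam := [::])); rewrite //= euv.
  have E2 : s = rcons (h1 :: t1) u by rewrite Es -cats1.
  split.
    apply: TX'; rewrite !inE mem_cat; apply/orP; right; apply/orP; right; apply/orP; right.
    by apply: contraT; rewrite {1 2}Es => /mem_drop_split.
  have fuy : f' u y by move: pf'; rewrite E2 rcons_path last_rcons => /andP[].
  apply: (near_trans (d1 := 1) (d2 := 3) (v := y)); first exact: near1.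
  have eyu : e y u by rewrite se; move: pxy; rewrite E2 rcons_path last_rcons => /andP[].
  by apply: near_sub ff' _; apply: (fr_clean inv yF vF _ _ ou); rewrite //= eyu euv.
(* By [ear_bypass] with an empty detour a chord can only join the first interior vertex to the
   last. *)
have ad_in s1 u s2 v s3 : s = s1 ++ u :: s2 ++ v :: s3 -> e u v ->
    (f' u v || (u \in X')) /\ near f' 5 u v.
  move=> Es euv; case: s2 Es => [|h2 t2] Es.
    have fuv : f' u v.
      by move: pf'; rewrite Es rcons_cat cat_path /= => /and4P[].
    by rewrite fuv; split=> //; apply: near1.
  have := ear_bypass se min_ear min_cyc earS sn nbS Es (lam := [::]).
  rewrite /= euv us => /(_ isT isT isT isT).
  rewrite leqn0 addn_eq0 !size_eq0 => /andP[/eqP E1 /eqP E3]; rewrite {}E1 {}E3 /= in Es.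
  split; first by rewrite TX' ?orbT // Es !inE eqxx !orbT.
  have fxu : f' u x by rewrite sf'; move: pf'; rewrite Es => /andP[].
  have E2 : s = rcons (u :: h2 :: t2) v by rewrite Es -cats1.
  have fvy : f' y v by rewrite sf'; move: pf'; rewrite E2 rcons_path last_rcons => /andP[].
  apply: (near_trans (d1 := 4) (d2 := 1) (v := y)); last exact: near1.
  apply: (near_trans (d1 := 1) (d2 := 3) (v := x)); first exact: near1.
  have evy : e v y by move: pxy; rewrite E2 rcons_path last_rcons => /andP[].
  have exu : e x u by move: pxy; rewrite Es => /andP[].
  apply: near_sub ff' _; apply: (fr_clean inv xF yF (lam := [:: u; v])) => //=.
  - by rewrite exu euv evy.
  - by rewrite inE andbT; apply: contraTneq euv => ->; rewrite ire.
  - by rewrite !(allP als) // E2 ?mem_rcons ?inE ?mem_rcons ?inE eqxx ?orbT.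
have order a b : a \in s -> b \in s -> a != b ->
    (exists s1 s2 s3, s = s1 ++ a :: s2 ++ b :: s3) \/ (exists s1 s2 s3, s = s1 ++ b :: s2 ++ a :: s3).
  move=> as' bs ab; have [s1 [t Es]] := mem_split as'.
  move: bs; rewrite Es mem_cat inE eq_sym (negPf ab) /= => /orP[]/mem_split[t1 [t2 E]].
    by right; exists t1, t2, t; rewrite E -catA.
  by left; exists s1, t1, t2; rewrite E.
exists F', f', X', (XB :|: W); split; last first.
  apply: proper_card; apply/properP; split; first by rewrite setCS.
  by exists (head y s); rewrite !inE ?hs ?orbT // sF.
split=> //.
- move=> u v /orP[/fe//|]; exact: lk_edge.
- rewrite /X' !subUset (subset_trans XF FF') WF andbT /=; apply/subsetP => v.
  rewrite !inE mem_cat => /or4P[/eqP->|/eqP->|/mem_take->|/mem_drop->]; by rewrite ?xF ?yF ?orbT.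
- by rewrite setSU // /X' subsetU // XBX.
- by rewrite subUset XBB.
- move=> v; have [vs|vs] := boolP (v \in s); first by rewrite din.
  have [vF|vF] := boolP (v \in F); last by rewrite (deg_out _ onF') // !inE negb_or vF.
  rewrite dout //; have := fr_deg4 inv v; have [->|_] := eqVneq v x.
    by case: (x == y); move: dx; clear; lia.
  by have [->|_] := eqVneq v y; [move: dy|]; clear; lia.
- move=> v vX'; have [vs|vs] := boolP (v \in s); first by rewrite din.
  have [vF|vF] := boolP (v \in F); last by rewrite (deg_out _ onF') // !inE negb_or vF.
  rewrite dout //.
  have -> : (v == x) = false by apply: contraNF vX' => /eqP->; apply: TX'; rewrite mem_head.
  have -> : (v == y) = false by apply: contraNF vX' => /eqP->; apply: TX'; rewrite !inE eqxx orbT.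
  rewrite !addn0; apply: (fr_deg2 inv); apply: contra vX'; exact: (subsetP XX').
- move=> u v /inF'[uF|us'] /inF'[vF|vs] euv.
  + have [h nr] := fr_adj inv uF vF euv; split; last exact: near_sub ff' nr.
    by case/or3P: h => [/ff'->|/(subsetP XX')->|/(subsetP XX')->]; rewrite ?orbT.
  + have [h nr] := ad_mix v u vs uF (etrans (se _ _) euv).
    by rewrite h !orbT; split=> //; apply: near_sym => //; apply: near_le nr.
  + have [h nr] := ad_mix u v us' vF euv.
    by rewrite h !orbT; split=> //; apply: near_le nr.
  + have uv : u != v by apply: contraTneq euv => ->; rewrite ire.
    case: (order u v us' vs uv) => -[s1 [s2 [s3 Es]]].
      have [h nr] := ad_in _ _ _ _ _ Es euv; split=> //.
      by case/orP: h => ->; rewrite ?orbT.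
    have [h nr] := ad_in _ _ _ _ _ Es (etrans (se _ _) euv); split; last exact: near_sym.
    by rewrite sf'; case/orP: h => ->; rewrite ?orbT.
- move=> a b lam /inF'[aF|as'] /inF'[bF|bs] pl ul al sl.
  + by apply: near_sub ff' _; apply: (fr_clean inv aF bF pl) => //; apply: sub_all al.
  + apply: near_sym => //; apply: (cl_mix b a (rev lam)); rewrite ?rev_uniq ?all_rev ?size_rev //.
    by rewrite -path_revE.
  + exact: cl_mix al sl.
  + have [->|ab] := eqVneq a b; first exact: near_refl.
    case: (order a b as' bs ab) => -[s1 [s2 [s3 Es]]]; first exact: cl_in Es pl ul al sl.
    apply: near_sym => //; apply: (cl_in b (rev lam) _ _ _ _ Es); rewrite ?rev_uniq ?all_rev ?size_rev //.
    by rewrite -path_revE.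
- have dFs : [disjoint F & [set v in s]].
    by rewrite disjoint_sym disjoints_subset; apply/subsetP => v; rewrite !inE => /sF.
  rewrite sum_setU // (eq_bigr _ dout) !big_split /= !sum_eq1 //.
  have -> : #|F'| = #|F| + size s.
    by have := leq_card_setU F [set v in s]; rewrite dFs => -[_ /eqP->]; rewrite cardsE (card_uniqP us).
  have -> : \sum_(v in [set v in s]) deg f' setT v = \sum_(v in [set v in s]) 2.
    by apply: eq_bigr => v; rewrite inE => /din.
  rewrite sum_nat_const cardsE (card_uniqP us).
  by have := fr_sum inv; clear; lia.
- have : bad f' \subset bad f :|: [set x; y].
    apply/subsetP => v; rewrite !inE => h.
    have vF' : v \in F' by apply: contraTT h => vF'; rewrite (deg_out _ onF').
    case: (inF' v vF') => [vF|/din vs]; last by rewrite vs in h.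
    by move: h; rewrite dout //; do 2 case: eqP => //=; rewrite ?orbT // !addn0 orbF.
  move=> /subset_leq_card; have := leq_card_setU (bad f) [set x; y] => -[h1 _] h2.
  by move: (fr_bad inv) h1 h2; rewrite cards2; case: (x != y); clear; lia.
- by move=> Z /(fr_core inv)[Z0 cZ]; split=> //; apply: core_subrel cZ.
- exact: fr_triv inv.
(* Together with [W] an ear costs at most nine vertices, within the eleven that a cycle may cost. *)
- have cT : #|T| <= 8.
    apply: leq_trans (card_set_seq_le _) _; rewrite /= size_cat size_take size_drop.
    by case: (ltnP 3 (size s)); clear; lia.
  have [h1 _] := leq_card_setU (X :|: T) W; have [h2 _] := leq_card_setU X T.
  by move: (fr_X inv) h1 h2 cT cW; rewrite -/X'; clear; lia.
Qed.

End EarStep.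
End State.

(** * The cycle step *)

Section CycleStep.
Variables (V : finType) (e : rel V) (B : {set V}).
Hypotheses (se : symmetric e) (ire : irreflexive e).
Implicit Types (Z : {set V}) (l lam s : seq V).

Lemma bcyc_rot (P : pred V) i l : bcyc e B P l -> bcyc e B P (rot i l).
Proof.
move=> [ul cl sl al hl]; split; rewrite ?rot_uniq ?rot_cycle ?size_rot //.
  by rewrite (eq_all_r (mem_rot i l)).
by rewrite (eq_has_r (mem_rot i l)).
Qed.

Lemma rot_to2 l a b : a \in l -> b \in l -> a != b ->
  exists i s1 s2, rot i l = a :: s1 ++ b :: s2.
Proof.
move=> /rot_to[i l' El] bl ab; exists i.
move: bl; rewrite -(mem_rot i) El inE eq_sym (negPf ab) /= => /mem_split[s1 [s2 ->]].
by exists s1, s2.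
Qed.

Lemma split_first (P : pred V) l : has P l ->
  exists a1 w a2, [/\ l = a1 ++ w :: a2, P w & ~~ has P a1].
Proof.
elim: l => //= v l IH; have [vP _|vP] := boolP (P v).
  by exists [::], v, l.
by move=> /= /IH[a1 [w [a2 [-> wP ha]]]]; exists (v :: a1), w, a2; rewrite /= negb_or vP.
Qed.

Section MinimalCycle.
Variables (P : pred V) (n : nat).
Hypothesis min_cyc : forall c, bcyc e B P c -> n <= size c.

(** One of the two closed arcs contains a root and forms a rooted cycle with [lam], so by minimality
    the other arc is no longer than [lam]. The last two hypotheses keep these cycles from
    degenerating to two vertices. *)
Lemma cyc_bypass p s1 q s2 lam : bcyc e B P (p :: s1 ++ q :: s2) ->
  size (p :: s1 ++ q :: s2) = n -> path e p (rcons lam q) ->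
  uniq (lam ++ p :: s1 ++ q :: s2) -> all P lam ->
  0 < size s1 + size lam -> 0 < size s2 + size lam ->
  size s1 <= size lam \/ size s2 <= size lam.
Proof.
move=> [uc cc _ ac hc] sn pl ul al l1 l2.
move: ac; rewrite /= all_cat /= => /and4P[ap a1 aq a2].
move: cc; rewrite /= rcons_cat /= cat_path /= => /and3P[p1 pq p2].
move: ul; rewrite cat_uniq /= has_cat /= !negb_or mem_cat inE !negb_or.
rewrite cat_uniq /= !negb_or.
move=> /and5P[ul /and4P[np h1 nq h2] /and3P[np1 npq np2] u1 /andP[/andP[nq1 h12] /andP[nq2 u2]]].
have [hB|nB] := boolP (has (mem B) (p :: rcons s1 q)).
  right; suff: n <= size (p :: s1 ++ q :: rev lam).
    by rewrite -sn /= !size_cat /= size_rev; clear; lia.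
  apply: min_cyc; split.
  - rewrite /= mem_cat inE !negb_or np1 npq mem_rev np cat_uniq u1 /= negb_or nq1 mem_rev nq rev_uniq ul.
    by rewrite has_rev has_sym h1.
  - by rewrite /= rcons_cat /= cat_path /= p1 pq -path_revE.
  - by move: l1; rewrite /= size_cat /= size_rev; clear; lia.
  - by rewrite /= all_cat /= all_rev ap a1 aq.
  - by rewrite -cat_rcons -cat_cons has_cat hB.
left; suff: n <= size (p :: lam ++ q :: s2).
  by rewrite -sn /= !size_cat /=; clear; lia.
apply: min_cyc; split.
- by rewrite /= mem_cat inE !negb_or np npq np2 cat_uniq ul /= negb_or nq h2 nq2 u2.
- by rewrite /= rcons_cat /= -cat_rcons cat_path pl last_rcons.
- by move: l2; rewrite /= size_cat /=; clear; lia.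
- by rewrite /= all_cat /= al ap aq.
- move: hc nB; rewrite /= -cats1 !has_cat /= !orbF !negb_or => + /and3P[pB s1B qB].
  by rewrite (negPf pB) (negPf s1B) (negPf qB) /= => ->; rewrite !orbT.
Qed.

End MinimalCycle.

Variables (F X XB : {set V}) (f : rel V) (M : nat) (O : {set {set V}}) (n : nat).
Hypothesis inv : frame e B F f X XB M O.
(** The inequality is not strict: a cycle is added only when no ear of the same size could be added
    instead. *)
Hypothesis min_ear : forall x s y, ear e F X x s y -> size s <= n -> benign B f x s y.
Hypothesis min_cyc : forall c, bcyc e B (off e F X) c -> n <= size c.

(** A closed arc containing a root, prolonged by both paths to [F], is an ear that is not benign, so
    its interior has more than [n] vertices. Comparison with the cycle bounds the other arc. *)
Lemma cyc_ears p s1 q s2 lam1 lam2 z z' : bcyc e B (off e F X) (p :: s1 ++ q :: s2) ->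
  size (p :: s1 ++ q :: s2) = n -> z \in F -> z' \in F ->
  path e p (rcons lam1 z) -> path e q (rcons lam2 z') ->
  uniq (lam1 ++ lam2 ++ p :: s1 ++ q :: s2) -> all (off e F X) lam1 -> all (off e F X) lam2 ->
  size s1 < size lam1 + size lam2 \/ size s2 < size lam1 + size lam2.
Proof.
move=> [uc cc _ ac hc] sn zF z'F pl1 pl2 ul al1 al2.
move: ac; rewrite /= all_cat /= => /and4P[ap a1 aq a2].
move: cc; rewrite /= rcons_cat /= cat_path /= => /and3P[p1 pq p2].
have pl1' : path e z (rcons (rev lam1) p) by rewrite -path_revE.
have [hB|nB] := boolP (has (mem B) (p :: rcons s1 q)).
  right; rewrite ltnNge; apply/negP => lt.
  have /and4P[_ _ + _] : benign B f z (rev lam1 ++ (p :: rcons s1 q) ++ lam2) z'.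
    apply: min_ear; last first.
      by move: lt; rewrite -sn /= !size_cat /= size_rev size_cat size_rcons /=; clear; lia.
    split=> //.
      rewrite !rcons_cat /= -cat_rcons cat_path pl1' last_rcons /= cat_path last_rcons pl2 andbT.
      by rewrite rcons_path p1 pq.
    split; last by rewrite size_cat /= size_cat size_rcons; case: (z == z'); clear; lia.
      have : subseq (lam1 ++ lam2 ++ p :: rcons s1 q) (lam1 ++ lam2 ++ p :: s1 ++ q :: s2).
        by rewrite !cat_subseq // -cat_rcons -cat_cons prefix_subseq.
      move=> /subseq_uniq/(_ ul); rewrite (perm_uniq (s2 := rev lam1 ++ (p :: rcons s1 q) ++ lam2)) //.
      by apply/permP => a; rewrite !count_cat count_rev [count a lam2 + _]addnC.
    by rewrite !all_cat all_rev al1 al2 /= ap all_rcons aq a1.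
  by rewrite !all_cat => /and3P[_ + _]; rewrite all_predC hB.
left; rewrite ltnNge; apply/negP => lt.
have /and4P[_ _ + _] : benign B f z (rev lam1 ++ (p :: rcons (rev s2) q) ++ lam2) z'.
  apply: min_ear; last first.
    by move: lt; rewrite -sn /= !size_cat /= size_rev size_cat size_rcons size_rev /=; clear; lia.
  split=> //.
    rewrite !rcons_cat /= -cat_rcons cat_path pl1' last_rcons /= cat_path last_rcons pl2 andbT.
    by rewrite -path_revE.
  split; last by rewrite size_cat /= size_cat size_rcons size_rev; case: (z == z'); clear; lia.
    have : subseq (lam1 ++ lam2 ++ p :: q :: s2) (lam1 ++ lam2 ++ p :: s1 ++ q :: s2).
      by rewrite !cat_subseq //= eqxx suffix_subseq.
    move=> /subseq_uniq/(_ ul); rewrite (perm_uniq (s2 := rev lam1 ++ (p :: rcons (rev s2) q) ++ lam2)) //.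
    by apply/permP => a; rewrite !count_cat /= -rev_cons !count_rev [count a lam2 + _]addnC.
  by rewrite !all_cat all_rev al1 al2 /= ap all_rcons all_rev aq a2.
rewrite !all_cat => /and3P[_ + _]; rewrite /= all_rcons all_rev => /and3P[_ _ s2B]; move: hc nB s2B.
rewrite /= -cats1 !has_cat /= !orbF !negb_or => + /and3P[pB s1B qB].
by rewrite (negPf pB) (negPf s1B) (negPf qB) /= all_predC => ->.
Qed.

(* [fr_clean] could only fail at such vertices of the cycle, which are confined to a short
   window of it by [contacts_close]. *)
Definition contact l lam p := exists z, [/\ z \in F, path e p (rcons lam z),
  uniq (lam ++ l), all (off e F X) lam & size lam <= 2].

(** Disjoint paths fall under [cyc_ears]. If they intersect, following [lam1] to its first vertex on
    [lam2] and then [lam2] backwards gives a detour of at most three vertices for [cyc_bypass]. *)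
Lemma contacts_close p s1 q s2 lam1 lam2 : bcyc e B (off e F X) (p :: s1 ++ q :: s2) ->
  size (p :: s1 ++ q :: s2) = n ->
  contact (p :: s1 ++ q :: s2) lam1 p -> contact (p :: s1 ++ q :: s2) lam2 q ->
  size s1 <= 3 \/ size s2 <= 3.
Proof.
move=> bc sn [z [zF pl1 ul1 al1 l1]] [z' [z'F pl2 ul2 al2 l2]].
have [/split_first[a1 [w [a2 [E1 wl ha]]]]|dis] := boolP (has (mem lam2) lam1); last first.
  have : uniq (lam1 ++ lam2 ++ p :: s1 ++ q :: s2).
    rewrite cat_uniq ul2; move: ul1; rewrite cat_uniq => /and3P[-> h _].
    by rewrite has_cat negb_or has_sym dis h.
  move=> u; have := cyc_ears bc sn zF z'F pl1 pl2 u al1 al2.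
  by case=> h; [left|right]; move: h l1 l2; clear; lia.
have [b1 [b2 E2]] := mem_split wl.
have := @cyc_bypass _ _ min_cyc p s1 q s2 (a1 ++ w :: rev b1) bc sn.
rewrite rcons_cat /= cat_path /=.
have -> : path e p a1 && (e (last p a1) w && path e w (rcons (rev b1) q)).
  move: pl1 pl2; rewrite E1 E2 !rcons_cat !cat_path /= => /and3P[-> -> _] /and3P[pb1 ew _].
  by rewrite /= -path_revE // rcons_path pb1.
have -> : all (off e F X) (a1 ++ w :: rev b1).
  by move: al1 al2; rewrite E1 E2 !all_cat /= all_rev => /and3P[-> -> _] /and3P[-> _ _].
have -> : uniq ((a1 ++ w :: rev b1) ++ p :: s1 ++ q :: s2).
  set c := p :: _ in ul1 ul2 *.
  have u1 : uniq (a1 ++ c).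
    apply: subseq_uniq ul1; rewrite E1 -catA; apply: cat_subseq => //.
    exact: suffix_subseq.
  have u2 : uniq (b1 ++ [:: w] ++ c).
    apply: subseq_uniq ul2; rewrite E2 -catA; apply: cat_subseq => //.
    by rewrite (@cat_subseq _ [:: w] _ [:: w]) // suffix_subseq.
  have u2' : uniq ((w :: rev b1) ++ c).
    rewrite (perm_uniq (s2 := b1 ++ [:: w] ++ c)) //.
    by apply/permP => a; rewrite !count_cat /= count_cat /= count_rev; clear; lia.
  rewrite -catA cat_uniq u2' andbT; move: u1; rewrite cat_uniq => /and3P[-> ca1 _].
  rewrite has_cat negb_or ca1 andbT andTb.
  apply/hasPn => v; rewrite inE mem_rev => vb; apply/negP => va1.
  have := hasPn ha v va1; rewrite E2 /= mem_cat inE.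
  by case/orP: vb => ->; rewrite ?orbT.
move=> /(_ isT isT isT); rewrite !size_cat /= !addnS => /(_ isT isT).
move: l1 l2; rewrite E1 E2 !size_cat /= size_rev => l1 l2.
by case=> h; [left|right]; move: h l1 l2; clear; lia.
Qed.

Lemma contact_rot i l lam p : contact l lam p -> contact (rot i l) lam p.
Proof.
move=> [z [zF pl ul al sl]]; exists z; split=> //.
rewrite (perm_uniq (s2 := lam ++ l)) //.
by rewrite perm_cat2l perm_rot.
Qed.

Lemma contact_window p0 c' lam0 lam q : bcyc e B (off e F X) (p0 :: c') -> size (p0 :: c') = n ->
  contact (p0 :: c') lam0 p0 -> contact (p0 :: c') lam q -> q \in p0 :: c' ->
  q \in p0 :: take 4 c' ++ drop (size c' - 4) c'.
Proof.
move=> bc sn k0 kq; rewrite !inE; case: eqP => //= _ qc'.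
have [s1 [s2 E]] := mem_split qc'; rewrite {}E in bc sn k0 kq *.
rewrite mem_cat; apply: contraT; rewrite negb_or => /andP[/mem_take_split h1 /mem_drop_split h2].
by case: (contacts_close bc sn k0 kq) => h; [move: h h1|move: h h2]; clear; lia.
Qed.

(** The start is the vertex of the cycle with a neighbour in [F], unique by [cyc_ears] with empty
    paths; failing that any contact, and failing that any vertex. *)
Lemma choose_root c : bcyc e B (off e F X) c -> size c = n ->
  exists p0 c', [/\ bcyc e B (off e F X) (p0 :: c'), size (p0 :: c') = n,
    forall w z, w \in p0 :: c' -> z \in F -> e w z -> w = p0 &
    forall lam q, contact (p0 :: c') lam q -> q \in p0 :: c' ->
      q \in p0 :: take 4 c' ++ drop (size c' - 4) c'].
Proof.
move=> bc sn.
have [[w [z [wc zF ewz]]]|notouch] := EM (exists w z, [/\ w \in c, z \in F & e w z]).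
  have [i c' E] := rot_to wc; have bc' := bcyc_rot i bc; rewrite E in bc'.
  have sn' : size (w :: c') = n by rewrite -E size_rot.
  exists w, c'; split=> //; last first.
    move=> lam q; apply: (contact_window (lam0 := [::])) => //.
    by case: bc' => uc _ _ _ _; exists z; rewrite /= ewz; split.
  move=> w' z' w'c z'F ewz'; apply/eqP; apply: contraT => ww.
  move: w'c; rewrite inE (negPf ww) /= => /mem_split[s1 [s2 E']]; rewrite {}E' in bc' sn'.
  have := @cyc_ears w s1 w' s2 [::] [::] z z' bc' sn' zF z'F.
  by case: bc' => uc _ _ _ _; rewrite /= ewz ewz' => /(_ isT isT uc isT isT)[].
have nt : forall i w z, w \in rot i c -> z \in F -> e w z -> False.
  by move=> i w z; rewrite mem_rot => wc zF ewz; apply: notouch; exists w, z.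
have [[lam0 [p0 [pc k0]]]|nocontact] := EM (exists lam p0, p0 \in c /\ contact c lam p0).
  have [i c' E] := rot_to pc; have bc' := bcyc_rot i bc; rewrite E in bc'.
  have sn' : size (p0 :: c') = n by rewrite -E size_rot.
  exists p0, c'; split=> //; first by rewrite -E => w z wc zF ewz; case: (nt i w z).
  move=> lam q; apply: (contact_window (lam0 := lam0)) => //.
  by rewrite -E; apply: contact_rot.
case: c bc sn nt nocontact {notouch} => [|p0 c'] bc sn nt nocontact; first by case: bc.
exists p0, c'; split=> //.
  by move=> w z wc zF ewz; case: (nt 0 w z); rewrite ?rot0.
by move=> lam q k qc; case: nocontact; exists lam, q.
Qed.

(** An edge joining the cycle to [F], if any, is added first as a pendant edge at [p0]. The rest of
    the cycle is then an ear from [p0] to itself, so the ear lemmas apply to cycles too. [t] records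
    whether the edge exists; without it [x] takes the default value [p0]. *)
Lemma pendant p0 : p0 \notin F -> off e F X p0 ->
  (forall z, z \in F -> e p0 z -> False) \/
  (exists2 x, x \in F & e p0 x) ->
  exists f1 (t : bool) x, [/\ symmetric f1, subrel f1 e, on (p0 |: F) f1, subrel f f1 &
   [/\ forall v, v \in F -> deg f1 setT v = deg f setT v + (t && (v == x)),
    deg f1 setT p0 = t, (if t then [/\ x \in F, e p0 x & f1 p0 x] else x = p0),
    acyc f1 XB & t = false -> forall z, z \in F -> e p0 z -> False]].
Proof.
have sf := fr_sym inv; have fe := fr_edge inv; have Ff := fr_on inv.
have irf : irreflexive f by move=> v; apply/negP => /fe; rewrite ire.
move=> pF op [no|[x xF epx]].
  exists f, false, p0; split=> //.
    by move=> u v /Ff; rewrite !inE => /andP[-> ->]; rewrite !orbT.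
  split=> //; first by move=> v vF; rewrite addn0.
    exact: deg_out Ff pF.
  exact: fr_acyc inv.
have xp : x != p0 by apply: contraNneq pF => <-.
have fp u : f p0 u = false by apply: contraNF pF => /Ff/andP[].
pose f1 := add_links f x [:: p0].
have f1p u : f1 p0 u = (u == x).
  by rewrite /f1 /add_links /= fp eqxx /= orbF eq_sym (negPf xp) /= .
have f1v v u : v \in F -> f1 v u = f v u || (v == x) && (u == p0).
  move=> vF; rewrite /f1 /add_links /= orbF; have -> : (v == p0) = false by apply: contraNF pF => /eqP<-.
  by rewrite orbF.
exists f1, true, x; split.
- exact: add_links_sym.
- move=> u v /orP[/fe//|]; apply: lk_edge => //=; by rewrite se epx.
- move=> u v /(add_links_on sf Ff xF); by rewrite !inE ![_ || (_ == p0)]orbC.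
- by move=> u v fuv; rewrite /f1 /add_links fuv.
split=> //.
- move=> v vF; rewrite /deg.
  have -> : [set u in setT | f1 v u] = [set u in setT | f v u] :|: [set u | (v == x) && (u == p0)].
    by apply/setP => u; rewrite !inE f1v.
  rewrite cardsU disjoint_setI0 ?cards0 ?subn0.
    congr (_ + _); case: (v == x) => /=; last by apply/eqP; rewrite cards_eq0; apply/eqP/setP => u; rewrite !inE.
    by rewrite (_ : [set _ | _] = [set p0]) ?cards1 //; apply/setP => u; rewrite !inE.
  rewrite -setI_eq0; apply/eqP/setP => u; rewrite !inE; apply/negP => /and3P[fvu _ /eqP E].
  by move: pF; rewrite -E; case/andP: (Ff _ _ fvu) => _ ->.
- rewrite /deg (_ : [set _ in _ | _] = [set x]) ?cards1 //.
  by apply/setP => u; rewrite !inE f1p.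
- by rewrite f1p.
move=> Z cZ dZ.
have pZ : p0 \notin Z.
  by apply/negP => /cZ[y1 [y2 [y12 _ _]]]; rewrite !f1p => /eqP E1 /eqP E2; rewrite E1 E2 eqxx in y12.
apply: (fr_acyc inv) dZ => v vZ; have [y1 [y2 [y12 y1Z y2Z f1v1 f1v2]]] := cZ v vZ.
have nb u : u \in Z -> f1 v u -> f v u.
  move=> uZ; rewrite /f1 /add_links /= orbF => /or3P[//||] /andP[/eqP E1 /eqP E2].
    by rewrite -E2 uZ in pZ.
  by rewrite -E1 vZ in pZ.
by exists y1, y2; split=> //; apply: nb.
Qed.

Lemma cycle_step c : bcyc e B (off e F X) c -> size c = n ->
  exists F' f' X' XB' t O', [/\ t <= 1, frame e B F' f' X' XB' (M + t) O' & #|~: F'| < #|~: F|].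
Proof.
move=> bc0 sn0; have [p0 [c' [bc sn touch cont]]] := choose_root bc0 sn0.
have sf := fr_sym inv; have fe := fr_edge inv; have Ff := fr_on inv.
have XF := fr_XF inv; have XBX := fr_XBX inv; have XBB := fr_XBB inv.
have [uc cc sc ac hc] := bc; set c1 := p0 :: c' in bc sn touch cont uc cc sc ac hc.
have pc : p0 \in c1 by apply: mem_head.
have offc v : v \in c1 -> off e F X v by move/(allP ac).
have cF v : v \in c1 -> v \notin F by move/offc/andP=> [].
have [|f1 [t [x [sf1 f1e F1f ff1 [d1 dp xt ac1 nt]]]]] := @pendant p0 (cF _ pc) (offc _ pc).
  have [[z [zF ez]]|no] := EM (exists z, z \in F /\ e p0 z); first by right; exists z.
  by left=> z zF ez; apply: no; exists z.
have irf1 : irreflexive f1 by move=> v; apply/negP => /f1e; rewrite ire.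
have [b bc1 bB0] := hasP hc; have bB : b \in B by [].
pose F1 := p0 |: F; have p1 : p0 \in F1 by apply: setU11.
have uc' : uniq c' by case/andP: uc.
have c'F v : v \in c' -> v \notin F1.
  move=> vc; rewrite !inE negb_or cF ?inE ?vc ?orbT // andbT.
  by apply: contraTneq vc => ->; case/andP: uc.
have sc' : (p0 == p0) < size c' by rewrite eqxx; move: sc.
pose f' := add_links f1 p0 (rcons c' p0); pose F' := F :|: [set v in c1].
(* The window of [choose_root], the new root [b] and the far end [x] of the pendant edge: at most
   eleven vertices, whence the constant in [fr_X]. *)
pose T := [set v in x :: b :: p0 :: take 4 c' ++ drop (size c' - 4) c'].
pose X' := X :|: T.
have xin : x \in F'.
  by move: xt; case: (t) => [[xF _ _]|->]; rewrite !inE ?xF ?eqxx ?orbT.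
have ff' : subrel f f' by move=> u v /ff1 fuv; rewrite /f' /add_links fuv.
have f1f' : subrel f1 f' by move=> u v fuv; rewrite /f' /add_links fuv.
have XX' : X \subset X' by apply: subsetUl.
have FF' : F \subset F' by apply: subsetUl.
have EF' : F' = F1 :|: [set v in c'].
  by apply/setP => v; rewrite !inE; case: (v == p0); rewrite ?orbT.
have cyc' : cycle f' c1.
  by apply: sub_path (path_lk _ _) => u v h; rewrite /f' /add_links h orbT.
have sf' : symmetric f' by apply: add_links_sym.
have onF' : on F' f'.
  move=> u v /(add_links_on sf1 F1f p1)/andP[].
  rewrite !inE !mem_rcons !inE !orbA => h1 h2; apply/andP; split.
    by case/orP: h1 => [/orP[/orP[]|]|] ->; rewrite ?orbT.
  by case/orP: h2 => [/orP[/orP[]|]|] ->; rewrite ?orbT.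
have din v : v \in c' -> deg f' setT v = 2 by exact: (ear_deg_in F1f p1 p1 uc' c'F sc').
have dout v : v \in F1 -> deg f' setT v = deg f1 setT v + (v == p0) + (v == p0).
  by exact: (ear_deg_out F1f uc' c'F sc').
have dF v : v \in F -> deg f' setT v = deg f setT v + (t && (v == x)).
  move=> vF; rewrite dout ?inE ?vF ?orbT // d1 //.
  have -> : (v == p0) = false by apply: contraTF vF => /eqP->; apply: cF.
  by rewrite !addn0.
have dp0 : deg f' setT p0 = t + 2 by rewrite dout // dp eqxx -addnA.
have xX : t -> x \notin X.
  move=> tt; move: xt; rewrite tt => -[_ ex _]; exact: (off_adj se (offc _ pc) ex).
have off' v : off e F' X' v -> off e F X v by apply: off_sub.
have offs v : off e F' X' v -> v \notin c1 by case/andP=> _; rewrite !inE negb_or => /andP[].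
have inF' v : v \in F' -> v \in F \/ v \in c1.
  by rewrite [v \in F']in_setU [v \in [set _ in c1]]inE => /orP[h|h]; [left|right].
have TX' v : v \in x :: b :: p0 :: take 4 c' ++ drop (size c' - 4) c' -> v \in X'.
  by move=> vT; rewrite in_setU [v \in T]inE vT orbT.
have ad_mix u v : u \in c1 -> v \in F -> e u v -> u \in X' /\ near f' 4 u v.
  move=> uc1 vF euv; have E : u = p0 by apply: (touch u v).
  rewrite {}E in euv *; split; first by apply: TX'; rewrite !inE eqxx !orbT.
  have tt : t by case: (t) nt => // /(_ erefl v vF euv).
  move: xt; rewrite tt => -[xF epx fpx].
  apply: (near_trans (d1 := 1) (d2 := 3) (v := x)); first by apply: near1 => //; apply: f1f'.
  apply: near_sub ff' _; apply: (fr_clean inv xF vF (lam := [:: p0])) => //=.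
    by rewrite se epx euv.
  by rewrite offc.
have rot2 a d : a \in c1 -> d \in c1 -> a != d -> exists s1 s2,
    [/\ bcyc e B (off e F X) (a :: s1 ++ d :: s2), size (a :: s1 ++ d :: s2) = n,
        cycle f' (a :: s1 ++ d :: s2) & perm_eq (a :: s1 ++ d :: s2) c1].
  move=> ac1' dc1 ad; have [i [s1 [s2 E]]] := rot_to2 ac1' dc1 ad; exists s1, s2; rewrite -E.
  by rewrite size_rot rot_cycle perm_rot; split=> //; apply: bcyc_rot.
have arcs a s1 d s2 : cycle f' (a :: s1 ++ d :: s2) ->
    near f' (size s1).+1 a d /\ near f' (size s2).+1 a d.
  rewrite /= rcons_cat /= cat_path /= => /and3P[q1 qd q2]; split.
    by exists (rcons s1 d); rewrite rcons_path last_rcons size_rcons q1 qd.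
  by apply: near_sym => //; exists (rcons s2 a); rewrite last_rcons size_rcons.
(* By [cyc_bypass] with an empty detour, a shortest rooted cycle has no chord. *)
have ad_in u v : u \in c1 -> v \in c1 -> e u v -> f' u v.
  move=> uc1 vc1 euv; have uv : u != v by apply: contraTneq euv => ->; rewrite ire.
  have [s1 [s2 [bc2 sn2 cf2 _]]] := rot2 u v uc1 vc1 uv.
  have [E1|n1] := posnP (size s1).
    by move: cf2; rewrite (size0nil E1) => /andP[].
  have [E2|n2] := posnP (size s2).
    by move: cf2; rewrite (size0nil E2) sf' /= cats1 !rcons_path last_rcons => /andP[].
  have := @cyc_bypass _ _ min_cyc u s1 v s2 [::] bc2 sn2; case: bc2 => u2 _ _ _ _.
  rewrite /= euv !addn0 => /(_ isT u2 isT n1 n2).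
  by move: n1 n2; clear; lia.
have p0b : [/\ t + 2 <= 4, t + 2 <= 3 & t <= 1] by case: (t).
have tv v : t && (v == x) -> deg f setT v <= 2.
  by case/andP=> tt /eqP->; apply: (fr_deg2 inv); apply: xX.
have dFc : [disjoint F & [set v in c1]].
  by rewrite disjoint_sym disjoints_subset; apply/subsetP => v; rewrite [v \in [set _ in c1]]inE [v \in ~: F]inE => /cF.
have c10 : [set v in c1] != set0 by apply/set0Pn; exists p0; rewrite inE.
have OF Z : Z \in O -> Z \subset F.
  by move=> /(fr_core inv)[_ cZ]; apply: core_on cZ.
have cO : [set v in c1] \notin O.
  apply/negP => /OF sub; case/negP: (cF _ pc); apply: (subsetP sub); by rewrite inE.
exists F', f', X', (b |: XB), t, ([set v in c1] |: O); split; first by case: p0b.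
  split=> //.
- move=> u v /orP[/f1e//|]; apply: lk_edge => //; exact: cc.
- rewrite /X' subUset (subset_trans XF FF') /=; apply/subsetP => v.
  rewrite [v \in T]inE [v \in x :: _]inE [v \in b :: _]inE => /or3P[/eqP->//|/eqP->|].
    by rewrite in_setU [_ \in [set _ in _]]inE bc1 orbT.
  rewrite inE mem_cat => h; rewrite in_setU [v \in [set _ in _]]inE inE.
  by case/or3P: h => [->|/mem_take->|/mem_drop->]; rewrite ?orbT.
- rewrite subUset sub1set TX' ?inE ?eqxx ?orbT //=; exact: subset_trans XBX XX'.
- by rewrite subUset sub1set bB.
- move=> v; have [vF'|vF'] := boolP (v \in F'); last by rewrite (deg_out _ onF').
  case: (inF' v vF') => [vF|]; last first.
    by rewrite inE => /orP[/eqP->|/din->//]; rewrite dp0; case: p0b.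
  rewrite dF //; have := fr_deg4 inv v; case: (boolP (t && _)) => [/tv|_]; clear; lia.
- move=> v vX'; have [vF'|vF'] := boolP (v \in F'); last by rewrite (deg_out _ onF').
  case: (inF' v vF') => [vF|].
    rewrite dF //; have -> : (v == x) = false.
      by apply: contraNF vX' => /eqP->; apply: TX'; rewrite mem_head.
    rewrite andbF addn0; apply: (fr_deg2 inv); apply: contra vX'; exact: (subsetP XX').
  rewrite inE => /orP[/eqP E|/din->//]; case/negP: vX'; rewrite E; apply: TX'.
  by rewrite !inE eqxx !orbT.
- move=> u v /inF'[uF|uc1] /inF'[vF|vc1] euv.
  + have [h nr] := fr_adj inv uF vF euv; split; last exact: near_sub ff' nr.
    by case/or3P: h => [/ff'->|/(subsetP XX')->|/(subsetP XX')->]; rewrite ?orbT.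
  + have [h nr] := ad_mix v u vc1 uF (etrans (se _ _) euv).
    by rewrite h !orbT; split=> //; apply: near_sym => //; apply: near_le nr.
  + have [h nr] := ad_mix u v uc1 vF euv.
    by rewrite h !orbT; split=> //; apply: near_le nr.
  + by have h := ad_in u v uc1 vc1 euv; rewrite h; split=> //; apply: near1.
- move=> Z cZ dZ.
  have bZ : b \notin Z by apply/negP => /(disjointFr dZ); rewrite setU11.
  have Zc' z : z \in Z -> z \notin c'.
    move=> zZ; apply: contra bZ => zc'.
    apply: (ear_core_all F1f p1 p1 uc' c'F cZ zZ zc').
    by move: bc1; rewrite !inE mem_rcons inE => /orP[->|->]; rewrite ?orbT.
  apply: ac1 (disjointWr (subsetUr _ _) dZ).
  apply: (ear_core_out uc' c'F sc' cZ Zc').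
  apply/subsetP => z zZ; have := subsetP (core_on onF' cZ) z zZ; rewrite EF' in_setU.
  by rewrite [z \in [set _ in _]]inE (negPf (Zc' z zZ)) orbF.
(* The start [a] of such a path would be a contact, hence in the window and in [X']; but it is
   adjacent to a vertex that is [off] for [X']. *)
- have mix a z lam : a \in c1 -> z \in F -> path e a (rcons lam z) -> uniq lam ->
      all (off e F' X') lam -> 0 < size lam <= 2 -> False.
    move=> ac1' zF pl ul al /andP[l0 l2].
    have aX' : a \notin X'.
      apply: (@off_adj _ e se F' X' (head z lam)).
        by case: (lam) l0 al => //= w s _ /andP[].
      by case: (lam) l0 pl => //= w s _ /andP[]; rewrite se.
    case/negP: aX'; apply: TX'; rewrite inE; apply/orP; right; rewrite inE; apply/orP; right.
    apply: (cont lam) => //; exists z; split=> //; last exact: (sub_all off' al).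
    rewrite cat_uniq ul uc andbT andTb; apply/hasPn => v vc; apply/negP => /(allP al)/offs.
    by rewrite vc.
  move=> a d lam /inF'[aF|ac1'] /inF'[dF'|dc1] pl ul al sl.
  + apply: near_sub ff' _; apply: (fr_clean inv aF dF' pl) => //; exact: (sub_all off' al).
  + case: (mix d a (rev lam)); rewrite ?rev_uniq ?all_rev ?size_rev //.
    by rewrite -path_revE.
  + by case: (mix a d lam).
  + have [->|ad] := eqVneq a d; first exact: near_refl.
    have [s1 [s2 [bc2 sn2 cf2 pe2]]] := rot2 a d ac1' dc1 ad.
    have [n1 n2] := arcs _ _ _ _ cf2.
    have ul2 : uniq (lam ++ a :: s1 ++ d :: s2).
      rewrite (perm_uniq (s2 := lam ++ c1)) ?perm_cat2l //.
      rewrite cat_uniq ul uc andbT andTb; apply/hasPn => v vc; apply/negP => /(allP al)/offs.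
      by rewrite vc.
    have [l0 l2] := andP sl.
    have := cyc_bypass min_cyc bc2 sn2 pl ul2 (sub_all off' al); rewrite !addn_gt0 l0 !orbT => /(_ isT isT).
    case=> h; [apply: near_le n1|apply: near_le n2]; exact: leq_trans h l2.
- rewrite sum_setU // (eq_bigr _ dF) big_split /=.
  have -> : #|F'| = #|F| + (size c').+1.
    by have := leq_card_setU F [set v in c1]; rewrite dFc => -[_ /eqP->]; rewrite cardsE (card_uniqP uc).
  have -> : \sum_(v in [set v in c1]) deg f' setT v = t + 2 + 2 * size c'.
    have -> : [set v in c1] = p0 |: [set v in c'] by apply/setP => v; rewrite !inE.
    rewrite big_setU1 /=; last by rewrite inE; case/andP: uc.
    rewrite dp0 -(card_uniqP uc') -cardsE [2 * _]mulnC -sum_nat_const; congr addn.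
    by apply: eq_bigr => v; rewrite inE => /din.
  have -> : \sum_(v in F) (t && (v == x)) = t.
    move: xt; case: (t) => [[xF _ _]|_] /=; first exact: sum_eq1.
    by rewrite big1.
  by have := fr_sum inv; clear; lia.
- have : bad f' \subset bad f :|: (if t then [set x; p0] else set0).
    apply/subsetP => v; rewrite [v \in bad f']inE => h.
    have vF' : v \in F' by apply: contraTT h => vF'; rewrite (deg_out _ onF').
    rewrite in_setU [v \in bad f]inE.
    case: (inF' v vF') => [vF|].
      move: h; rewrite dF //; case: (t) => /=; last by rewrite addn0 => ->.
      by case: eqP => [->|_]; rewrite ?inE ?eqxx ?orbT // addn0 => ->.
    rewrite inE => /orP[/eqP E|/din vs]; last by rewrite vs in h.
    by move: h; rewrite E dp0; case: (t) => //= _; rewrite !inE eqxx !orbT.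
  move=> /subset_leq_card; have := leq_card_setU (bad f) (if t then [set x; p0] else set0) => -[h1 _] h2.
  by move: (fr_bad inv) h1 h2; case: (t); rewrite ?cards2 ?cards0; [case: (x != p0)|]; clear; lia.
- move=> Z /setU1P[->|/(fr_core inv)[Z0 cZ]]; last by split=> //; apply: core_subrel cZ.
  by split=> //; apply: cycle_core.
- move=> Z Z' /setU1P[->|ZO] /setU1P[->|Z'O]; rewrite ?eqxx // => ZZ.
  + by rewrite disjoint_sym; apply: disjointWl (OF _ Z'O) dFc.
  + exact: disjointWl (OF _ ZO) dFc.
  + exact: (fr_triv inv).
- have cT : #|T| <= 11.
    apply: leq_trans (card_set_seq_le _) _; rewrite /= size_cat size_take size_drop.
    by case: (ltnP 4 (size c')) => h /=; move: h; clear; move: (size c') => q; lia.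
  have [h1 _] := leq_card_setU X T; rewrite ?cardsU1 ?cO.
  by move: (fr_X inv) h1 cT; rewrite -/X'; clear; lia.
apply: proper_card; apply/properP; split; first by rewrite setCS.
by exists p0; rewrite in_setC ?in_setU ?[p0 \in [set _ in _]]inE ?pc ?orbT // cF.
Qed.

End CycleStep.

(** * Termination *)

Section Packing.
Variables (V : finType) (e : rel V) (B : {set V}).
Hypotheses (se : symmetric e) (ire : irreflexive e).
Implicit Types (Z : {set V}) (l lam s : seq V).

Section Termination.
Variables (F X XB : {set V}) (f : rel V) (M : nat) (O : {set {set V}}).
Hypothesis inv : frame e B F f X XB M O.

Section NoObject.
Hypothesis no_ear : forall x s y, ear e F X x s y -> benign B f x s y.
Hypothesis no_cyc : forall c, ~ bcyc e B (off e F X) c.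

Let live v := v \notin cnb e X.

Lemma live_notin v : live v -> v \notin X.
Proof. by apply: contra => vX; rewrite inE vX. Qed.

Lemma live_edge u v : live u -> live v -> u \in F -> v \in F -> e u v -> f u v.
Proof.
move=> /live_notin uX /live_notin vX uF vF euv.
by case: (fr_adj inv uF vF euv); rewrite (negPf uX) (negPf vX) !orbF.
Qed.

(** An edge of the walk inside [F] is an edge of [f]. An excursion outside [F] is an ear, hence
    benign, so its ends are joined in [f] off [B], and therefore off [XB] and [b]. *)
Lemma walk_connect b u l : b \in B -> u \in F -> path e u l -> uniq (u :: l) ->
  all live (u :: l) -> last u l \in F -> b \notin u :: l ->
  connect (rst f (~: XB :\ b)) u (last u l).
Proof.
move=> bB; move En: (size l) => n; elim/ltn_ind: n u l En => n IH u [|v l] /= En uF.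
  by rewrite connect0.
move=> /andP[euv pl] uq al lF bn.
have XBX := fr_XBX inv; have XBB := fr_XBB inv.
have inA w : live w -> w != b -> w \in ~: XB :\ b.
  by move=> /live_notin wX wb; rewrite !inE wb; apply: contra wX; apply: (subsetP XBX).
have sub : ~: B \subset ~: XB :\ b.
  apply/subsetP => w; rewrite !inE => wB; rewrite (contraNneq _ wB) => [|->] //=.
  by apply: contra wB; apply: (subsetP XBB).
have [ub vb] : u != b /\ v != b.
  by move: bn; rewrite !inE !negb_or ![b == _]eq_sym => /and3P[].
have [vF|vF] := boolP (v \in F).
  apply: (@connect_trans _ _ v).
    apply: connect1; case/and3P: al => lu lv _ /=.
    by rewrite (live_edge lu lv) // !inA.
  apply: (IH (size l)) => //; first by rewrite -En.
  - by case/andP: uq.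
  - by case/andP: al.
  - by move: bn; rewrite inE negb_or => /andP[].
have [|s [z [l2 [El zF hs]]]] := @split_first V (mem F) (v :: l).
  by apply/hasP; exists (last v l) => //; apply: mem_last.
case: s El hs => [|v' s] /= [Ev El] hs; first by rewrite Ev in vF; case/negP: vF.
subst v' l; move: pl; rewrite cat_path /= => /and3P[ps ez pl2].
have [uu /and3P[us _ uz]] : u \notin (v :: s) ++ z :: l2 /\
    [&& uniq (v :: s), ~~ has (mem (v :: s)) (z :: l2) & uniq (z :: l2)].
  by case/andP: uq => u1 u2; split; rewrite -?cat_uniq.
have [ls lz] : all live (v :: s) /\ all live (z :: l2).
  by apply/andP; rewrite -all_cat; case/andP: al.
have uz' : (u == z) = false.
  by apply: contraNF uu => /eqP->; rewrite mem_cat mem_head orbT.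
have El : connect (rst f (~: B)) u z.
  have : ear e F X u (v :: s) z.
    split=> //; first by rewrite /= euv rcons_path ps.
    split; rewrite ?uz' //.
    apply/allP => w ws; apply/andP; split; first exact: (allP ls).
    by move: ws; rewrite inE => /orP[/eqP->//|]; apply: (hasPn (norP hs).2).
  by move=> /no_ear/and4P[].
apply: connect_trans (rst_sub sub El) _; rewrite last_cat /=.
apply: (IH (size l2)) => //.
- by rewrite -En size_cat /=; clear; lia.
- by move: lF; rewrite last_cat.
- by apply: contra bn => bz; rewrite in_cons -cat_cons mem_cat bz !orbT.
Qed.

(** Otherwise the cycle leaves [b] along an ear with an end in [B], which cannot be benign. *)
Lemma cycle_head_in b c' : b \in F -> b \in B -> uniq (b :: c') -> cycle e (b :: c') ->
  1 < size c' -> all live (b :: c') -> exists y t, c' = y :: t /\ y \in F.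
Proof.
move=> bF bB; rewrite cons_uniq => /andP[bc' uc'] cc sc /andP[_ ac].
have [hF|nF] := boolP (has (mem F) c'); last first.
  have : ear e F X b c' b.
    split=> //; split; rewrite ?eqxx //; apply/allP => v vc; apply/andP; split; first exact: (allP ac).
    exact: (hasPn nF).
  by move=> /no_ear/and4P[]; rewrite bB.
have [[|v s] [z [l2 [E zF hs]]]] := split_first hF; first by exists z, l2.
have : ear e F X b (v :: s) z.
  split=> //.
    by move: cc; rewrite E /= rcons_cat -cat_rcons cat_path => /and3P[-> ->].
  split.
  - by move: uc'; rewrite E cat_uniq => /andP[].
  - apply/allP => w ws; apply/andP; split; last exact: (hasPn hs).
    by apply: (allP ac); rewrite E mem_cat ws.
  - by have -> : (b == z) = false by apply: contraNF bc' => /eqP->; rewrite E mem_cat mem_head orbT.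
by move=> /no_ear/and4P[]; rewrite bB.
Qed.

(** A root [b] outside [F] would be interior to an ear that is not benign, or the cycle would avoid
    [F] altogether. If [b] is in [F], so are both its neighbours on the cycle, and [walk_connect]
    joins them in [f] without [b] and [XB]; closing up through [b] gives a cycle of [f] that avoids
    [XB]. *)
Lemma no_object c : ~ bcyc e B live c.
Proof.
move=> bc; have [_ _ _ _ /hasP[b bc1 bB0]] := bc; have bB : b \in B by [].
have [i c' E] := rot_to bc1.
have := bcyc_rot i bc; rewrite {}E => -[uc cc sc ac _].
have vl v : v \in b :: c' -> live v by move=> h; apply: (allP ac v h).
have [bc' uc'] : b \notin c' /\ uniq c' by case/andP: uc.
have [bF|bF] := boolP (b \in F); last first.
  have [hF|nF] := boolP (has (mem F) c'); last first.
    apply: (no_cyc (c := b :: c')); split=> //; last by rewrite /= bB.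
    apply/allP => v vc; apply/andP; split; first exact: vl.
    by move: vc; rewrite inE => /orP[/eqP->//|/(hasPn nF)].
  have [l1 [z1 [m1 [E1 z1F h1]]]] := split_first hF.
  have [l2 [z2 [m2 [E2 z2F h2]]]] : exists l2 z2 m2,
      [/\ rev (z1 :: m1) = l2 ++ z2 :: m2, mem F z2 & ~~ has (mem F) l2].
    by apply: split_first; rewrite has_rev; apply/hasP; exists z1; rewrite ?mem_head.
  have {}E2 : z1 :: m1 = rev m2 ++ z2 :: rev l2.
    by rewrite -[LHS]revK E2 rev_cat rev_cons cat_rcons.
  have Ec : c' = l1 ++ rev m2 ++ z2 :: rev l2 by rewrite E1 E2.
  have : ear e F X z2 (rev l2 ++ b :: l1) z1.
    have pc1 : path e b (rcons l1 z1).
      by move: cc; rewrite E1 /= rcons_cat -cat_rcons cat_path => /andP[].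
    have pc2 : path e z2 (rcons (rev l2) b).
      by move: cc; rewrite Ec catA /= rcons_cat cat_path => /andP[_ /andP[]].
    split=> //; first by rewrite rcons_cat /= -cat_rcons cat_path pc2 last_rcons.
    split.
    - have : uniq (l1 ++ rev l2 ++ [:: b]).
        have : subseq (l1 ++ rev l2) c'.
          rewrite Ec; apply: cat_subseq => //.
          exact: (subseq_trans (subseq_cons _ z2) (suffix_subseq _ _)).
        rewrite catA cats1 rcons_uniq => sub; rewrite (subseq_uniq sub uc') andbT.
        by apply: contra bc'; apply: (mem_subseq sub).
      rewrite (perm_uniq (s2 := rev l2 ++ b :: l1)) //.
      by apply/permP => a; rewrite !count_cat /=; clear; lia.
    - rewrite all_cat all_rev /=.
      apply/and3P; split; last (apply/allP => v vl1; apply/andP; split; last exact: (hasPn h1)).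
      + apply/allP => v vl2; apply/andP; split; last exact: (hasPn h2).
        by apply: vl; rewrite inE Ec !mem_cat inE !mem_rev vl2 !orbT.
      + by apply/andP; split=> //; apply: vl; apply: mem_head.
      + by apply: vl; rewrite inE E1 mem_cat vl1 orbT.
    - case: eqP => [z12|_] /=; last by rewrite size_cat addnS.
      rewrite size_cat size_rev /= addnS ltnS addn_gt0.
      case: l1 l2 E1 E2 {Ec h1 h2 pc1 pc2} => [|? ?] [|? ?] //= E1 E2.
      move: sc; rewrite E1 E2 /=; case: (lastP m2) E2 => [|m3 w] //= E2 _.
      move: uc'; rewrite E1 E2 rev_rcons /= mem_cat; move: E2; rewrite rev_rcons => -[<- _].
      by rewrite z12 mem_head orbT.
  by move=> /no_ear/and4P[_ _ +]; rewrite all_cat /= bB /= andbF.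
have [y1 [t [Et y1F]]] := cycle_head_in bF bB uc cc sc ac.
have [||||y2 [t2 [Et2 y2F]]] := @cycle_head_in b (rev c') bF bB.
- by rewrite /= mem_rev rev_uniq.
- by move: cc; rewrite /= -path_revE.
- by rewrite size_rev.
- by move: ac; rewrite /= all_rev.
have Ec' : c' = rcons (rev t2) y2 by rewrite -rev_cons -Et2 revK.
have ly2 : last y1 t = y2 by rewrite -[last y1 t]/(last b (y1 :: t)) -Et Ec' last_rcons.
have sf := fr_sym inv; have fe := fr_edge inv.
have irf : irreflexive f by move=> v; apply/negP => /fe; rewrite ire.
have lb := vl b (mem_head _ _).
have ly1 : live y1 by apply: vl; rewrite Et inE mem_head orbT.
have ly2' : live y2 by apply: vl; rewrite Ec' inE mem_rcons mem_head orbT.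
have eb1 : e b y1 by move: cc; rewrite Et => /andP[].
have eb2 : e b y2 by rewrite se; move: cc; rewrite Ec' /= rcons_path last_rcons => /andP[].
have XBX := fr_XBX inv.
have inA w : live w -> w \in ~: XB.
  by move=> /live_notin wX; rewrite inE; apply: contra wX; apply: (subsetP XBX).
have y12 : y1 != y2.
  rewrite -ly2; apply/eqP => E; move: uc' sc; rewrite Et /=.
  by case: t E {Et ly2} => //= w t ->; rewrite mem_last.
have [|c3 [uc3 cc3 sc3 sub3]] := @rst_cycle_core _ f (~: XB) b y1 y2 sf irf (inA _ lb) y12
    (inA _ ly1) (inA _ ly2') (live_edge lb ly1 bF y1F eb1) (live_edge lb ly2' bF y2F eb2).
  rewrite -ly2; apply: walk_connect => //.
  - by move: cc; rewrite Et /= rcons_path => /and3P[].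
  - by rewrite -Et.
  - by rewrite -Et; case/andP: ac.
  - by rewrite ly2.
  - by rewrite -Et.
have : [set z in b :: c3] = set0.
  apply: (fr_acyc inv); first exact: cycle_core.
  by rewrite disjoints_subset; apply/subsetP => u; rewrite inE => /sub3.
by move/setP/(_ b); rewrite !inE eqxx.
Qed.

End NoObject.
End Termination.
End Packing.

(** * A coarse Erdos-Posa property for rooted cycles *)

Section Packing.
Variables (V : finType) (e : rel V) (B : {set V}) (k : nat).
Hypotheses (se : symmetric e) (ire : irreflexive e).
Implicit Types (Z : {set V}) (l lam s : seq V).

Definition cycle_packing (P : {set {set V}}) :=
  (forall Z, Z \in P -> exists c, bcyc e B (mem Z) c) /\
  (forall Z Z' u v, Z \in P -> Z' \in P -> Z != Z' -> u \in Z -> v \in Z' -> u != v /\ ~~ e u v).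

Hypothesis small_packing : forall P, cycle_packing P -> #|P| <= k.

Section Frame.
Variables (F X XB : {set V}) (f : rel V) (M : nat) (O : {set {set V}}).
Hypothesis inv : frame e B F f X XB M O.

Let irf : irreflexive f.
Proof. by move=> v; apply/negP => /(fr_edge inv); rewrite ire. Qed.

Lemma core_bcyc Z : Z != set0 -> core f Z -> exists c, bcyc e B (mem Z) c.
Proof.
move=> Z0 cZ; have [c [uc cc sc sub]] := core_cycle (fr_sym inv) irf Z0 cZ.
exists c; split=> //; first exact: (sub_cycle (fr_edge inv)).
  exact/allP.
apply: contraT => /hasPn nB.
have c0 : [set z in c] = set0.
  apply: (fr_acyc inv); first exact: cycle_core (fr_sym inv) uc cc sc.
  rewrite disjoints_subset; apply/subsetP => z; rewrite !inE => /nB.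
  by apply: contra; apply: (subsetP (fr_XBB inv)).
by case: c sc c0 {uc cc sub nB} => [//|z c _ /setP/(_ z)]; rewrite !inE eqxx.
Qed.

Lemma far_anticomplete Z Z' u v : core f Z -> core f Z' -> u \in Z -> v \in Z' ->
  ~ near f 5 u v -> u != v /\ ~~ e u v.
Proof.
move=> cZ cZ' uZ vZ' far; have uF := subsetP (core_on (fr_on inv) cZ) u uZ.
have vF := subsetP (core_on (fr_on inv) cZ') v vZ'.
split; first by apply/eqP => E; apply: far; rewrite E; apply: near_refl.
by apply/negP => /(fr_adj inv uF vF)[].
Qed.

(* With [m = 4 * r] there are at most [r / 2] heavy parts, so the parts account for less
   than half of the excess [2 * r ^ 2]. *)
Lemma not_saturated r : 0 < r -> M = r * r -> 68 * (6 * (5 ^ 5 * 2) * k.+1) <= r -> False.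
Proof.
move=> r0 EM rk.
have [|h hm|P [cP P1 P2]] := @far_cores V f (fr_sym inv) irf (fr_deg4 inv) (4 * r) 5 k F; first by lia.
  have := fr_sum inv; rewrite EM.
  have -> : \sum_(v in F) deg f setT v = pairs f F.
    apply: eq_bigr => v _; apply: eq_card => u; rewrite !inE.
    by case fvu: (f v u); rewrite ?andbF // andbT; case/andP: (fr_on inv fvu) => _ ->.
  have := leq_trans hm (fr_bad inv); rewrite EM.
  move: rk r0; clear; set D := 6 * (5 ^ 5 * 2); rewrite [6 * _](_ : _ = D * (16 * r + 1)); last first.
    by rewrite /D; move: (5 ^ 5) => q; lia.
  have : 0 < D by [].
  move: D (pairs f F) => D p D0 rk r0 hr sp.
  have h2 : 2 * h <= r by nia.
  have h4 : 4 * (h * h.+1) <= r * r + 2 * r by nia.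
  (* As [68 = 4 * 17], the cost of deleting cores is at most a quarter of [r * r]. *)
  have : k * (D * (16 * r + 1)) <= (D * k.+1) * (17 * r) by nia.
  nia.
suff : #|P| <= k by rewrite cP ltnn.
apply: small_packing; split; first by move=> Z /P1[Z0 _ cZ]; apply: core_bcyc.
move=> Z Z' u v ZP Z'P ZZ uZ vZ'; have [_ _ cZ] := P1 Z ZP; have [_ _ cZ'] := P1 Z' Z'P.
by apply: (far_anticomplete cZ cZ' uZ vZ' (P2 Z Z' u v ZP Z'P ZZ uZ vZ')).
Qed.

(** The objects meeting [bad f] are disjoint, so [#|bad f|] bounds their number. In the others every
    vertex has degree two, so they are closed under [f]-neighbours; they lie at infinite distance
    from all other objects and form a packing. *)
Lemma card_objects : #|O| <= 2 * M + k.
Proof.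
pose O1 := [set Z in O | Z :&: bad f != set0].
have -> : #|O| = #|O1| + #|O :\: O1| by rewrite -(cardsID O1 O) (setIidPr _) //; apply/subsetP => Z; rewrite inE => /andP[].
apply: leq_add.
  apply: leq_trans (fr_bad inv).
  pose g Z := [pick v in Z :&: bad f].
  have gP Z : Z \in O1 -> exists v, [/\ g Z = Some v, v \in Z & v \in bad f].
    rewrite inE => /andP[_ /set0Pn[v vZ]]; rewrite /g; case: pickP => [w /setIP[wZ wb]|/(_ v)].
      by exists w.
    by rewrite vZ.
  have gi : {in O1 &, injective g}.
    move=> Z Z' ZO Z'O; have [v [-> vZ _]] := gP Z ZO; have [w [-> wZ _]] := gP Z' Z'O.
    case=> E; apply/eqP/negPn/negP => ZZ; move: ZO Z'O; rewrite !inE => /andP[ZO _] /andP[Z'O _].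
    by have := fr_triv inv ZO Z'O ZZ => /disjointFr/(_ vZ); rewrite E wZ.
  have si : injective (@Some V) by move=> a b [].
  rewrite -(card_in_imset gi) -(card_imset (mem (bad f)) si).
  apply/subset_leq_card/subsetP => o /imsetP[Z /gP[v [-> _ vb]] ->].
  by apply/imsetP; exists v.
apply: small_packing; split.
  by move=> Z /setDP[/(fr_core inv)[Z0 cZ] _]; apply: core_bcyc.
move=> Z Z' u v /setDP[ZO nZ] /setDP[Z'O _] ZZ uZ vZ'.
have [_ cZ] := fr_core inv ZO; have [_ cZ'] := fr_core inv Z'O.
apply: (far_anticomplete cZ cZ' uZ vZ') => -[p [pp lp _]].
have closed w w' : w \in Z -> f w w' -> w' \in Z.
  move=> wZ fww; apply: contraT => w'Z.
  case/negP: nZ; rewrite inE ZO; apply/set0Pn; exists w; rewrite !inE wZ.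
  have [y1 [y2 [y12 y1Z y2Z f1 f2]]] := cZ w wZ.
  apply/card_gt2P; exists y1, y2, w'; split; rewrite ?inE //.
  by split=> //; apply: contraNneq w'Z; [move=> <-|move=> ->].
have : last u p \in Z.
  by elim: p u uZ pp {lp} => //= w p IH u uZ /andP[fuw pp]; apply: IH pp; apply: closed fuw.
by rewrite lp; move: (fr_triv inv ZO Z'O ZZ) => /disjointFl/(_ vZ') ->.
Qed.

End Frame.

Lemma frame0 : frame e B set0 (fun _ _ => false) set0 set0 0 set0.
Proof.
have d0 v : deg (fun _ _ : V => false) [set: V] v = 0.
  by apply/eqP; rewrite cards_eq0; apply/eqP/setP => u; rewrite !inE.
split=> //; rewrite ?sub0set ?cards0 //.
- by move=> v; rewrite d0.
- by move=> v; rewrite d0.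
- by move=> u v; rewrite inE.
- move=> Z cZ _; apply/eqP; rewrite -subset0; apply/subsetP => z /cZ.
  by case=> y1 [y2 []].
- by move=> x y lam; rewrite inE.
- by rewrite (_ : bad _ = set0) ?cards0 //; apply/setP => v; rewrite !inE d0.
- by move=> Z; rewrite inE.
- by move=> Z Z'; rewrite inE.
Qed.

(** Each step enlarges [F], and [M] grows by at most one at a time, so the run cannot jump over
    [M0]. *)
Lemma frame_run M0 F f X XB M O : frame e B F f X XB M O -> M <= M0 ->
  exists F' f' X' XB' M' O', [/\ frame e B F' f' X' XB' M' O', M' <= M0 &
    M' = M0 \/ forall c, ~ bcyc e B (fun v => v \notin cnb e X') c].
Proof.
move En: #|~: F| => n; elim/ltn_ind: n F f X XB M O En => n IH F f X XB M O En inv MM0.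
have [E|ltM] : M = M0 \/ M < M0 by case: (ltngtP M M0) MM0; auto.
  by exists F, f, X, XB, M, O; split=> //; left.
pose Q m := (exists x s y, [/\ ear e F X x s y, ~~ benign B f x s y & size s = m]) \/
  (exists2 c, bcyc e B (off e F X) c & size c = m).
have [exQ|noQ] := EM (exists m, Q m); last first.
  exists F, f, X, XB, M, O; split=> //; right; apply: (no_object se ire inv).
    by move=> x s y h; apply: contraT => nb; case: noQ; exists (size s); left; exists x, s, y.
  by move=> c bc; apply: noQ; exists (size c); right; exists c.
have exQ' : exists m, `[< Q m >] by case: exQ => m Qm; exists m; apply/asboolP.
case: (ex_minnP exQ') => m /asboolP Qm minm.
have min_ear x s y : ear e F X x s y -> size s < m -> benign B f x s y.
  move=> h lt; apply: contraT => nb; move: lt; rewrite ltnNge minm //; apply/asboolP; left.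
  by exists x, s, y.
have min_cyc c : bcyc e B (off e F X) c -> m <= size c.
  by move=> bc; apply: minm; apply/asboolP; right; exists c.
have [[x [s [y [h nb sm]]]]|noear] := EM (exists x s y, [/\ ear e F X x s y, ~~ benign B f x s y & size s = m]).
  have [F' [f' [X' [XB' [inv' cF']]]]] := ear_step se ire inv min_ear min_cyc h sm nb.
  by apply: (IH _ _ _ _ _ _ _ _ erefl inv'); rewrite -?En.
case: Qm => // -[c bc sc].
have min_ear' x s y : ear e F X x s y -> size s <= m -> benign B f x s y.
  rewrite leq_eqVlt => h /orP[/eqP E|]; last exact: min_ear.
  by apply: contraT => nb; case: noear; exists x, s, y.
have [F' [f' [X' [XB' [t [O' [t1 inv' cF']]]]]]] := cycle_step se ire inv min_ear' min_cyc bc sc.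
apply: (IH _ _ _ _ _ _ _ _ erefl inv'); rewrite -?En //.
by move: t1 ltM; clear; lia.
Qed.

Lemma rooted_erdos_posa : exists X : {set V},
  #|X| <= 33 * (68 * (6 * (5 ^ 5 * 2) * k.+1)) ^ 2 + 11 * k /\
  forall c, ~ bcyc e B (fun v => v \notin cnb e X) c.
Proof.
set r := 68 * _.
have r0 : 0 < r by rewrite /r !muln_gt0.
have [F [f [X [XB [M [O [inv MM0 alt]]]]]]] := frame_run frame0 (leq0n (r * r)).
case: alt => [E|noc]; first by case: (not_saturated inv r0 E).
(* [fr_X] and [card_objects] bound the size by [11 * (3 * M + k)], and [M] is at most [r * r]. *)
exists X; split=> //.
have := fr_X inv; have := card_objects inv; rewrite -mulnn.
by move: MM0; clearbody r; clear; move: (r * r) => q; lia.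
Qed.

End Packing.

(** * Majority components *)

Section BigComponents.
Variables (V : finType) (e : rel V).
Hypotheses (se : symmetric e) (ire : irreflexive e).
Implicit Types (A B C D K : {set V}).

Definition bigc A D := exists x, [/\ x \in A, D = comp e A x & #|V| < 2 * #|D|].

Lemma bigc_sub A D : bigc A D -> D \subset A.
Proof. by case=> x [xA -> _]; apply: comp_sub. Qed.

Lemma bigc_cset A D : bigc A D -> cset e D.
Proof. by case=> x [xA -> _]; apply: comp_cset. Qed.

Lemma bigc_meet A D A' D' : bigc A D -> bigc A' D' -> exists v, v \in D :&: D'.
Proof.
move=> [_ [_ _ b]] [_ [_ _ b']]; apply/set0Pn; apply: contraTneq b => E.
have := cardsUI D D'; rewrite E cards0 addn0 => EU.
have : #|D :|: D'| <= #|V| by apply: max_card.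
by rewrite -leqNgt; move: b' EU; clear; lia.
Qed.

Lemma bigc_nonempty A D : bigc A D -> exists v, v \in D.
Proof. by move=> b; have [v /setIP[]] := bigc_meet b b; exists v. Qed.

Lemma bigc_closed A D u v : bigc A D -> u \in D -> v \in A -> e u v -> v \in D.
Proof.
by move=> [x [xA -> _]] uD vA; apply: (comp_step uD) => //; apply: (subsetP (comp_sub e xA)).
Qed.

Lemma bigc_absorb A D K v : bigc A D -> cset e K -> K \subset A -> v \in K -> v \in D -> K \subset D.
Proof.
move=> [x [xA -> _]] /csetP cK KA vK vD; apply/subsetP => w wK.
by move: vD; rewrite !inE => xv; apply: connect_trans xv (rst_sub KA (cK v w vK wK)).
Qed.

Lemma bigc_within A A' D : bigc A D -> D \subset A' -> exists2 D', bigc A' D' & D \subset D'.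
Proof.
move=> bD DA; have [x xD] := bigc_nonempty bD.
have sub : D \subset comp e A' x.
  apply/subsetP => y yD; rewrite inE; apply: (rst_sub DA).
  exact: (csetP _ _ (bigc_cset bD)).
exists (comp e A' x) => //; exists x; split=> //; first exact: (subsetP DA).
by case: bD => _ [_ _ b]; apply: leq_trans b _; rewrite leq_mul2l subset_leq_card.
Qed.

(** Two majorities share a vertex, so the connected set [D] is absorbed by [D']. *)
Lemma bigc_sub_big A D A' D' : bigc A D -> bigc A' D' -> D \subset A' -> D \subset D'.
Proof.
move=> b b' DA; have [v /setIP[vD vD']] := bigc_meet b b'.
exact: bigc_absorb b' (bigc_cset b) DA vD vD'.
Qed.

Lemma cycle_at_bcyc B C b y1 y2 : (forall c, ~ bcyc e B (mem C) c) -> b \in B -> b \in C ->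
  y1 != y2 -> y1 \in C -> y2 \in C -> e b y1 -> e b y2 ->
  connect (rst e (C :\ b)) y1 y2 -> False.
Proof.
move=> nb bB bC y12 y1C y2C e1 e2 con.
have [c [uc cc sc sub]] := rst_cycle_core se ire bC y12 y1C y2C e1 e2 con.
apply: (nb (b :: c)); split=> //; first by apply/allP.
by rewrite /= bB.
Qed.

Section CentralVertices.
Variables (A B C : {set V}).
Hypothesis bigC : bigc A C.
Hypothesis noB : forall c, ~ bcyc e B (mem C) c.
Hypothesis cutB : forall b, b \in B -> b \in C -> exists D, bigc (C :\ b) D.

(** In the absence of rooted cycles the vertices of [B] in [C] act as cut vertices. The central
    vertices lie on the majority side of all these cuts, and they replace the whole of [C] when a
    branch is chosen. *)
Definition central v := [/\ v \in C, v \notin B &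
  forall b D, b \in B -> b \in C -> bigc (C :\ b) D -> v \in D].

(* Take a cut vertex [b] whose majority component [D] is smallest; a neighbour of [b] in [D]
   is central. *)
Lemma central_ex : exists v, central v.
Proof.
have [[b0 [b0B b0C]]|noBC] := EM (exists b, b \in B /\ b \in C); last first.
  have [v vC] := bigc_nonempty bigC; exists v; split=> //.
    by apply/negP => vB; apply: noBC; exists v.
  by move=> b D bB bC; case: noBC; exists b.
pose Q m := exists b D, [/\ b \in B, b \in C, bigc (C :\ b) D & #|D| = m].
have exQ : exists m, `[< Q m >].
  by have [D0 bD0] := cutB b0B b0C; exists #|D0|; apply/asboolP; exists b0, D0.
case: (ex_minnP exQ) => m /asboolP[b [D [bB bC bD cD]]] minm.
have minD b' D' : b' \in B -> b' \in C -> bigc (C :\ b') D' -> ~ D' \proper D.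
  move=> b'B b'C bD' /proper_card; rewrite cD ltnNge minm //.
  by apply/asboolP; exists b', D'.
have [z zD] := bigc_nonempty bD; have DCb := bigc_sub bD.
have bnD : b \notin D by apply/negP => /(subsetP DCb); rewrite !inE eqxx.
have DC : D \subset C by apply: subset_trans DCb (subsetDl _ _).
have [y yD eby] : exists2 y, y \in D & e b y.
  have con := csetP _ _ (bigc_cset bigC) z b (subsetP DC z zD) bC.
  have [u [v [/setIP[uD _] /setDP[vC vD] euv]]] := connect_cross con zD bnD.
  suff E : v = b by exists u; rewrite // se -E.
  by apply/eqP/negPn/negP => vb; case/negP: vD; apply: (bigc_closed bD uD _ euv); rewrite !inE vb.
have yC := subsetP DC y yD.
(* Without [b], the component [D'] would lie inside [D] and miss [b'], so it would be smaller than
   [D]. *)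
have small b' D' : b' \in B -> b' \in C -> bigc (C :\ b') D' -> b' \in D -> b \notin D' -> False.
  move=> b'B b'C bD' b'D bD'n; apply: (minD b' D') => //; apply/properP; split.
    apply: (bigc_sub_big bD' bD); apply/subsetP => w wD'; rewrite in_setD1.
    have := subsetP (bigc_sub bD') w wD'; rewrite in_setD1 => /andP[_ ->]; rewrite andbT.
    by apply: contraNneq bD'n => <-.
  by exists b' => //; apply/negP => /(subsetP (bigc_sub bD')); rewrite !inE eqxx.
(* If [y] were in [B], its majority component [D'] would contain [b] by [small], and it meets [D].
   It can leave [D] only towards [b], which gives a second neighbour [u] of [b] in [D] and a rooted
   cycle through [u], [b] and [y]. *)
have yB : y \notin B.
  apply/negP => yB; have [D' bD'] := cutB yB yC.
  have [bD'in|] := boolP (b \in D'); last exact: (small y D' yB yC bD' yD).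
  have [w /setIP[wD wD']] := bigc_meet bD bD'.
  have con := csetP _ _ (bigc_cset bD') w b wD' bD'in.
  have [u [v [/setIP[uD uD'] /setDP[vD' vD] euv]]] := connect_cross con wD bnD.
  have vC : v \in C by have := subsetP (bigc_sub bD') v vD'; rewrite in_setD1 => /andP[].
  have E : v = b.
    by apply/eqP/negPn/negP => vb; case/negP: vD; apply: (bigc_closed bD uD _ euv); rewrite !inE vb.
  have yu : y != u.
    by have := subsetP (bigc_sub bD') u uD'; rewrite in_setD1 eq_sym => /andP[].
  apply: (cycle_at_bcyc noB bB bC yu yC (subsetP DC u uD) eby); first by rewrite se -E.
  exact: (rst_sub DCb (csetP _ _ (bigc_cset bD) y u yD uD)).
exists y; split=> // b' D' b'B b'C bD'.
have [b'D|b'D] := boolP (b' \in D); last first.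
  apply: (subsetP (bigc_sub_big bD bD' _)) yD; apply/subsetP => w wD; rewrite in_setD1 (subsetP DC w wD) andbT.
  by apply: contraNneq b'D => <-.
have [bD'in|] := boolP (b \in D'); last by move=> h; case: (small b' D' b'B b'C bD' b'D h).
have yb' : y != b' by apply: contraNneq yB => ->.
by apply: (bigc_closed bD' bD'in _ eby); rewrite !inE yb'.
Qed.

(** No path in [C] between [v] and [w] can pass through [b] in [B]: both ends lie in the majority
    component of [C :\ b], so the two neighbours of [b] on the path would be connected without [b],
    giving a rooted cycle. *)
Lemma central_connect v w : central v -> central w -> connect (rst e (~: B)) v w.
Proof.
move=> [vC vB vM] [wC wB wM].
have [p [pp up sp lp]] := rst_connectP vC (csetP _ _ (bigc_cset bigC) v w vC wC).
have [hB|nB] := boolP (has (mem B) (v :: p)); last first.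
  by rewrite -lp; apply: path_connect_rst => // u up'; rewrite inE; apply: (hasPn nB).
have [b bp bB] := hasP hB; exfalso; have bB' : b \in B by [].
have bv : b != v by apply: contraNneq vB => <-.
move: bp; rewrite inE (negPf bv) /= => /splitPr sp1; case: sp1 pp up sp lp => p1 [|u p2].
  by rewrite last_cat /= => _ _ _ E; rewrite -E bB' in wB.
rewrite cat_path last_cat /= => /and3P[pp1 flb /andP[ebu pp2]] up sp lp.
have bC : b \in C by apply: sp; rewrite inE mem_cat mem_head !orbT.
have [D bD] := cutB bB' bC.
have {}up : uniq ((v :: p1) ++ b :: u :: p2) by [].
have [nb1 nb2 nu1] : [/\ b \notin v :: p1, b \notin u :: p2 & u \notin v :: p1].
  move: up; rewrite cat_uniq => /and3P[_ /hasPn h /andP[h2 _]]; split=> //.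
    by apply: (h b); rewrite mem_head.
  by apply: (h u); rewrite inE mem_head orbT.
have inC x : x \in (v :: p1) ++ b :: u :: p2 -> x \in C by apply: sp.
have sub1 x : x \in v :: p1 -> x \in C :\ b.
  move=> xp; rewrite in_setD1 inC ?mem_cat ?xp // andbT.
  by apply: contraNneq nb1 => <-.
have sub2 x : x \in u :: p2 -> x \in C :\ b.
  move=> xp; rewrite in_setD1 inC ?mem_cat ?[x \in _ :: u :: _]inE ?xp ?orbT // andbT.
  by apply: contraNneq nb2 => <-.
apply: (@cycle_at_bcyc B C b (last v p1) u noB bB' bC).
- by apply: contraNneq nu1 => <-; apply: mem_last.
- by apply: inC; rewrite mem_cat mem_last.
- by apply: inC; rewrite mem_cat !inE eqxx !orbT.
- by rewrite se.
- by [].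
apply: (@connect_trans _ _ v); first by rewrite rst_connectC //; apply: path_connect_rst.
apply: (@connect_trans _ _ w); last by rewrite rst_connectC // -lp; apply: path_connect_rst.
apply: (rst_sub (bigc_sub bD)); apply: (csetP _ _ (bigc_cset bD)); [exact: vM bD|exact: wM bD].
Qed.

End CentralVertices.
(** This transfers one central vertex, found for a joint separator and the union of two bags, to
    each of the two bags separately. *)
Lemma central_sub A A' B B' C C' v : bigc A C -> bigc A' C' -> C' \subset C -> B \subset B' ->
  (forall b, b \in B' -> b \in C' -> exists D, bigc (C' :\ b) D) ->
  central B' C' v -> central B C v.
Proof.
move=> bC bC' CC BB cut [vC' vB' vM]; split.
- exact: (subsetP CC).
- by apply: contra vB'; apply: (subsetP BB).
move=> b D bB bin bD; have bB' := subsetP BB b bB.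
have [bC'in|bC'n] := boolP (b \in C').
  have [D' bD'] := cut b bB' bC'in.
  apply: (subsetP (bigc_sub_big bD' bD _)); last exact: vM bD'.
  by apply: subset_trans (bigc_sub bD') _; apply: setSD.
apply: (subsetP (bigc_sub_big bC' bD _)) => //.
apply/subsetP => w wC'; rewrite in_setD1 (subsetP CC w wC') andbT.
by apply: contraNneq bC'n => <-.
Qed.

End BigComponents.

(** * Tree decompositions *)

Lemma connect_induced (G : sgraph) (A : {set G}) (x y : {x : G | x \in A}) :
  connect (@induced_edge G A) x y = connect (rst edge A) (val x) (val y).
Proof.
apply/connectP/idP => [[p pp ->]|].
  elim: p x pp => [|z p IH] x /=; first by move=> _; apply: connect0.
  move=> /andP[xz /IH]; apply: connect_trans; apply: connect1.
  by apply/and3P; split; [exact: xz|exact: (valP x)|exact: (valP z)].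
case/connectP=> p + E; elim: p x E => [|z p IH] x /=; first by move=> /val_inj-> _; exists [::].
move=> E /andP[/and3P[exz _ zA] pp]; have [q pq lq] := IH (exist _ z zA) E pp.
by exists (exist _ z zA :: q); rewrite //= pq andbT.
Qed.

Section Tree.
Variable T : sgraph.
Hypothesis treeT : is_tree T.

(** Iterating [f] runs into a periodic orbit, which is a cycle of distinct nodes along tree edges.
    Acyclicity leaves period at most two, and period one would be a loop. *)
Lemma tree_involution (f : T -> T) : (forall t, edge t (f t)) -> exists t, f (f t) = t.
Proof.
case: treeT => /card_gt0P[t0 _] _ acy fe.
have [i [k E]] : exists i k, iter k.+1 f (iter i f t0) = iter i f t0.
  have /trajectP[i lt E] := looping_order f t0.
  exists i, (order f t0 - i).-1; rewrite prednK ?subn_gt0 // -iterD subnK ?E // ltnW //.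
set t := iter i f t0 in E; exists t.
have ex : exists k, iter k.+1 f t = t by exists k.
(* [orbitPcycle] is a list of equivalent statements: 0 says that the orbit is a cycle, 3 that some
   positive iterate returns, 4 that the iterate of exponent [order f t] returns. *)
have cyc : fcycle f (orbit f t)  := (orbitPcycle 3 0).1 ex.
have : ucycle edge (orbit f t).
  apply/andP; split; last exact: orbit_uniq.
  by apply: sub_cycle cyc => u v /eqP<-.
move=> /acy; rewrite size_orbit => o2.
have it := (orbitPcycle 3 4).1 ex.
move: it o2 (order_gt0 f t); case: (order f t) => [|[|[|n]]] //= E1 _ _.
by have := fe t; rewrite E1 edge_irrefl.
Qed.

Lemma tree_no_cycle (t t1 t2 : T) : edge t t1 -> edge t t2 ->
  connect (rst edge (~: [set t])) t1 t2 -> t1 = t2.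
Proof.
move=> e1 e2 con; apply/eqP/negPn/negP => t12.
have [_ _ acy] := treeT.
have ne u : edge t u -> u \in ~: [set t].
  by move=> eu; rewrite !inE; apply: contraTneq eu => ->; rewrite edge_irrefl.
have [p [pp up sp lp]] := rst_connectP (ne _ e1) con.
have : ucycle edge (t :: t1 :: p).
  apply/andP; split; first by rewrite /= e1 rcons_path pp lp edge_sym.
  rewrite cons_uniq up andbT; apply/negP => /sp; by rewrite !inE eqxx.
by move=> /acy; case: p lp {pp up sp} => //= E; rewrite E eqxx in t12.
Qed.
End Tree.

Section Sides.
Variables (G : sgraph) (D : tree_decomposition G).
Implicit Types (t : D) (v w : G).

(* For [v] outside [bag t]: the bags containing [v] lie in the branch at [t] through [t']. *)
Definition side t t' v := exists2 u : D, v \in bag u & connect (rst edge (~: [set t])) t' u.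

Lemma bag_connect v (u u' : D) (A : {set D}) : (forall t, v \in bag t -> t \in A) ->
  v \in bag u -> v \in bag u' -> connect (rst edge A) u u'.
Proof.
move=> vA vu vu'.
have uS : u \in [set t | v \in bag t] by rewrite inE.
have uS' : u' \in [set t | v \in bag t] by rewrite inE.
have := @td_conn G D v (exist _ u uS) (exist _ u' uS').
rewrite connect_induced /=; apply: rst_sub; apply/subsetP => t; rewrite inE; exact: vA.
Qed.

Lemma avoid_bag t v (u : D) : v \notin bag t -> v \in bag u -> u \in ~: [set t].
Proof. by move=> vt vu; rewrite !inE; apply: contraNneq vt => <-. Qed.

Lemma side_ex t v : v \notin bag t -> exists2 t', edge t t' & side t t' v.
Proof.
move=> vt; have [u vu] := td_cover D v.
have [_ con _] := td_treeP D.
have : connect (rst edge [set: D]) t u.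
  by apply: connect_sub (con t u) => a b eab; apply: connect1; rewrite /= eab !inE.
case/(rst_connectP (in_setT t)) => [[|t' p]] [pp up _ lp].
  by move: vt vu; rewrite -lp => /negPf /= ->.
move: pp => /andP[ett pp]; exists t' => //; exists u => //.
rewrite -[u]lp; apply: path_connect_rst => // z zp; rewrite !inE.
by apply: contraTneq up => <-; rewrite cons_uniq zp.
Qed.

Lemma side_uniq t t1 t2 v : v \notin bag t -> edge t t1 -> edge t t2 ->
  side t t1 v -> side t t2 v -> t1 = t2.
Proof.
move=> vt e1 e2 [u1 v1 c1] [u2 v2 c2]; apply: (tree_no_cycle (td_treeP D) e1 e2).
apply: connect_trans c1 _; rewrite rst_connectC; last exact: edge_sym.
apply: connect_trans c2 _; apply: (bag_connect (v := v)) => // s; exact: avoid_bag.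
Qed.

Lemma side_step t t' v w : edge v w -> v \notin bag t -> side t t' v -> side t t' w.
Proof.
move=> evw vt [u vu cu]; have [u0 /andP[v0 w0]] := td_edge D evw.
exists u0 => //; apply: connect_trans cu _; apply: (bag_connect (v := v)) => // s; exact: avoid_bag.
Qed.

Lemma side_connect t t' v w (A : {set G}) : A \subset ~: bag t ->
  connect (rst edge A) v w -> side t t' v -> side t t' w.
Proof.
move=> At /connectP[p pp ->]; elim: p v pp => //= z p IH v /andP[/and3P[evz vA _] pp] sv.
apply: IH pp _; apply: side_step evz _ sv; by move: (subsetP At v vA); rewrite inE.
Qed.

(** The path from [t] to [u] off [t'] starts towards a neighbour [y] other than [t'], so [v] would
    lie in two different branches at [t]. *)
Lemma side_opposite t t' v : edge t t' -> v \notin bag t -> v \notin bag t' ->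
  side t t' v -> side t' t v -> False.
Proof.
move=> ett vt vt' s1 [u vu cu].
have tt' : t \in ~: [set t'] by rewrite !inE; apply: contraTneq ett => ->; rewrite edge_irrefl.
have [[|y p] [pp up sp lp]] := rst_connectP tt' cu.
  by move: vt vu; rewrite -lp => /negPf /= ->.
move: pp => /andP[ety pp].
have s2 : side t y v.
  exists u => //; rewrite -[u]lp; apply: path_connect_rst => // z zp; rewrite !inE.
  by apply: contraTneq up => <-; rewrite cons_uniq zp.
have := sp y; rewrite !inE eqxx orbT => /(_ isT); rewrite eq_sym => /eqP[].
exact: (side_uniq vt ett ety s1 s2).
Qed.

Lemma opposite_choice (P : D -> D -> Prop) : (forall t, exists2 t', edge t t' & P t t') ->
  exists t t', [/\ edge t t', P t t' & P t' t].
Proof.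
move=> H; have H' (t : D) : exists t', edge t t' /\ P t t'.
  by have [t' ? ?] := H t; exists t'.
have [f fP] := boolp.choice H'.
have [t E] := tree_involution (td_treeP D) (fun t => (fP t).1).
exists t, (f t); split; [exact: (fP t).1|exact: (fP t).2|].
by have := (fP (f t)).2; rewrite E.
Qed.

End Sides.

(** * Induced paths and cycles *)

Lemma sg_iso_sym (G F : sgraph) : sg_iso G F -> sg_iso F G.
Proof.
case=> f [g fK gK] fe; exists g; first by exists f.
by move=> x y; rewrite -fe !gK.
Qed.

Lemma iso_mem_trans (H : graph_family) (G F : sgraph) : sg_iso G F -> iso_mem H F -> iso_mem H G.
Proof.
move=> [f bf fe] [K HK [g bg ge]]; exists K => //; exists (g \o f); first exact: bij_comp.
by move=> x y; rewrite ge fe.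
Qed.

Lemma card_induced (G : sgraph) (A : {set G}) : #|induced A| = #|A|.
Proof. by rewrite card_sig; apply: eq_card => x; rewrite !inE. Qed.

Lemma induced_iso (G F : sgraph) (A : {set G}) (h : F -> G) : injective h ->
  (forall i j, edge (h i) (h j) = edge i j) -> A = [set h i | i in F] -> sg_iso (induced A) F.
Proof.
move=> hi he EA; apply: sg_iso_sym.
have hA i : h i \in A by rewrite EA imset_f.
exists (fun i => exist _ (h i) (hA i) : induced A); last by move=> i j; rewrite -he.
apply: inj_card_bij; first by move=> i j [/hi].
by rewrite card_induced EA card_imset.
Qed.

Section InducedPaths.
Variable G : sgraph.
Implicit Types (p q : seq G) (u v w : G).

Fixpoint indpath p : bool :=
  if p is u :: p' then
    [&& indpath p', u \notin p', all (fun v => ~~ edge u v) (behead p')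
      & if p' is w :: _ then edge u w else true]
  else true.

Lemma indpath_uniq p : indpath p -> uniq p.
Proof. by elim: p => //= u p IH /and4P[/IH-> ->]. Qed.

Lemma indpath_edge u0 p i j : indpath p -> i < size p -> j < size p ->
  edge (nth u0 p i) (nth u0 p j) = (i.+1 == j) || (j.+1 == i).
Proof.
elim: p i j => [|u p IH] //= i j /and4P[/IH{}IH _ np ep].
have E0 k : k < size p -> edge u (nth u0 p k) = (k == 0).
  case: p ep np {IH} => [|w p] //= euw np; case: k => [|k] //=; rewrite ltnS => kp.
  by apply/negbTE/(allP np)/mem_nth.
case: i j => [|i] [|j] //=; rewrite ?ltnS => ip jp.
- by rewrite edge_irrefl.
- by rewrite E0 //; case: (j).
- by rewrite edge_sym E0 //; case: (i).
- exact: IH.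
Qed.

Lemma indpath_iso p : indpath p -> sg_iso (induced [set v in p]) (path_graph (size p)).
Proof.
case: p => [_|u0 p ip].
  (* [G] may have no vertex to serve as a default, so the empty path is mapped by case analysis on
     the empty type. *)
  apply: (@induced_iso _ _ _ (fun i : path_graph 0 => match i with Ordinal n lt => False_rect G (notF (etrans (esym (ltn0 n)) lt)) end)).
  - by case.
  - by case.
  - by apply/setP => v; rewrite !inE; apply/esym/imsetP => -[[]].
set l := u0 :: p in ip *.
apply: (@induced_iso _ _ _ (fun i : path_graph (size l) => nth u0 l i)).
- by move=> i j /eqP; rewrite nth_uniq ?indpath_uniq // => /eqP/val_inj.
- by move=> i j; rewrite indpath_edge.
- apply/setP => v; rewrite inE; apply/idP/imsetP => [vl|[i _ ->]]; last exact: mem_nth.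
  by exists (Ordinal (etrans (index_mem v l) vl)) => //=; rewrite nth_index.
Qed.

(** A shortest rooted cycle in [Z] is induced: a chord splits it into two shorter cycles, one of
    which still contains a root. *)
Lemma bcyc_induced (B Z : {set G}) c : bcyc edge B (mem Z) c ->
  exists A : {set G}, [/\ A \subset Z, A :&: B != set0 & exists2 l, 3 <= l & sg_iso (induced A) (cycle_graph l)].
Proof.
move=> bc; have ex : exists n, `[< exists2 d, bcyc edge B (mem Z) d & size d = n >].
  by exists (size c); apply/asboolP; exists c.
case: (ex_minnP ex) => n /asboolP[d bd sd] minn {c bc ex}.
have min_cyc d' : bcyc edge B (mem Z) d' -> n <= size d'.
  by move=> bd'; apply: minn; apply/asboolP; exists d'.
have [ud cd s3 ad hd] := bd.
have [b bin bB] := hasP hd.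
exists [set v in d]; split.
- by apply/subsetP => v; rewrite inE => /(allP ad).
- by apply/set0Pn; exists b; rewrite !inE bin.
exists (size d) => //.
(* For positions [i < j], the second alternative is the closing edge between the last position and
   the first. *)
have Eij i j : i < j < size d -> edge (nth b d i) (nth b d j) = (j == i.+1) || (j - i == (size d).-1).
  move=> /andP[ij jd].
  pose s1 := take (j - i.+1) (drop i.+1 d); pose s2 := drop j.+1 d ++ take i d.
  have E : rot i d = nth b d i :: s1 ++ nth b d j :: s2.
    have D1 : drop i.+1 d = s1 ++ nth b d j :: drop j.+1 d.
      by rewrite -[LHS](cat_take_drop (j - i.+1)) drop_drop subnK // (drop_nth b jd).
    by rewrite /rot (drop_nth b (ltn_trans ij jd)) D1 /s2 /= -catA.
  have z1 : size s1 = j - i.+1.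
    by rewrite size_takel // size_drop; move: ij jd; clear; lia.
  have z2 : size s2 = size d - j.+1 + i.
    by rewrite size_cat size_drop size_takel //; move: ij jd; clear; lia.
  have := bcyc_rot i bd; rewrite E => bd'.
  have sd' : size (nth b d i :: s1 ++ nth b d j :: s2) = n by rewrite -E size_rot.
  have -> : (j == i.+1) || (j - i == (size d).-1) = (size s1 == 0) || (size s2 == 0).
    by rewrite z1 z2; move: ij jd; clear; lia.
  apply/idP/idP => [eij|].
    have := @cyc_bypass _ edge B (@edge_sym G) _ n min_cyc _ _ _ _ [::] bd' sd'.
    case: bd' => ud' _ _ _ _ /=; rewrite eij !addn0 => /(_ isT ud' isT).
    by rewrite !leqn0; clear; case: (size s1) (size s2) => [|a] [|b'] //= /(_ isT isT)[].
  case: bd' => _ cd' _ _ _; move: cd'; rewrite /= => cd' /orP[]; rewrite size_eq0 => /eqP E0.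
    by move: cd'; rewrite E0 /= => /andP[].
  by move: cd'; rewrite E0 cats1 !rcons_path last_rcons => /andP[_]; rewrite edge_sym.
apply: (@induced_iso _ _ _ (fun i : cycle_graph (size d) => nth b d i)).
- by move=> i j /eqP; rewrite nth_uniq // => /eqP/val_inj.
- have lt (i j : 'I_(size d)) : i < j -> edge (nth b d i) (nth b d j) = cycle_edge i j.
    move=> ij; rewrite Eij ?ij ?ltn_ord // /cycle_edge -!val_eqE /=.
    rewrite [i.+1 %% _]modn_small ?(leq_ltn_trans ij) //.
    have jd := ltn_ord j; move: (nat_of_ord i) (nat_of_ord j) ij jd => i' j' ij jd.
    have [jl|jl] := ltnP j'.+1 (size d).
      have arith a c l : a < c -> c.+1 < l ->
        (c == a.+1) || (c - a == l.-1) = (a != c) && ((c == a.+1) || (a == c.+1)) by clear; lia.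
      by rewrite modn_small // arith.
    have -> : j'.+1 = size d by move: jd jl; clear; lia.
    have arith a c l : a < c -> c < l -> l <= c.+1 -> 2 < l ->
      (c == a.+1) || (c - a == l.-1) = (a != c) && ((c == a.+1) || (a == 0)) by clear; lia.
    by rewrite modnn arith.
  move=> i j; case: (ltngtP i j) => [/lt//|ji|/val_inj->].
    by rewrite edge_sym lt //= cycle_edge_sym.
  by rewrite edge_irrefl /= cycle_edge_irrefl.
- apply/setP => v; rewrite inE; apply/idP/imsetP => [vl|[i _ ->]]; last exact: mem_nth.
  by exists (Ordinal (etrans (index_mem v d) vl)) => //=; rewrite nth_index.
Qed.

Lemma packing_bound (H : graph_family) (B : {set G}) (P : {set {set G}}) :
  induced_packing H P -> rooted B P -> #|P| <= packing_number H B.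
Proof.
by move=> ip ro; apply: (@leq_bigmax_cond _ _ (fun P : {set {set G}} => #|P|)); apply/asboolP.
Qed.

(* The path is built backwards in its list: the current end [w] is next to the majority
   component left after removing the neighbourhood of the earlier vertices. *)
Lemma gyarfas_path (X C : {set G}) b m :
  (forall Y : {set G}, #|Y| <= #|X| + m -> exists D, bigc edge (~: cnb edge Y) D) ->
  bigc edge (~: cnb edge X) C -> b \in C ->
  exists p, [/\ indpath p, size p = m.+1, b \in p & {subset p <= C}].
Proof.
move=> big bC bin.
(* Only the neighbourhoods of [X] and of the tail [q] have been deleted; the current end [w] still
   sees [D], or lies in it at the start. *)
suff: exists w q D, [/\ indpath (w :: q), size q = m, b \in w :: q, {subset w :: q <= C} &
    bigc edge (~: cnb edge (X :|: [set v in q])) D /\ (w \in D \/ exists2 d, d \in D & edge w d)].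
  by case=> w [q [D [ip sq bq sub _]]]; exists (w :: q); rewrite /= sq.
elim: m big => [|m IH] big.
  exists b, [::], C; split=> //; first by rewrite mem_head.
    by move=> v; rewrite inE => /eqP->.
  rewrite (_ : [set v in [::]] = set0) ?setU0; last by apply/setP => v; rewrite !inE.
  by split=> //; left.
have [|w [q [D [ip sq bq sub [bD wD]]]]] := IH.
  by move=> Y cY; apply: big; apply: leq_trans cY _; rewrite leq_add2l.
pose Y := X :|: [set v in q]; pose Y' := X :|: [set v in w :: q].
have YY' : Y \subset Y' by apply: setUS; apply/subsetP => v; rewrite !inE => ->; rewrite orbT.
have [D' bD'] : exists D', bigc edge (~: cnb edge Y') D'.
  apply: big; apply: leq_trans (leq_card_setU _ _) _; rewrite leq_add2l -sq.
  by rewrite cardsE; apply: (card_size (w :: q)).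
have DD : D' \subset D.
  apply: (bigc_sub_big (@edge_sym G) bD' bD); apply: subset_trans (bigc_sub bD') _.
  by rewrite setCS; apply: cnbS.
have DC : D \subset C.
  apply: (bigc_sub_big (@edge_sym G) bD bC); apply: subset_trans (bigc_sub bD) _.
  by rewrite setCS; apply: cnbS; apply: subsetUl.
have wY' : w \in Y' by rewrite !inE eqxx orbT.
have wD' : w \notin D'.
  by apply/negP => /(subsetP (bigc_sub bD')); rewrite inE [w \in cnb _ _]inE wY'.
have [z zD'] := bigc_nonempty bD'.
have con : connect (rst edge (w |: D)) w z.
  have zD := subsetP DD z zD'.
  have inD a : a \in D -> connect (rst edge (w |: D)) a z.
    by move=> aD; apply: (rst_sub (subsetUr _ _) (csetP _ _ (bigc_cset (@edge_sym G) bD) a z aD zD)).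
  case: wD => [/inD//|[d dD ewd]]; apply: connect_trans (inD d dD).
  by apply: connect1; rewrite /= ewd !inE eqxx dD orbT.
have wS : w \in ~: D' by rewrite inE.
have zS : z \notin ~: D' by rewrite inE negbK.
(* [u] lies in [D] and has a neighbour in [D'] without belonging to it, so it was deleted on passing
   from [Y] to [Y']. Hence it is adjacent to [w] but to no vertex of [q], and extends the induced
   path. *)
have [u [v [/setIP[uS uA] /setDP[_ vS] euv]]] := connect_cross con wS zS.
rewrite inE negbK in vS; rewrite inE in uS.
have vN := subsetP (bigc_sub bD') v vS; rewrite inE in vN.
have uw : u != w.
  by apply: contraNneq vN => E; apply: (cnb_adj wY'); rewrite -E.
have {uA}uD : u \in D by move: uA; rewrite !inE (negPf uw).
have uN : u \notin cnb edge Y by have := subsetP (bigc_sub bD) u uD; rewrite inE.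
have euw : edge u w.
  have : u \in cnb edge Y'.
    apply: contraR uS => uN'; apply: (bigc_closed bD' vS); first by rewrite inE.
    by rewrite edge_sym.
  have -> : Y' = w |: Y by apply/setP => a; rewrite !inE orbCA.
  rewrite !inE (negPf uw) /= => /orP[uY|/exists_inP[a]].
    by case/negP: uN; rewrite inE; apply/orP; left; rewrite !inE.
  rewrite !inE => /orP[/eqP->|aY]; first by rewrite edge_sym.
  by move=> eau; case/negP: uN; apply: (cnb_adj (x := a)) => //; rewrite !inE.
have nq a : a \in q -> ~~ edge u a /\ u != a.
  move=> aq; have aY : a \in Y by rewrite !inE aq orbT.
  split; first by apply: contra uN => eua; apply: (cnb_adj aY); rewrite edge_sym.
  by apply: contraNneq uN => ->; rewrite inE aY.
exists u, (w :: q), D'; split=> //.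
- rewrite [indpath _]/= -/(indpath (w :: q)) ip euw andbT /= inE negb_or uw /=.
  apply/andP; split; last by apply/allP => a /nq[].
  by apply/negP => /nq[_]; rewrite eqxx.
- by rewrite /= sq.
- by rewrite inE bq orbT.
- by move=> a; rewrite inE => /orP[/eqP->|/sub//]; apply: (subsetP DC).
- by split=> //; right; exists v.
Qed.

End InducedPaths.

(** * Separators from packings *)

Lemma unbalanced_bigc (G : sgraph) (X : {set G}) :
  ~ balanced_separator (closed_nbhd X) -> exists D, bigc edge (~: cnb edge X) D.
Proof.
move=> nb; have [//|no] := EM (exists D, bigc edge (~: cnb edge X) D).
case: nb => C /imsetP[x _ ->]; rewrite leqNgt; apply/negP => lt; apply: no.
exists (comp edge (~: cnb edge X) (val x)); exists (val x); split=> //; first exact: (valP x).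
apply: leq_trans lt _; rewrite leq_mul2l /= -(card_imset _ val_inj); apply: subset_leq_card.
apply/subsetP => y /imsetP[z]; rewrite inE => xz ->; rewrite inE.
by rewrite -(connect_induced (A := ~: cnb edge X)).
Qed.

(** Adding [b] to the separator keeps a majority component, which lies in [C] and misses [b]. In the
    cycle case this is what the extra one in [2 * K + 1] pays for. *)
Lemma cut_bigc (V : finType) (e : rel V) (X C : {set V}) b : symmetric e ->
  (exists D, bigc e (~: cnb e (b |: X)) D) -> bigc e (~: cnb e X) C ->
  exists D, bigc e (C :\ b) D.
Proof.
move=> se [D bD] bC.
have DC : D \subset C.
  apply: (bigc_sub_big se bD bC); apply: subset_trans (bigc_sub bD) _.
  by rewrite setCS; apply: cnbS; apply: subsetUr.
have [|D' bD' _] := bigc_within se bD (A' := C :\ b); last by exists D'.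
apply/subsetP => v vD; rewrite in_setD1 (subsetP DC) // andbT.
have := subsetP (bigc_sub bD) v vD; rewrite inE; apply: contraNneq => ->.
by rewrite inE setU11.
Qed.

Lemma bcyc_sub (V : finType) (e : rel V) (B B' : {set V}) (P P' : pred V) c :
  subpred P P' -> has (mem B') c -> bcyc e B P c -> bcyc e B' P' c.
Proof. by move=> PP hB' [uc cc sc ac _]; split=> //; apply: (sub_all PP ac). Qed.

Section Bounds.
Variables (H : graph_family) (G : sgraph) (D : tree_decomposition G) (k : nat).
Hypothesis k0 : 0 < k.
Hypothesis Hk : forall t : D, packing_number H (bag t) <= k.

Lemma path_separator m : contains_path H m ->
  exists2 X : {set G}, balanced_separator (closed_nbhd X) & #|X| <= 2 * k * m.
Proof.
move=> [m0 Hm]; have [//|no] := EM (exists2 X : {set G}, balanced_separator (closed_nbhd X) & #|X| <= 2 * k * m).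
have big (Y : {set G}) : #|Y| <= 2 * k * m -> exists C, bigc edge (~: cnb edge Y) C.
  by move=> cY; apply: unbalanced_bigc => bal; apply: no; exists Y.
pose R (t t' : D) := exists X C : {set G}, [/\ #|X| <= k * m, bigc edge (~: cnb edge X) C &
  forall v, v \in C -> v \notin bag t /\ side t t' v].
suff HR : forall t, exists2 t', edge t t' & R t t'.
  have [t [t' [ett [X [C [cX bC s1]]] [X' [C' [cX' bC' s2]]]]]] := opposite_choice HR.
  have [|Y bY] := big (X :|: X').
    by apply: leq_trans (leq_card_setU _ _) _; move: cX cX'; clear; lia.
  have [v vY] := bigc_nonempty bY.
  have [|v1 sv1] := s1 v; [apply: (subsetP (bigc_sub_big _ bY bC _)) vY|have [|v2 sv2] := s2 v].
  - exact: edge_sym.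
  - by apply: subset_trans (bigc_sub bY) _; rewrite setCS cnbS // subsetUl.
  - apply: (subsetP (bigc_sub_big _ bY bC' _)) vY; first exact: edge_sym.
    by apply: subset_trans (bigc_sub bY) _; rewrite setCS cnbS // subsetUr.
  by case: (side_opposite ett v1 v2 sv1 sv2).
move=> t; pose good (P : {set {set G}}) := [/\ {in P, forall A, sg_iso (induced A) (path_graph m)},
  rooted (bag t) P & {in P &, forall A A', A != A' -> anticomplete A A'}].
have goodk P : good P -> #|P| <= k.
  move=> [iP rP aP]; apply: leq_trans (Hk t); apply: packing_bound => //; split=> //.
  by move=> A AP; apply: iso_mem_trans (iP A AP) Hm.
pose Q n := `[< exists2 P, good P & #|P| = n >].
have exQ : exists n, Q n.
  by exists 0; apply/asboolP; exists set0; rewrite ?cards0 //; split=> A; rewrite inE.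
have boundQ n : Q n -> n <= k by move=> /asboolP[P gP <-]; apply: goodk.
case: (ex_maxnP exQ boundQ) => n /asboolP[P gP cP] maxP.
have [iP rP aP] := gP; pose X := cover P.
have cX : #|X| <= k * m.
  have [h _] := leq_card_cover P; apply: leq_trans h _.
  apply: leq_trans (_ : #|P| * m <= _); last by rewrite leq_mul2r goodk ?orbT.
  rewrite -sum_nat_const; apply: leq_sum => A /iP[f bf _].
  by rewrite -card_induced (bij_eq_card bf) card_ord.
have [|C bC] := big X; first by apply: leq_trans cX _; rewrite -mulnA leq_pmull.
have notin b : b \in C -> b \notin bag t.
  move=> bC0; apply/negP => bt.
  have [Y cY|p [ip sp bp subp]] := @gyarfas_path G X C b m.-1 _ bC bC0.
    (* The sets tried have at most [k * m + m.-1] vertices, which is within [2 * k * m] because [k]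
       is positive. *)
    by apply: big; apply: leq_trans cY _; move: cX k0 m0; clear; nia.
  rewrite prednK // in sp; pose A0 := [set v in p].
  have inX v A : A \in P -> v \in A -> v \in X.
    by move=> AP vA; apply/bigcupP; exists A.
  have out v : v \in A0 -> v \notin cnb edge X.
    by rewrite inE => /subp/(subsetP (bigc_sub bC)); rewrite inE.
  have outX v : v \in A0 -> v \notin X by move=> /out; apply: contra => vX; rewrite inE vX.
  have A0P : A0 \notin P.
    have bA0 : b \in A0 by rewrite inE.
    by apply/negP => /inX/(_ bA0) bX; have := outX b bA0; rewrite bX.
  have far A : A \in P -> anticomplete A A0 /\ anticomplete A0 A.
    move=> AP; have dis : [disjoint A & A0].
      by rewrite disjoints_subset; apply/subsetP => v /(inX v A AP) vX; rewrite inE; apply: contraL vX => /outX.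
    have ne x y : x \in A -> y \in A0 -> ~~ edge x y.
      by move=> xA /out; apply: contra => exy; apply: cnb_adj (inX x A AP xA) exy.
    split; split=> //; first by rewrite disjoint_sym.
    by move=> x y xA0 yA; rewrite edge_sym ne.
  have : n.+1 <= n.
    apply: maxP; apply/asboolP; exists (A0 |: P); last by rewrite cardsU1 A0P cP.
    split.
    - by move=> A /setU1P[->|/iP//]; rewrite -sp; apply: indpath_iso.
    - by move=> A /setU1P[->|/rP//]; apply/set0Pn; exists b; rewrite !inE bp.
    - move=> A A' /setU1P[->|AP] /setU1P[->|A'P]; rewrite ?eqxx // => AA.
      + by have [] := far A' A'P.
      + by have [] := far A AP.
      + exact: aP.
  by rewrite ltnn.
have [v0 v0C] := bigc_nonempty bC.
have [t' ett s0] := side_ex (notin v0 v0C).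
exists t' => //; exists X, C; split=> // v vC; split; first exact: notin.
apply: (side_connect (A := C) _ _ s0).
  by apply/subsetP => w /notin; rewrite inE.
exact: (csetP _ _ (bigc_cset (@edge_sym G) bC)).
Qed.

(** Each packed set contains an induced cycle meeting the bag. The chosen cycles inherit
    anticompleteness, and being nonempty they are distinct, so they form an induced packing of the
    same size. *)
Lemma bag_cycle_packing (t : D) (P : {set {set G}}) : contains_all_cycles H ->
  cycle_packing edge (bag t) P -> #|P| <= k.
Proof.
move=> Hc [P1 P2].
have choose Z : exists A : {set G}, Z \in P ->
    [/\ A \subset Z, A :&: bag t != set0 & iso_mem H (induced A)].
  have [ZP|nZ] := boolP (Z \in P); last by exists Z.
  have [c /bcyc_induced[A [AZ AB [l l3 il]]]] := P1 Z ZP.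
  by exists A => _; split=> //; apply: iso_mem_trans il (Hc l l3).
have [g gP] := boolp.choice choose.
have anti Z Z' : Z \in P -> Z' \in P -> Z != Z' -> anticomplete (g Z) (g Z').
  move=> ZP Z'P ZZ; have [s1 _ _] := gP Z ZP; have [s2 _ _] := gP Z' Z'P; split.
    rewrite disjoints_subset; apply/subsetP => v vg; rewrite inE; apply/negP => vg'.
    by have [] := P2 Z Z' v v ZP Z'P ZZ (subsetP s1 v vg) (subsetP s2 v vg'); rewrite eqxx.
  by move=> u v /(subsetP s1) uZ /(subsetP s2) vZ'; have [] := P2 Z Z' u v ZP Z'P ZZ uZ vZ'.
have gi : {in P &, injective g}.
  move=> Z Z' ZP Z'P E; apply/eqP/negPn/negP => ZZ.
  have [dis _] := anti Z Z' ZP Z'P ZZ; have [_ /set0Pn[v /setIP[vg _]] _] := gP Z ZP.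
  by move: (disjointFr dis vg); rewrite -E vg.
rewrite -(card_in_imset gi); apply: leq_trans (Hk t); apply: packing_bound.
  split; first by move=> A /imsetP[Z /gP[_ _ ?] ->].
  move=> A A' /imsetP[Z ZP ->] /imsetP[Z' Z'P ->] gg; apply: anti => //.
  by apply: contraNneq gg => ->.
by move=> A /imsetP[Z /gP[_ ? _] ->].
Qed.

Lemma cycle_separator K : contains_all_cycles H ->
  33 * (68 * (6 * (5 ^ 5 * 2) * k.+1)) ^ 2 + 11 * k <= K ->
  exists2 X : {set G}, balanced_separator (closed_nbhd X) & #|X| <= 2 * K + 1.
Proof.
move=> Hc leK; have [//|no] := EM (exists2 X : {set G}, balanced_separator (closed_nbhd X) & #|X| <= 2 * K + 1).
have se := @edge_sym G; have ire := @edge_irrefl G.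
have big (Y : {set G}) : #|Y| <= 2 * K + 1 -> exists C, bigc edge (~: cnb edge Y) C.
  by move=> cY; apply: unbalanced_bigc => bal; apply: no; exists Y.
have cut (Y C : {set G}) b : #|Y| <= 2 * K -> bigc edge (~: cnb edge Y) C ->
    exists D', bigc edge (C :\ b) D'.
  move=> cY; apply: cut_bigc => //; apply: big.
  by rewrite cardsU1; move: cY; case: (b \notin Y); clear; lia.
pose R (t t' : D) := exists X C : {set G}, [/\ #|X| <= K, bigc edge (~: cnb edge X) C,
  forall c, ~ bcyc edge (bag t) (mem C) c &
  forall v, central edge (bag t) C v -> v \notin bag t /\ side t t' v].
suff HR : forall t, exists2 t', edge t t' & R t t'.
  have [t [t' [ett [X [C [cX bC n1 s1]]] [X' [C' [cX' bC' n2 s2]]]]]] := opposite_choice HR.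
  have cY : #|X :|: X'| <= 2 * K.
    by apply: leq_trans (leq_card_setU _ _) _; move: cX cX'; clear; lia.
  have [|Y bY] := big (X :|: X'); first by rewrite (leq_trans cY) // leq_addr.
  have YC : Y \subset C.
    apply: (bigc_sub_big se bY bC); apply: subset_trans (bigc_sub bY) _.
    by rewrite setCS cnbS // subsetUl.
  have YC' : Y \subset C'.
    apply: (bigc_sub_big se bY bC'); apply: subset_trans (bigc_sub bY) _.
    by rewrite setCS cnbS // subsetUr.
  have cutY b : b \in bag t :|: bag t' -> b \in Y -> exists D', bigc edge (Y :\ b) D'.
    by move=> _ _; apply: cut bY.
  (* A cycle rooted in the union of the bags is rooted in one of them, which [n1] and [n2] exclude,
     so the joint majority component has a central vertex. *)
  have [c bc|v cv] := @central_ex G edge se ire _ (bag t :|: bag t') Y bY _ cutY.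
    have : has (mem (bag t)) c || has (mem (bag t')) c.
      rewrite -has_predU; case: bc => _ _ _ _; apply: sub_has => x /=.
      by rewrite inE.
    case/orP=> hB.
      by apply: (n1 c); apply: bcyc_sub hB bc => x; apply: (subsetP YC).
    by apply: (n2 c); apply: bcyc_sub hB bc => x; apply: (subsetP YC').
  have [v1 sv1] := s1 v (central_sub se bC bY YC (subsetUl _ _) cutY cv).
  have [v2 sv2] := s2 v (central_sub se bC' bY YC' (subsetUr _ _) cutY cv).
  by case: (side_opposite ett v1 v2 sv1 sv2).
move=> t.
have [X [cX nX]] := rooted_erdos_posa se ire (fun P => @bag_cycle_packing t P Hc).
have {}cX : #|X| <= K := leq_trans cX leK.
have cX2 : #|X| <= 2 * K by move: cX; clear; lia.
have [|C bC] := big X; first by move: cX; clear; lia.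
have nC c : ~ bcyc edge (bag t) (mem C) c.
  move=> bc; apply: (nX c); have [_ _ _ _ hB] := bc; apply: bcyc_sub hB bc => x xC.
  by have := subsetP (bigc_sub bC) x xC; rewrite inE.
have cutC b : b \in bag t -> b \in C -> exists D', bigc edge (C :\ b) D'.
  by move=> _ _; apply: cut bC.
have [v0 cv0] := central_ex se ire bC nC cutC.
have [_ v0t _] := cv0; have [t' ett s0] := side_ex v0t.
exists t' => //; exists X, C; split=> // v cv; have [_ vt _] := cv; split=> //.
exact: (side_connect (subxx _) (central_connect se ire bC nC cutC cv0 cv) s0).
Qed.

End Bounds.

(** For positive [k] the factor [k.+1] is at most [2 * k], which makes the bound homogeneous. *)
Lemma packing_bound_quadratic : exists q, forall k, 0 < k ->
  33 * (68 * (6 * (5 ^ 5 * 2) * k.+1)) ^ 2 + 11 * k <= q * (k * k).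
Proof.
move: (6 * _) => d; exists (33 * (68 * (d * 2)) ^ 2 + 11) => k k0.
have : d * k.+1 <= d * 2 * k by nia.
rewrite -!mulnn; move: (d * k.+1) (d * 2) => a b ab.
have : 68 * a * (68 * a) <= 68 * b * (68 * b) * (k * k) by nia.
nia.
Qed.

Local Open Scope ring_scope.
Import Order.TTheory GRing.Theory Num.Theory.

Lemma log2_ge1 (R : realType) (n : nat) : (2 <= n)%N -> 1 <= log2 (n%:R : R).
Proof.
move=> n2; have l2 : 0 < ln (2 : R) by rewrite ln_gt0 // ltr1n.
rewrite /log2 ler_pdivlMr // mul1r ler_ln ?posrE ?ltr0n ?(ltn_trans _ n2) //.
by rewrite ler_nat.
Qed.

Theorem theorem1p7 (R : realType) :
  exists c1 c2 : R, forall (H : graph_family) (G : sgraph) (k : nat),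
    (1 <= k)%N -> (2 <= #|G|)%N -> (tree_packing_number H G <= k)%N ->
    exists X : {set G},
      [/\ balanced_separator (closed_nbhd X),
          (forall t : nat, contains_path H t -> #|X|%:R <= c1 * k%:R * t%:R) &
          (contains_all_cycles H ->
           #|X|%:R <= c2 * k%:R ^+ 3 * log2 #|G|%:R)].
Proof.
have [q qP] := packing_bound_quadratic.
exists 2%:R, (2 * q + 1)%:R => H G k k1 n2 tk.
have [D Dk] : exists D : tree_decomposition G, (td_packing_number H D <= k)%N.
  move: tk; rewrite /tree_packing_number; case: ex_minnP => m /asboolP[D <-] _ h.
  by exists D.
have Hk (t : D) : (packing_number H (bag t) <= k)%N.
  by apply: leq_trans Dk; apply: (leq_bigmax (F := fun t : D => packing_number H (bag t))).
(* The whole vertex set is a balanced separator, so a smallest one exists. Taking it lets a single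
   [X] satisfy the path bound for all [t] and the cycle bound at once. *)
have ex : exists n, `[< exists2 X : {set G}, balanced_separator (closed_nbhd X) & #|X| = n >].
  exists #|[set: G]|; apply/asboolP; exists [set: G] => //.
  by move=> C /imsetP[x _ _]; have := valP x; rewrite !inE.
case: (ex_minnP ex) => n /asboolP[X bX cX] minX; exists X; split=> //.
  move=> t /(path_separator k1 Hk)[Y bY cY].
  rewrite -!natrM ler_nat cX (leq_trans _ cY) //; apply: minX; apply/asboolP.
  by exists Y.
move=> Hc; have [Y bY cY] := cycle_separator Hk Hc (qP k k1).
have le : (#|X| <= (2 * q + 1) * k ^ 3)%N.
  rewrite cX (leq_trans (minX #|Y| _)) //; first by apply/asboolP; exists Y.
  apply: leq_trans cY _; move: k1; clear; rewrite !expnS expn0 muln1.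
  by have : (k * k <= k * (k * k))%N; nia.
apply: le_trans (_ : ((2 * q + 1) * k ^ 3)%N%:R <= _); first by rewrite ler_nat.
rewrite natrM natrX ler_peMr ?mulr_ge0 ?exprn_ge0 ?ler0n //.
exact: log2_ge1.
Qed.
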